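(* Let $k$ be a number field, let $E/k$ be an elliptic curve, let $v$ be a non-archimedean place of $k$, and let $\Delta_v\in\mathcal{O}_v$ be the discriminant of a minimal Weierstrass equation for $E/k_v$. If $Z=\{P_1,\dots,P_N\}\subset E(k_v)$ is a set of $N$ distinct $k_v$-rational points, then \[ \Lambda_v(Z)\geq\Big(\frac{1}{c_v^2}-\frac{1}{N}\Big)\frac{1}{12}\log|1/\Delta_v|_v, \] where $\Lambda_v(Z)=\frac{1}{N^2}\sum_{1\le i,j\le N,\, i\neq j}\lambda_v(P_i-P_j)$.
   Context: $k_v$ is the completion of $k$ at $v$, $\mathcal{O}_v$ its ring of integers, and $|\cdot|_v$ is the absolute value on $k_v$ whose restriction to $\mathbb{Q}$ is the usual $p$-adic absolute value, $p$ the prime below $v$. $\lambda_v:E(k_v)\setminus\{O\}\to\mathbb{R}$ is the Néron local height function, normalized as in Silverman, Advanced Topics in the Arithmetic of Elliptic Curves, Ch. VI (independent of the Weierstrass equation; in particular $\lambda_v(P)\ge \frac1{12}\log|1/\Delta_v|_v$ for $P\neq O$ with nonsingular reduction). $E_0(k_v)$ is the subgroup of points of $E(k_v)$ whose reduction modulo a minimal Weierstrass equation is nonsingular, and $c_v=|E(k_v)/E_0(k_v)|$. *)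

(* Defs.v *)
From HB Require Import structures.
From mathcomp Require Import all_boot all_order all_algebra all_field.
From mathcomp Require Import reals exp.
Set Implicit Arguments. Unset Strict Implicit. Unset Printing Implicit Defensive.
Import Order.TTheory GRing.Theory Num.Theory.
Local Open Scope ring_scope.

Record wcoef (F : Type) := WCoef { wa1 : F; wa2 : F; wa3 : F; wa4 : F; wa6 : F }.

Definition map_wcoef (F G : Type) (f : F -> G) (W : wcoef F) : wcoef G :=
  WCoef (f (wa1 W)) (f (wa2 W)) (f (wa3 W)) (f (wa4 W)) (f (wa6 W)).

Section Weierstrass.
Variable K : fieldType.
Implicit Types (W : wcoef K).

Definition wb2 W := wa1 W ^+ 2 + 4%:R * wa2 W.
Definition wb4 W := 2%:R * wa4 W + wa1 W * wa3 W.
Definition wb6 W := wa3 W ^+ 2 + 4%:R * wa6 W.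
Definition wb8 W := wa1 W ^+ 2 * wa6 W + 4%:R * wa2 W * wa6 W - wa1 W * wa3 W * wa4 W
                    + wa2 W * wa3 W ^+ 2 - wa4 W ^+ 2.
Definition disc W := - wb2 W ^+ 2 * wb8 W - 8%:R * wb4 W ^+ 3 - 27%:R * wb6 W ^+ 2
                     + 9%:R * wb2 W * wb4 W * wb6 W.

(** points of E(K): [None] is the point at infinity O, [Some (x,y)] an affine point *)
Definition on_curve W (P : option (K * K)) : bool :=
  match P with
  | None => true
  | Some (x, y) => y ^+ 2 + wa1 W * x * y + wa3 W * y ==
                   x ^+ 3 + wa2 W * x ^+ 2 + wa4 W * x + wa6 W
  end.

(** group law (Silverman, AEC, III.2.3) *)
Definition negpt W (P : option (K * K)) : option (K * K) :=
  match P with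
  | None => None
  | Some (x, y) => Some (x, - y - wa1 W * x - wa3 W)
  end.

Definition addpt W (P Q : option (K * K)) : option (K * K) :=
  match P, Q with
  | None, _ => Q
  | _, None => P
  | Some (x1, y1), Some (x2, y2) =>
    if (x1 == x2) && (y1 + y2 + wa1 W * x2 + wa3 W == 0) then None
    else
      let l := if x1 != x2 then (y2 - y1) / (x2 - x1)
               else (3%:R * x1 ^+ 2 + 2%:R * wa2 W * x1 + wa4 W - wa1 W * y1)
                    / (2%:R * y1 + wa1 W * x1 + wa3 W) in
      let n := if x1 != x2 then (y1 * x2 - y2 * x1) / (x2 - x1)
               else (- x1 ^+ 3 + wa4 W * x1 + 2%:R * wa6 W - wa3 W * y1)
                    / (2%:R * y1 + wa1 W * x1 + wa3 W) in
      let x3 := l ^+ 2 + wa1 W * l - wa2 W - x1 - x2 in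
      Some (x3, - (l + wa1 W) * x3 - n - wa3 W)
  end.

(** change of variables  x = u^2 x' + r,  y = u^3 y' + s u^2 x' + t  (Silverman, Table 3.1) *)
Definition chg W (u r s t : K) : wcoef K :=
  WCoef ((wa1 W + 2%:R * s) / u)
        ((wa2 W - s * wa1 W + 3%:R * r - s ^+ 2) / u ^+ 2)
        ((wa3 W + r * wa1 W + 2%:R * t) / u ^+ 3)
        ((wa4 W - s * wa3 W + 2%:R * r * wa2 W - (t + r * s) * wa1 W
          + 3%:R * r ^+ 2 - 2%:R * s * t) / u ^+ 4)
        ((wa6 W + r * wa4 W + r ^+ 2 * wa2 W + r ^+ 3 - t * wa3 W - t ^+ 2
          - r * t * wa1 W) / u ^+ 6).

Definition chg_pt (u r s t : K) (P : option (K * K)) : option (K * K) :=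
  match P with
  | None => None
  | Some (x, y) => Some ((x - r) / u ^+ 2, (y - s * (x - r) - t) / u ^+ 3)
  end.

End Weierstrass.

Section Valued.
Variables (R : realType) (K : fieldType) (abs : K -> R).
Implicit Types (W : wcoef K).

Definition is_nonarch_abs : Prop :=
  [/\ forall x, 0 <= abs x,
      forall x, abs x = 0 <-> x = 0,
      forall x y, abs (x * y) = abs x * abs y &
      forall x y, abs (x + y) <= Num.max (abs x) (abs y)].

Definition abs_complete : Prop :=
  forall f : nat -> K,
    (forall e : R, 0 < e -> exists n0, forall m n, (n0 <= m)%N -> (n0 <= n)%N ->
        abs (f m - f n) < e) ->
    exists l, forall e : R, 0 < e -> exists n0, forall n, (n0 <= n)%N -> abs (f n - l) < e.

Definition abs_dense (k : Type) (iota : k -> K) : Prop :=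
  forall x (e : R), 0 < e -> exists a, abs (x - iota a) < e.

Definition integral_model W : Prop :=
  [/\ abs (wa1 W) <= 1, abs (wa2 W) <= 1, abs (wa3 W) <= 1, abs (wa4 W) <= 1 &
      abs (wa6 W) <= 1].

(** the change of variables (u,r,s,t) turns W into a minimal Weierstrass equation
    (integral coefficients, |Delta| maximal i.e. v(Delta) minimal) *)
Definition is_minimal_change W (u r s t : K) : Prop :=
  [/\ u != 0, integral_model (chg W u r s t) &
      forall u' r' s' t', u' != 0 -> integral_model (chg W u' r' s' t') ->
        abs (disc (chg W u' r' s' t')) <= abs (disc (chg W u r s t))].

(** P lies in E_0(K): its reduction modulo the minimal equation (chg W u r s t)
    is nonsingular (P reduces to O, or the two partial derivatives do not both
    vanish modulo the maximal ideal at the reduction of P). *)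
Definition in_E0 W (u r s t : K) (P : option (K * K)) : Prop :=
  match chg_pt u r s t P with
  | None => True
  | Some (x, y) =>
    let M := chg W u r s t in
    1 < abs x \/
    ~ (abs (2%:R * y + wa1 M * x + wa3 M) < 1 /\
       abs (3%:R * x ^+ 2 + 2%:R * wa2 M * x + wa4 M - wa1 M * y) < 1)
  end.

(** c = |E(K)/E_0(K)| : cardinality of a complete set of coset representatives *)
Definition is_tamagawa W (u r s t : K) (c : nat) : Prop :=
  exists reps : seq (option (K * K)),
    [/\ size reps = c, all (on_curve W) reps,
        (forall i j, (i < c)%N -> (j < c)%N -> i != j ->
           ~ in_E0 W u r s t (addpt W (nth None reps i) (negpt W (nth None reps j)))) &
        forall P, on_curve W P -> exists2 Q, Q \in reps & in_E0 W u r s t (addpt W P (negpt W Q))].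

Definition lamE (lam : K * K -> R) (P : option (K * K)) : R :=
  match P with None => 0 | Some q => lam q end.

(** Néron local height, via Silverman ATAEC Thm VI.1.1 (with v(x) = - log|x|):
    (a) continuous on E(K)\{O}, bounded away from any neighbourhood of O;
    (b) lim_{P -> O} (lam P - 1/2 log|x(P)|) exists;
    (c) lam(2P) = 4 lam(P) - log|2y+a1x+a3| + 1/4 log|Delta| whenever 2P <> O. *)
Definition is_neron_local_height W (lam : K * K -> R) : Prop :=
  [/\ (forall x0 y0, on_curve W (Some (x0, y0)) -> forall e : R, 0 < e ->
         exists2 d : R, 0 < d & forall x y, on_curve W (Some (x, y)) ->
           abs (x - x0) < d -> abs (y - y0) < d -> `|lam (x, y) - lam (x0, y0)| < e),
      (forall M : R, exists B : R, forall x y, on_curve W (Some (x, y)) ->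
           abs x <= M -> `|lam (x, y)| <= B),
      (exists L : R, forall e : R, 0 < e -> exists M : R, forall x y,
           on_curve W (Some (x, y)) -> M < abs x ->
           `|lam (x, y) - 2%:R^-1 * ln (abs x) - L| < e) &
      (forall x y, on_curve W (Some (x, y)) ->
         addpt W (Some (x, y)) (Some (x, y)) != None ->
         lamE lam (addpt W (Some (x, y)) (Some (x, y))) =
           4%:R * lam (x, y) - ln (abs (2%:R * y + wa1 W * x + wa3 W))
           + 4%:R^-1 * ln (abs (disc W)))].

Definition Lambda W (lam : K * K -> R) (Z : seq (option (K * K))) : R :=
  (size Z)%:R ^- 2 *
  \sum_(i < size Z) \sum_(j < size Z | i != j)
     lamE lam (addpt W (nth None Z i) (negpt W (nth None Z j))).

End Valued.

(* Main.v *)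
Require Import Defs.
From HB Require Import structures.
From mathcomp Require Import all_boot all_order all_algebra all_field.
From mathcomp Require Import boolp reals exp.
From mathcomp Require Import ring lra.
Set Implicit Arguments. Unset Strict Implicit. Unset Printing Implicit Defensive.
Import Order.TTheory GRing.Theory Num.Theory.
Local Open Scope ring_scope.

(* Write D = -log|disc| for the minimal discriminant. On E_0 one has lam >= D/12, and
   by Cauchy-Schwarz at least N^2/c of the pairs (i, j) have P_i - P_j in E_0.

   If |j| <= 1 then lam >= 0 everywhere, and this is enough. If |j| > 1 then c_4 is a square
   in K, so the x-line of E can be brought over K to that of the curve y^2 + xy = x^3 + b,
   even though E itself need not be split multiplicative. With V = -log|b| <= D and m(P) =
   -log|x(P)| clamped to [0, V/2] one has lam(P) >= V/2 * B_2(m(P)/V), and m satisfies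
   {m(P+Q), m(P-Q)} = {|m(P)-m(Q)|, min(m(P)+m(Q), V-m(P)-m(Q))}. Hence m takes the form
   d(k, nZ) * V/n on a cyclic quotient Z/n of E(K)/E_0(K), and the kernel B_2(d/n) on Z/n is
   positive semidefinite off the constants, with mean B_2(0)/n^2; since n <= c this gives the
   bound.

   The Neron height is bounded below without constructing it: a function l with
   l(2P) >= 4 l(P) - log|2y+a_1x+a_3| + log|disc|/4, bounded by lam up to a constant, satisfies
   l <= lam, by iterating the duplication formula. On E_0, and everywhere if |j| <= 1, one takes
   for l the logarithm of max(|psi_2|^(1/3), |psi_3|^(1/8)), with psi_n the division
   polynomials, minus log|disc|/12. *)

(** * The group law *)

Section GroupLaw.
Variables (K : fieldType) (W : wcoef K).
Local Notation a1 := (wa1 W).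
Local Notation a2 := (wa2 W).
Local Notation a3 := (wa3 W).
Local Notation a4 := (wa4 W).
Local Notation a6 := (wa6 W).

Lemma on_curve_a6 x y : on_curve W (Some (x, y)) ->
  a6 = y ^+ 2 + a1 * x * y + a3 * y - (x ^+ 3 + a2 * x ^+ 2 + a4 * x).
Proof. by move=> /eqP ->; ring. Qed.

Definition curve_dx x y := 3%:R * x ^+ 2 + 2%:R * a2 * x + a4 - a1 * y.
Definition curve_dy x y := 2%:R * y + a1 * x + a3.

Lemma singular_disc0 x y : on_curve W (Some (x, y)) ->
  curve_dx x y = 0 -> curve_dy x y = 0 -> disc W = 0.
Proof.
rewrite /curve_dx /curve_dy => /on_curve_a6 e6 dx0 dy0.
have e3 : a3 = - (2%:R * y + a1 * x) by apply/eqP; rewrite -addr_eq0 -dy0; apply/eqP; ring.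
have e4 : a4 = a1 * y - 3%:R * x ^+ 2 - 2%:R * a2 * x.
  by apply/eqP; rewrite -subr_eq0 -dx0; apply/eqP; ring.
by rewrite /disc /wb8 /wb6 /wb4 /wb2 e6 e4 e3; ring.
Qed.

Lemma disc_neq0_dx x y : disc W != 0 -> on_curve W (Some (x, y)) ->
  curve_dy x y = 0 -> curve_dx x y != 0.
Proof. by move=> D0 C dy0; apply: contra_neq D0 => dx0; apply: singular_disc0 dy0. Qed.

Lemma on_curve_same_x x y1 y2 : on_curve W (Some (x, y1)) -> on_curve W (Some (x, y2)) ->
  y1 = y2 \/ y1 + y2 + a1 * x + a3 = 0.
Proof.
move=> /eqP C1 /eqP C2.
have /eqP : (y1 - y2) * (y1 + y2 + a1 * x + a3) = 0.
  transitivity ((y1 ^+ 2 + a1 * x * y1 + a3 * y1) - (y2 ^+ 2 + a1 * x * y2 + a3 * y2)).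
    by ring.
  by rewrite C1 C2 subrr.
by rewrite mulf_eq0 subr_eq0 => /orP[/eqP|/eqP]; [left | right].
Qed.

(* The two equations, taken together, are satisfied by the slope of the chord through two
   distinct points and by the slope of the tangent at a double point. *)
Definition is_slope (P Q : K * K) (l : K) : Prop :=
  Q.2 - P.2 = l * (Q.1 - P.1) /\
  l * (P.2 + Q.2 + a1 * Q.1 + a3) =
    P.1 ^+ 2 + P.1 * Q.1 + Q.1 ^+ 2 + a2 * (P.1 + Q.1) + a4 - a1 * P.2.

Definition slope_sum (P Q : K * K) (l : K) : K * K :=
  let x3 := l ^+ 2 + a1 * l - a2 - P.1 - Q.1 in
  (x3, - (l + a1) * x3 - (P.2 - l * P.1) - a3).

Lemma is_slope_y P Q l : is_slope P Q l -> Q.2 = P.2 + l * (Q.1 - P.1).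
Proof. by case=> <- _; ring. Qed.

Lemma is_slope_a4 P Q l : is_slope P Q l ->
  a4 = l * (P.2 + Q.2 + a1 * Q.1 + a3) -
    (P.1 ^+ 2 + P.1 * Q.1 + Q.1 ^+ 2 + a2 * (P.1 + Q.1) - a1 * P.2).
Proof. by case=> _ ->; ring. Qed.

Lemma is_slope_chord x1 y1 x2 y2 :
  on_curve W (Some (x1, y1)) -> on_curve W (Some (x2, y2)) -> x1 != x2 ->
  is_slope (x1, y1) (x2, y2) ((y2 - y1) / (x2 - x1)).
Proof.
move=> /eqP C1 /eqP C2 ne; have d0 : x2 - x1 != 0 by rewrite subr_eq0 eq_sym.
split => /=; first by field.
apply: (mulIf d0).
transitivity ((y2 - y1) * (y1 + y2 + a1 * x2 + a3)); first by field.
transitivity (y2 ^+ 2 + a1 * x2 * y2 + a3 * y2 - (y1 ^+ 2 + a1 * x1 * y1 + a3 * y1)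
   - a1 * y1 * (x2 - x1)); first by ring.
by rewrite C1 C2; ring.
Qed.

Lemma is_slope_tangent x y : curve_dy x y != 0 ->
  is_slope (x, y) (x, y) (curve_dx x y / curve_dy x y).
Proof.
move=> dy0; split => /=; first by ring.
have -> : y + y + a1 * x + a3 = curve_dy x y by rewrite /curve_dy; ring.
by rewrite divfK // /curve_dx; ring.
Qed.

Lemma addpt_chord x1 y1 x2 y2 : x1 != x2 ->
  addpt W (Some (x1, y1)) (Some (x2, y2)) =
  Some (slope_sum (x1, y1) (x2, y2) ((y2 - y1) / (x2 - x1))).
Proof.
move=> ne; have d0 : x2 - x1 != 0 by rewrite subr_eq0 eq_sym.
by rewrite /= (negPf ne) /slope_sum /=; congr (Some (_, _)); field.
Qed.

Lemma addpt_tangent x y : on_curve W (Some (x, y)) -> curve_dy x y != 0 ->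
  addpt W (Some (x, y)) (Some (x, y)) =
  Some (slope_sum (x, y) (x, y) (curve_dx x y / curve_dy x y)).
Proof.
move=> /on_curve_a6 e6 dy0; have dyE : y + y + a1 * x + a3 = curve_dy x y.
  by rewrite /curve_dy; ring.
rewrite /= eqxx dyE (negPf dy0) /slope_sum /= e6.
by congr (Some (_, _)); move: dy0; rewrite /curve_dx /curve_dy => dy0; field.
Qed.

Lemma addpt_dy0 x y : curve_dy x y = 0 -> addpt W (Some (x, y)) (Some (x, y)) = None.
Proof.
have -> : curve_dy x y = y + y + a1 * x + a3 by rewrite /curve_dy; ring.
by move=> /= ->; rewrite !eqxx.
Qed.

Lemma addpt0 P : addpt W P None = P.
Proof. by case: P => [[x y]|]. Qed.

Lemma addNpt P : addpt W (negpt W P) P = None.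
Proof. by case: P => [[x y]|] //=; rewrite eqxx; case: eqP => //; case; ring. Qed.

Lemma addpt_eq0 P Q : addpt W P Q = None -> Q = negpt W P.
Proof.
case: P Q => [[x1 y1]|] [[x2 y2]|] //=; case: ifP => // /andP[/eqP-> /eqP e] _.
by congr (Some (_, _)); apply/eqP; rewrite -subr_eq0 -e; apply/eqP; ring.
Qed.

Lemma negptK : involutive (negpt W).
Proof. by case=> [[x y]|] //=; congr (Some (_, _)); ring. Qed.

Lemma negpt_on_curve P : on_curve W P -> on_curve W (negpt W P).
Proof. by case: P => [[x y]|] //= /eqP C; apply/eqP; rewrite -C; ring. Qed.

Lemma slope_sum_on_curve P Q l : on_curve W (Some P) -> is_slope P Q l ->
  on_curve W (Some (slope_sum P Q l)).
Proof.
case: P Q => [x1 y1] [x2 y2] /on_curve_a6 e6 sPQ; apply/eqP.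
have /= ey := is_slope_y sPQ; have /= e4 := is_slope_a4 sPQ.
by rewrite e6 e4 ey; ring.
Qed.

Lemma is_slope_sym P Q l : is_slope P Q l -> is_slope Q P l.
Proof.
case: P Q => [x1 y1] [x2 y2] sPQ; have /= ey := is_slope_y sPQ; have /= e4 := is_slope_a4 sPQ.
by split; rewrite /= ?e4 ey; ring.
Qed.

Lemma is_slope_neg P Q l : is_slope P Q l ->
  is_slope (P.1, - P.2 - a1 * P.1 - a3) (Q.1, - Q.2 - a1 * Q.1 - a3) (- l - a1).
Proof.
case: P Q => [x1 y1] [x2 y2] sPQ; have /= ey := is_slope_y sPQ; have /= e4 := is_slope_a4 sPQ.
by split; rewrite /= ?e4 ey; ring.
Qed.

Lemma is_slope_cancel P Q l : is_slope P Q l ->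
  is_slope (slope_sum P Q l) (Q.1, - Q.2 - a1 * Q.1 - a3) (- l - a1).
Proof.
case: P Q => [x1 y1] [x2 y2] sPQ; have /= ey := is_slope_y sPQ; have /= e4 := is_slope_a4 sPQ.
by split; rewrite /slope_sum /= ?e4 ey; ring.
Qed.

Hypothesis D0 : disc W != 0.

Lemma addpt_slope P Q l : on_curve W (Some P) -> on_curve W (Some Q) -> is_slope P Q l ->
  addpt W (Some P) (Some Q) = Some (slope_sum P Q l).
Proof.
case: P Q => [x1 y1] [x2 y2] CP CQ sPQ.
have [ex|nex] := eqVneq x1 x2; last first.
  have d0 : x2 - x1 != 0 by rewrite subr_eq0 eq_sym.
  rewrite addpt_chord //; congr (Some (slope_sum _ _ _)).
  by case: sPQ => /= -> _; field.
have ey : y2 = y1 by have /= -> := is_slope_y sPQ; rewrite ex subrr mulr0 addr0.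
case: (sPQ) => _ sl; rewrite /= in sl; rewrite {}ex {}ey {sPQ CQ} in CP sl *.
have {}sl : l * curve_dy x2 y1 = curve_dx x2 y1.
  transitivity (l * (y1 + y1 + a1 * x2 + a3)); first by rewrite /curve_dy; ring.
  by rewrite sl /curve_dx; ring.
have [dy0|dy0] := eqVneq (curve_dy x2 y1) 0.
  by case/eqP: (disc_neq0_dx D0 CP dy0); rewrite -sl dy0 mulr0.
by rewrite addpt_tangent // -sl mulfK.
Qed.

Lemma addpt_slope_exists P Q : on_curve W (Some P) -> on_curve W (Some Q) ->
  addpt W (Some P) (Some Q) = None \/ exists l, is_slope P Q l.
Proof.
case: P Q => [x1 y1] [x2 y2] CP CQ.
have [ex|nex] := eqVneq x1 x2; last by right; eexists; apply: is_slope_chord.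
rewrite ex in CP *; have [->|e0] := on_curve_same_x CP CQ; last first.
  by left; rewrite /= eqxx e0 eqxx.
have [dy0|dy0] := eqVneq (curve_dy x2 y2) 0; first by left; apply: addpt_dy0.
by right; eexists; apply: is_slope_tangent.
Qed.

Lemma addpt_on_curve P Q : on_curve W P -> on_curve W Q -> on_curve W (addpt W P Q).
Proof.
case: P Q => [P|] [Q|]; rewrite ?addpt0 // => CP CQ.
have [-> //|[l sPQ]] := addpt_slope_exists CP CQ.
by rewrite (addpt_slope CP CQ sPQ); apply: slope_sum_on_curve.
Qed.

Lemma addptC P Q : on_curve W P -> on_curve W Q -> addpt W P Q = addpt W Q P.
Proof.
case: P Q => [P|] [Q|]; rewrite ?addpt0 // => CP CQ.
have [e|[l sPQ]] := addpt_slope_exists CP CQ; first by rewrite e (addpt_eq0 e) addNpt.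
rewrite (addpt_slope CP CQ sPQ) (addpt_slope CQ CP (is_slope_sym sPQ)).
case: P Q sPQ {CP CQ} => [x1 y1] [x2 y2] /is_slope_y /= ->; rewrite /slope_sum /=.
by congr (Some (_, _)); ring.
Qed.

Lemma negptD P Q : on_curve W P -> on_curve W Q ->
  negpt W (addpt W P Q) = addpt W (negpt W P) (negpt W Q).
Proof.
case: P Q => [P|] [Q|]; rewrite ?addpt0 // => CP CQ.
have CP' := negpt_on_curve CP; have CQ' := negpt_on_curve CQ.
have [e|[l sPQ]] := addpt_slope_exists CP CQ; first by rewrite e (addpt_eq0 e) negptK addNpt.
rewrite (addpt_slope CP CQ sPQ).
case: P Q sPQ CP CQ CP' CQ' => [x1 y1] [x2 y2] /is_slope_neg sPQ _ _ CP' CQ'.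
by rewrite (addpt_slope CP' CQ' sPQ) /slope_sum /=; congr (Some (_, _)); ring.
Qed.

Lemma addptK P Q : on_curve W P -> on_curve W Q -> addpt W (addpt W P Q) (negpt W Q) = P.
Proof.
case: Q => [Q|] CP CQ; last by rewrite !addpt0.
have CQ' := negpt_on_curve CQ.
case: P CP => [P|] CP; last by rewrite (addptC CQ CQ') addNpt.
have [e|[l sPQ]] := addpt_slope_exists CP CQ; first by rewrite e (addpt_eq0 e) negptK.
rewrite (addpt_slope CP CQ sPQ).
have CS := slope_sum_on_curve CP sPQ.
case: P Q sPQ CP CQ CQ' CS => [x1 y1] [x2 y2] sPQ _ _ CQ' CS.
rewrite (addpt_slope CS CQ' (is_slope_cancel sPQ)) /slope_sum /=.
by congr (Some (_, _)); ring.
Qed.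

(* In the coordinates where B is the origin and AB is the x-axis this reads
   [x T - x A = l * (m + a1)]; it makes the whole configuration polynomial in
   the three slopes. *)
Lemma assoc_slope_x A B T e l m : on_curve W (Some B) ->
  is_slope A B e -> is_slope B T l -> is_slope (slope_sum A B e) T m ->
  T.1 - A.1 = (l - e) * (m + e + a1).
Proof.
case: A B T => [xA yA] [xB yB] [xT yT] CB sAB sBT sST.
have /= eA := is_slope_y (is_slope_sym sAB); have /= eT := is_slope_y sBT.
have /= e4 := is_slope_a4 sAB.
case: sBT sST => /= _ + [] /=; rewrite /slope_sum /=; set xS := _ - xA - xB => hBT hS hST.
have e2 : a2 = e ^+ 2 + a1 * e - xA - xB - xS by rewrite /xS; ring.
have e3 : a3 = m * (xT - xS) - yT - (e + a1) * xS - yA + e * xA by rewrite -hS; ring.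
clearbody xS; set d := xT - xA; apply/eqP; rewrite -subr_eq0.
have /eqP : (xT - xS) * (d - (l - e) * (m + e + a1)) = 0.
  transitivity (xB ^+ 2 + xB * xT + xT ^+ 2 + a2 * (xB + xT) + a4 - a1 * yB
     - l * (yB + yT + a1 * xT + a3)); last by rewrite hBT; ring.
  by rewrite /d e4 e2 e3 eT eA; ring.
rewrite mulf_eq0 => /orP[/eqP/subr0_eq eTS|//].
have /eqP : (xT - xB) * (d - (l - e) * (m + e + a1)) = 0.
  move/eqP: hST; rewrite -subr_eq0 => /eqP hST; rewrite -[RHS]oppr0 -hST.
  by rewrite /d e4 e2 e3 eT eA; ring.
rewrite mulf_eq0 => /orP[/eqP/subr0_eq eTB|//].
(* T = B = S would force B to be singular *)
have dy0 : curve_dy xB yB = 0 by rewrite /curve_dy e3 eT eA -eTS eTB; ring.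
have /eqP[] := disc_neq0_dx D0 CB dy0.
have e3' : a3 = - (2%:R * yB + a1 * xB) by rewrite e3 eT eA -eTS eTB; ring.
move/eqP: hBT; rewrite eq_sym -subr_eq0 => /eqP <-.
by rewrite /curve_dx eT eTB e3'; ring.
Qed.

Lemma assoc_slope A B T e l m : on_curve W (Some B) ->
  is_slope A B e -> is_slope B T l -> is_slope (slope_sum A B e) T m ->
  is_slope A (slope_sum B T l) (m - l + e) /\
  slope_sum A (slope_sum B T l) (m - l + e) = slope_sum (slope_sum A B e) T m.
Proof.
move=> CB sAB sBT sST; have := assoc_slope_x CB sAB sBT sST.
case: A B T sAB sBT sST CB => [xA yA] [xB yB] [xT yT] sAB sBT sST CB /= hx.
have /= eA := is_slope_y (is_slope_sym sAB); have /= eT := is_slope_y sBT.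
have /= e4 := is_slope_a4 sAB.
case: sST => /=; rewrite /slope_sum /=; set xS := _ - xA - xB => hS _.
have e2 : a2 = e ^+ 2 + a1 * e - xA - xB - xS by rewrite /xS; ring.
have e3 : a3 = m * (xT - xS) - yT - (e + a1) * xS - yA + e * xA by rewrite -hS; ring.
have ex : xA = xT - (l - e) * (m + e + a1) by rewrite -hx; ring.
clearbody xS; split; first split => /=.
- by rewrite e3 e2 eT eA ex; ring.
- by rewrite e4 e3 e2 eT eA ex; ring.
- by congr (_, _); rewrite ?e3 e2 ?eT ?eA ex; ring.
Qed.

Lemma addptA P Q T : on_curve W P -> on_curve W Q -> on_curve W T ->
  addpt W P (addpt W Q T) = addpt W (addpt W P Q) T.
Proof.
move=> CP CQ CT; have CPQ := addpt_on_curve CP CQ; have CQT := addpt_on_curve CQ CT.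
case: P CP CPQ => [A|] // CA CAB.
case: Q CQ CQT CAB => [B|] CB CBT CAB; last by rewrite addpt0.
case: T CT CBT => [T|] CT CBT; last by rewrite !addpt0.
have [e0|[e sAB]] := addpt_slope_exists CA CB.
  have eB := addpt_eq0 e0.
  rewrite e0 (addptC CA CBT) (addptC CB CT).
  have -> : Some A = negpt W (Some B) by rewrite eB negptK.
  by rewrite addptK.
have [e0|[l sBT]] := addpt_slope_exists CB CT.
  by rewrite e0 (addpt_eq0 e0) addptK // addpt0.
move: CAB; rewrite (addpt_slope CA CB sAB) => CS.
have [e0|[m sST]] := addpt_slope_exists CS CT.
  rewrite e0 (addpt_eq0 e0) -(addpt_slope CA CB sAB).
  have CN : on_curve W (addpt W (Some A) (Some B)) by apply: addpt_on_curve.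
  have -> : addpt W (Some B) (negpt W (addpt W (Some A) (Some B))) = negpt W (Some A).
    rewrite -{1}[Some B]negptK -negptD ?negpt_on_curve //.
    by rewrite (addptC (negpt_on_curve CB) CN) addptK.
  by rewrite -{1}[Some A]negptK addNpt.
rewrite (addpt_slope CS CT sST) (addpt_slope CB CT sBT).
have [sA <-] := assoc_slope CB sAB sBT sST.
by rewrite (addpt_slope CA (slope_sum_on_curve CB sBT) sA).
Qed.

End GroupLaw.

Definition curve_point (K : fieldType) (W : wcoef K) (D0 : disc W != 0) :=
  {P : option (K * K) | on_curve W P}.

Section PointGroup.
Variables (K : fieldType) (W : wcoef K) (D0 : disc W != 0).
Local Notation E := (curve_point D0).

HB.instance Definition _ := SubChoice.on E.

Definition mkpoint P (CP : on_curve W P) : E := exist _ P CP.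

Definition point0 : E := @mkpoint None isT.
Definition oppoint (P : E) : E := mkpoint (negpt_on_curve (valP P)).
Definition addpoint (P Q : E) : E := mkpoint (addpt_on_curve D0 (valP P) (valP Q)).

Lemma addpointA : associative addpoint.
Proof. by move=> P Q T; apply/val_inj; apply: addptA; rewrite ?(valP P) ?(valP Q) ?(valP T). Qed.

Lemma addpointC : commutative addpoint.
Proof. by move=> P Q; apply/val_inj; apply: addptC; rewrite ?(valP P) ?(valP Q). Qed.

Lemma add0point : left_id point0 addpoint.
Proof. by move=> P; apply/val_inj. Qed.

Lemma addNpoint : left_inverse point0 oppoint addpoint.
Proof. by move=> P; apply/val_inj; apply: addNpt. Qed.

HB.instance Definition _ :=
  GRing.isZmodule.Build E addpointA addpointC add0point addNpoint.

Lemma val_pointD (P Q : E) : val (P + Q) = addpt W (val P) (val Q). Proof. by []. Qed.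
Lemma val_pointN (P : E) : val (- P) = negpt W (val P). Proof. by []. Qed.

Definition to_point (P : option (K * K)) : E := insubd (0 : E) P.

Lemma val_to_point P : on_curve W P -> val (to_point P) = P.
Proof. exact: insubdK. Qed.

End PointGroup.

(** * Non-archimedean fields *)

Lemma ltr_leM (R : numDomainType) (a b c d : R) : 0 < b -> 0 <= c -> a <= b -> c < d ->
  a * c < b * d.
Proof.
by move=> b0 c0 ab cd; apply: le_lt_trans (ler_wpM2r c0 ab) _; rewrite ltr_pM2l.
Qed.

Lemma exists_exprn_lt (R : realType) (q e : R) : 0 <= q < 1 -> 0 < e -> exists n, q ^+ n < e.
Proof.
move=> /andP[q0 q1] e0; have [->|qn0] := eqVneq q 0; first by exists 1%N; rewrite expr1.
have qp : 0 < q by rewrite lt_neqAle eq_sym qn0.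
have lnq : ln q < 0 by rewrite ln_lt0 // qp.
exists (Num.truncn (ln e / ln q)).+1.
by rewrite -ltr_ln ?posrE ?exprn_gt0 // lnXn // -mulr_natl -ltr_ndivrMr // truncnS_gt.
Qed.

Structure nonarch_abs (R : realType) (K : fieldType) :=
  NonarchAbs { nonarch_abs_fun :> K -> R; nonarch_absP : is_nonarch_abs nonarch_abs_fun }.

Section NonarchAbs.
Variables (R : realType) (K : fieldType) (abs : nonarch_abs R K).
Implicit Types (x y z : K) (c d : R).

Lemma abs_ge0 x : 0 <= abs x. Proof. by case: (nonarch_absP abs). Qed.
Hint Resolve abs_ge0 : core.

Lemma absM x y : abs (x * y) = abs x * abs y.
Proof. by case: (nonarch_absP abs). Qed.

Lemma absD x y : abs (x + y) <= Num.max (abs x) (abs y).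
Proof. by case: (nonarch_absP abs). Qed.

Lemma abs_eq0 x : (abs x == 0) = (x == 0).
Proof. by case: (nonarch_absP abs) => _ h _ _; apply/eqP/eqP => /h. Qed.

Lemma abs0 : abs 0 = 0. Proof. by apply/eqP; rewrite abs_eq0. Qed.

Lemma abs_gt0 x : (0 < abs x) = (x != 0).
Proof. by rewrite lt_neqAle abs_ge0 andbT eq_sym abs_eq0. Qed.

Lemma abs1 : abs 1 = 1.
Proof.
have h : abs 1 != 0 by rewrite abs_eq0 oner_eq0.
by apply: (mulIf h); rewrite -absM !mul1r.
Qed.

Lemma absX x n : abs (x ^+ n) = abs x ^+ n.
Proof. by elim: n => [|n IHn]; rewrite ?expr0 ?abs1 // !exprS absM IHn. Qed.

Lemma absN x : abs (- x) = abs x.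
Proof.
have : abs (-1) ^+ 2 == 1 by rewrite -absX sqrrN expr1n abs1.
by rewrite sqrp_eq1 // => /eqP e; rewrite -mulN1r absM e mul1r.
Qed.

Lemma absB x y : abs (x - y) = abs (y - x).
Proof. by rewrite -absN opprB. Qed.

Lemma absV x : abs x^-1 = (abs x)^-1.
Proof.
have [->|x0] := eqVneq x 0; first by rewrite invr0 abs0 invr0.
have h : abs x != 0 by rewrite abs_eq0.
by apply: (mulIf h); rewrite -absM !mulVf // abs1.
Qed.

Lemma absD_le c x y : abs x <= c -> abs y <= c -> abs (x + y) <= c.
Proof. by move=> hx hy; apply: le_trans (absD x y) _; rewrite ge_max hx hy. Qed.

Lemma absB_le c x y : abs x <= c -> abs y <= c -> abs (x - y) <= c.
Proof. by move=> hx hy; apply: absD_le; rewrite ?absN. Qed.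

Lemma absD_lt c x y : abs x < c -> abs y < c -> abs (x + y) < c.
Proof. by move=> hx hy; apply: le_lt_trans (absD x y) _; rewrite gt_max hx hy. Qed.

Lemma absB_lt c x y : abs x < c -> abs y < c -> abs (x - y) < c.
Proof. by move=> hx hy; apply: absD_lt; rewrite ?absN. Qed.

Lemma absDl x y : abs y < abs x -> abs (x + y) = abs x.
Proof.
move=> yx; apply/le_anti; rewrite absD_le ?(ltW yx) //= leNgt; apply/negP => xyx.
by have := absB_lt xyx yx; rewrite addrK ltxx.
Qed.

Lemma absBl x y : abs y < abs x -> abs (x - y) = abs x.
Proof. by move=> h; apply: absDl; rewrite absN. Qed.

Lemma absDr x y : abs y < abs x -> abs (y + x) = abs x.
Proof. by rewrite addrC; apply: absDl. Qed.

Lemma absBr x y : abs y < abs x -> abs (y - x) = abs x.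
Proof. by rewrite absB; apply: absBl. Qed.

Lemma abs_close x y : abs (x - y) < abs y -> abs x = abs y.
Proof. by move=> h; rewrite -[in LHS](subrK y x) absDr. Qed.

Lemma abs_nat n : abs n%:R <= 1.
Proof.
by elim: n => [|n IHn]; rewrite ?abs0 // -natr1; apply: absD_le; rewrite ?abs1.
Qed.

Lemma abs_natM_le n x c : abs x <= c -> abs (n%:R * x) <= c.
Proof. by apply: le_trans; rewrite absM; apply: ler_piMl; rewrite ?abs_nat. Qed.

Lemma abs_natM_lt n x c : abs x < c -> abs (n%:R * x) < c.
Proof. exact: le_lt_trans (abs_natM_le n (lexx _)). Qed.

Lemma absM_le x y c d : abs x <= c -> abs y <= d -> abs (x * y) <= c * d.
Proof. by move=> xc yd; rewrite absM ler_pM. Qed.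

Lemma absM_lt x y c d : 0 < c -> abs x <= c -> abs y < d -> abs (x * y) < c * d.
Proof. by move=> c0 xc yd; rewrite absM ltr_leM. Qed.

Lemma absM_le1 x y : abs x <= 1 -> abs y <= 1 -> abs (x * y) <= 1.
Proof. by move=> x1 y1; rewrite -[1]mulr1 absM_le. Qed.

Lemma absM_lt1 x y : abs x <= 1 -> abs y < 1 -> abs (x * y) < 1.
Proof. by move=> x1 y1; rewrite -[1]mulr1 absM_lt. Qed.

Lemma absX_le1 x n : abs x <= 1 -> abs (x ^+ n) <= 1.
Proof. by move=> x1; rewrite absX exprn_ile1. Qed.

Lemma absX_lt1 x n : abs x < 1 -> abs (x ^+ n.+1) < 1.
Proof. by move=> x1; rewrite absX exprn_ilt1. Qed.

Lemma absX_le x c n : abs x <= c -> abs (x ^+ n) <= c ^+ n.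
Proof. by move=> xc; rewrite absX lerXn2r ?nnegrE // (le_trans _ xc). Qed.

Lemma abs_monomial_le a x c m n : abs a <= 1 -> abs x <= c -> 1 <= c -> (m <= n)%N ->
  abs (a * x ^+ m) <= c ^+ n.
Proof.
move=> a1 xc c1 mn; rewrite -[c ^+ n]mul1r; apply: absM_le => //.
by apply: le_trans (absX_le m xc) _; rewrite ler_weXn2l.
Qed.

Lemma abs_monomial_lt a x m n : abs a <= 1 -> 1 < abs x -> (m < n)%N ->
  abs (a * x ^+ m) < abs x ^+ n.
Proof.
move=> a1 x1 mn; apply: le_lt_trans (abs_monomial_le a1 (lexx _) (ltW x1) (leqnn m)) _.
by rewrite ltr_eXn2l.
Qed.

Lemma abs_coprime_nat m n : coprime m n -> abs (m%:R : K) = 1 \/ abs (n%:R : K) = 1.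
Proof.
move=> cop; have le1 k : 1 <= abs (k%:R : K) -> abs (k%:R : K) = 1.
  by move=> h; apply/le_anti; rewrite abs_nat h.
have [/le1|m1] := leP 1 (abs (m%:R : K)); first by left.
right; apply: le1; rewrite leNgt; apply/negP => n1.
have [m0|m_gt0] := posnP m.
  by move: cop n1; rewrite m0 /coprime gcd0n => /eqP ->; rewrite abs1 ltxx.
have [a b e _] := egcdnP n m_gt0.
have : abs (a%:R * m%:R - b%:R * n%:R : K) < 1.
  by apply: absB_lt; apply: abs_natM_lt.
by rewrite -!natrM e (eqP cop) natrD addrAC subrr add0r abs1 ltxx.
Qed.

Lemma abs_roots_le x y c : abs (x * y) <= c ^+ 2 -> abs (x + y) <= c ->
  abs x <= c /\ abs y <= c.
Proof.
have root_le x1 y1 : abs (x1 * y1) <= c ^+ 2 -> abs (x1 + y1) <= c -> abs x1 <= c.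
  rewrite absM => hM hD; rewrite leNgt; apply/negP => cx.
  have c0 : 0 <= c by apply: le_trans hD.
  have x0 := le_lt_trans c0 cx.
  have yc : abs y1 <= c.
    by rewrite -(ler_pM2l x0); apply: le_trans hM _; rewrite expr2 ler_wpM2r // ltW.
  by move: hD; rewrite absDl ?(le_lt_trans yc) // leNgt cx.
by move=> hM hD; split; [apply: root_le hM hD | apply: (root_le y x); rewrite 1?mulrC 1?addrC].
Qed.

Lemma abs_roots_ge1 x y c : 1 <= c -> c <= abs (x * y) -> abs (x + y) <= c ->
  1 <= abs x /\ 1 <= abs y.
Proof.
have root_ge1 x1 y1 : 1 <= c -> c <= abs (x1 * y1) -> abs (x1 + y1) <= c -> 1 <= abs x1.
  move=> c1; rewrite absM => hM hD; rewrite leNgt; apply/negP => x_lt1.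
  have hy : c < abs y1.
    have y0 : 0 < abs y1.
      rewrite lt_neqAle abs_ge0 andbT; apply: contraTneq hM => <-.
      by rewrite mulr0 -ltNge; lra.
    by apply: le_lt_trans hM _; rewrite -[X in _ < X]mul1r ltr_pM2r.
  by move: hD; rewrite absDr ?leNgt ?hy //; lra.
move=> c1 hM hD; split; first exact: root_ge1 c1 hM hD.
by apply: (root_ge1 y x); rewrite 1?mulrC 1?addrC.
Qed.

Lemma abs_roots_eq x y c : abs (x * y) = c ^+ 2 -> abs (x + y) <= c ->
  abs x = c /\ abs y = c.
Proof.
move=> hM hD; have [|xc yc] := @abs_roots_le x y c _ hD; first by rewrite hM.
move: hM; rewrite absM expr2; have := abs_ge0 x; have := abs_ge0 y => y0 x0 hM.
by split; apply/le_anti/andP; split => //; nra.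
Qed.

Lemma abs_roots_split x y : abs (x * y) < abs (x + y) ^+ 2 ->
  (abs x = abs (x + y) /\ abs y = abs (x * y) / abs (x + y)) \/
  (abs y = abs (x + y) /\ abs x = abs (x * y) / abs (x + y)).
Proof.
have dominant x1 y1 : abs y1 < abs x1 ->
    abs x1 = abs (x1 + y1) /\ abs y1 = abs (x1 * y1) / abs (x1 + y1).
  move=> h; rewrite absDl // absM; split => //.
  by rewrite [abs x1 * _]mulrC mulfK // gt_eqF // (le_lt_trans _ h).
move=> h; have [yx|xy|e] := ltgtP (abs y) (abs x).
- by left; apply: dominant.
- by right; rewrite [x + y]addrC [x * y]mulrC; apply: dominant.
- have : abs (x + y) <= abs x by apply: absD_le; rewrite ?e.
  rewrite leNgt => /negP[]; rewrite -(@ltr_pXn2r _ 2) ?nnegrE //.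
  by move: h; rewrite absM e expr2.
Qed.

End NonarchAbs.

#[export] Hint Extern 0 (is_true (@Order.le _ _ _ (nonarch_abs_fun _ _))) =>
  (apply: abs_ge0) : core.

Section Complete.
Variables (R : realType) (K : fieldType) (abs : nonarch_abs R K).
Hypothesis cpl : abs_complete abs.
Implicit Types (x y z : K) (q : R).

Lemma geometric_limit (s : nat -> K) q : 0 <= q < 1 ->
  (forall n, abs (s n.+1 - s n) <= q ^+ n) ->
  exists l, forall n, abs (l - s n) <= q ^+ n.
Proof.
move=> q01 hs; have /andP[q0 q1] := q01.
have dist n k : abs (s (n + k)%N - s n) <= q ^+ n.
  elim: k => [|k IHk]; first by rewrite addn0 subrr abs0 exprn_ge0.
  rewrite addnS -(subrK (s (n + k)%N) (s (n + k).+1)) -addrA.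
  apply: absD_le => //; apply: le_trans (hs _) _.
  by rewrite ler_wiXn2l ?(ltW q1) ?leq_addr.
have [|l Hl] := cpl (f := s).
  move=> e e0; have [n qn] := exists_exprn_lt q01 e0.
  exists n => i j ni nj; rewrite -(subnKC ni) -(subnKC nj).
  rewrite -(subrKA (s n)); apply: absD_lt; last rewrite absB.
    exact: le_lt_trans (dist _ _) qn.
  exact: le_lt_trans (dist _ _) qn.
exists l => n; rewrite leNgt; apply/negP => h.
have [m Hm] := Hl _ (le_lt_trans (exprn_ge0 n q0) h).
have [] := negP (negbT (ltxx (abs (l - s n)))).
rewrite -[X in abs X < _](subrKA (s (n + m)%N)).
apply: absD_lt; first by rewrite absB Hm ?leq_addl.
exact: le_lt_trans (dist _ _) h.
Qed.

Lemma contraction_fixpoint (f : K -> K) (c q : R) : 0 <= c <= 1 -> 0 <= q < 1 ->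
  (forall x, abs x <= c -> abs (f x) <= c) ->
  (forall x y, abs x <= c -> abs y <= c -> abs (f x - f y) <= q * abs (x - y)) ->
  exists2 x, abs x <= c & f x = x.
Proof.
move=> /andP[c0 c1] q01 fc fq; have /andP[q0 q1] := q01.
pose s n := iter n f 0.
have sc n : abs (s n) <= c by elim: n => [|n IHn]; rewrite ?abs0 //=; apply: fc.
have [|l Hl] := geometric_limit (s := s) q01.
  elim=> [|n IHn]; first by rewrite subr0 expr0 (le_trans (sc 1%N)).
  by rewrite exprS; apply: le_trans (fq _ _ (sc n.+1) (sc n)) _; rewrite ler_wpM2l.
have lc : abs l <= c.
  rewrite leNgt; apply/negP => h.
  have [n qn] := exists_exprn_lt q01 (le_lt_trans c0 h).
  have : abs (s n) = abs l by apply: abs_close; rewrite absB (le_lt_trans (Hl n)).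
  by move=> e; have := sc n; rewrite e leNgt h.
exists l => //; apply/subr0_eq/eqP; rewrite -(abs_eq0 abs) eq_le abs_ge0 andbT leNgt.
apply/negP => h; have [n qn] := exists_exprn_lt q01 h.
have [] := negP (negbT (ltxx (abs (f l - l)))).
rewrite -[X in abs X < _](subrKA (s n.+1)); apply: absD_lt; last first.
  rewrite [abs (s _ - l)]absB; apply: le_lt_trans (Hl _) (le_lt_trans _ qn).
  by rewrite exprS ler_piMl ?exprn_ge0 // ltW.
apply: le_lt_trans (fq _ _ lc (sc n)) _; apply: le_lt_trans qn.
by apply: le_trans (ler_wpM2l q0 (Hl n)) _; rewrite ler_piMl ?exprn_ge0 // ltW.
Qed.

Lemma sqrt_1D4M a : abs a < 1 -> exists2 w, (1 + 2%:R * w) ^+ 2 = 1 + 4%:R * a & abs w <= abs a.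
Proof.
move=> a1; pose f w := a - w ^+ 2.
have [|||x y xa ya|w wa ew] := @contraction_fixpoint f (abs a) (abs a).
- by rewrite abs_ge0 ltW.
- by rewrite abs_ge0.
- move=> x xa; apply: absB_le => //; apply: le_trans (xa).
  by rewrite absX expr2 ler_piMl // (le_trans xa (ltW a1)).
- rewrite (_ : f x - f y = - ((x + y) * (x - y))); last by rewrite /f; ring.
  by rewrite absN absM_le // absD_le.
by exists w => //; rewrite -[in RHS](subrK (w ^+ 2) a) -/(f w) ew; ring.
Qed.

End Complete.

(** * The b-invariants *)

Record binv (K : Type) := BInv { b2 : K; b4 : K; b6 : K; b8 : K }.

Section BInvariants.
Variable K : fieldType.
Implicit Types (B : binv K) (x y z r k : K).

Definition brel B := 4%:R * b8 B = b2 B * b6 B - b4 B ^+ 2.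

Definition bdisc B := - b2 B ^+ 2 * b8 B - 8%:R * b4 B ^+ 3 - 27%:R * b6 B ^+ 2
                     + 9%:R * b2 B * b4 B * b6 B.

Definition c4inv B := b2 B ^+ 2 - 24%:R * b4 B.
Definition c6inv B := - b2 B ^+ 3 + 36%:R * b2 B * b4 B - 216%:R * b6 B.

Definition bshift B x := BInv (b2 B + 12%:R * x)
  (b4 B + b2 B * x + 6%:R * x ^+ 2)
  (b6 B + 2%:R * b4 B * x + b2 B * x ^+ 2 + 4%:R * x ^+ 3)
  (b8 B + 3%:R * b6 B * x + 3%:R * b4 B * x ^+ 2 + b2 B * x ^+ 3 + 3%:R * x ^+ 4).

Definition bscale B k := BInv (b2 B / k) (b4 B / k ^+ 2) (b6 B / k ^+ 3) (b8 B / k ^+ 4).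

(* Numerators of x(2P), x(P + Q) + x(P - Q) and x(P + Q) x(P - Q) as functions of
   x = x(P) and y = x(Q). *)
Definition dbl_num B x := x ^+ 4 - b4 B * x ^+ 2 - 2%:R * b6 B * x - b8 B.
Definition add_num B x y :=
  2%:R * x * y * (x + y) + b2 B * x * y + b4 B * (x + y) + b6 B.
Definition mul_num B x y :=
  x ^+ 2 * y ^+ 2 - b4 B * x * y - b6 B * (x + y) - b8 B.

Lemma b2_shift B x : b2 (bshift B x) = b2 B + 12%:R * x. Proof. by []. Qed.
Lemma b4_shift B x : b4 (bshift B x) = b4 B + b2 B * x + 6%:R * x ^+ 2.
Proof. by []. Qed.
Lemma b6_shift B x : b6 (bshift B x) =
  b6 B + 2%:R * b4 B * x + b2 B * x ^+ 2 + 4%:R * x ^+ 3.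
Proof. by []. Qed.
Lemma b8_shift B x : b8 (bshift B x) =
  b8 B + 3%:R * b6 B * x + 3%:R * b4 B * x ^+ 2 + b2 B * x ^+ 3 + 3%:R * x ^+ 4.
Proof. by []. Qed.

Lemma brel_b4 B : brel B -> b4 B ^+ 2 = b2 B * b6 B - 4%:R * b8 B.
Proof. by rewrite /brel => ->; ring. Qed.

Lemma brel_shift B x : brel B -> brel (bshift B x).
Proof.
rewrite /brel /bshift /= => h.
transitivity (4%:R * b8 B + 4%:R * (3%:R * b6 B * x + 3%:R * b4 B * x ^+ 2
  + b2 B * x ^+ 3 + 3%:R * x ^+ 4)); first by ring.
by rewrite h; ring.
Qed.

Lemma brel_scale B k : k != 0 -> brel B -> brel (bscale B k).
Proof.
rewrite /brel /bscale /= => k0 h.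
by transitivity ((4%:R * b8 B) / k ^+ 4); [|rewrite h]; field.
Qed.

Lemma c4inv_shift B x : c4inv (bshift B x) = c4inv B.
Proof. by rewrite /c4inv b2_shift b4_shift; ring. Qed.

Lemma c6inv_shift B x : c6inv (bshift B x) = c6inv B.
Proof. by rewrite /c6inv b2_shift b4_shift b6_shift; ring. Qed.

Lemma c4inv_c6inv_disc B : brel B -> c6inv B ^+ 2 = c4inv B ^+ 3 - 1728%:R * bdisc B.
Proof.
rewrite /brel /bdisc => h.
transitivity (c4inv B ^+ 3 + 432%:R * b2 B ^+ 2 * (4%:R * b8 B) + 1728%:R *
  (8%:R * b4 B ^+ 3 + 27%:R * b6 B ^+ 2 - 9%:R * b2 B * b4 B * b6 B)); last by ring.
by rewrite h /c6inv /c4inv; ring.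
Qed.

Lemma bdisc_shift B x : brel B -> bdisc (bshift B x) = bdisc B.
Proof.
rewrite /brel /bdisc /bshift /= => h; apply/subr0_eq.
transitivity ((4%:R * b8 B - (b2 B * b6 B - b4 B ^+ 2)) *
  (- 6%:R * (b2 B * x + 6%:R * x ^+ 2))); first by ring.
by rewrite h subrr mul0r.
Qed.

Lemma bdisc_scale B k : k != 0 -> bdisc (bscale B k) = bdisc B / k ^+ 6.
Proof. by rewrite /bdisc /bscale /= => k0; field. Qed.

Lemma bshiftD B x t : bshift (bshift B x) t = bshift B (x + t).
Proof. by rewrite /bshift /=; congr BInv; ring. Qed.

Lemma bshift_affine B r k x : k != 0 ->
  bshift (bscale (bshift B r) k) ((x - r) / k) = bscale (bshift B x) k.
Proof. by rewrite /bshift /bscale /= => k0; congr BInv; field. Qed.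

Lemma dbl_num_affine B r k x : k != 0 ->
  dbl_num (bscale (bshift B r) k) ((x - r) / k) =
  (dbl_num B x - r * b6 (bshift B x)) / k ^+ 4.
Proof. by rewrite /dbl_num /bshift /bscale /= => k0; field. Qed.

Lemma add_num_affine B r k x y : k != 0 ->
  add_num (bscale (bshift B r) k) ((x - r) / k) ((y - r) / k) =
  (add_num B x y - 2%:R * r * (x - y) ^+ 2) / k ^+ 3.
Proof. by rewrite /add_num /bshift /bscale /= => k0; field. Qed.

Lemma mul_num_affine B r k x y : k != 0 ->
  mul_num (bscale (bshift B r) k) ((x - r) / k) ((y - r) / k) =
  (mul_num B x y - r * add_num B x y + r ^+ 2 * (x - y) ^+ 2) / k ^+ 4.
Proof. by rewrite /mul_num /add_num /bshift /bscale /= => k0; field. Qed.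

Lemma add_numC B x y : add_num B x y = add_num B y x.
Proof. by rewrite /add_num; ring. Qed.

Lemma mul_numC B x y : mul_num B x y = mul_num B y x.
Proof. by rewrite /mul_num; ring. Qed.

End BInvariants.

Arguments b2 : simpl never.
Arguments b4 : simpl never.
Arguments b6 : simpl never.
Arguments b8 : simpl never.

(* The b-invariants of the curve translated by x are, up to constants, the derivatives of
   the 2-division polynomial at x; two of them are division polynomials. *)
Notation psi2sq B x := (b6 (bshift B x)).
Notation psi3 B x := (b8 (bshift B x)).

Section Duplication.
Variable K : fieldType.
Implicit Types (B : binv K) (x z : K).

(* In the notation of division polynomials this is psi_4 / psi_2. *)
Definition psi4_2 B x := b4 (bshift B x) * psi3 B x - psi2sq B x ^+ 2.

Lemma dbl_shift B x z : psi2sq B x != 0 -> z * psi2sq B x = dbl_num B x ->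
  bshift B z = bshift (bshift B x) (- (psi3 B x / psi2sq B x)).
Proof.
move=> ne e; rewrite bshiftD; congr bshift; apply: (mulIf ne).
rewrite {}e mulrDl mulNr divfK //.
by rewrite /dbl_num b6_shift b8_shift; ring.
Qed.

Lemma psi2sq_dbl B x z : brel B -> psi2sq B x != 0 -> z * psi2sq B x = dbl_num B x ->
  psi2sq B z * psi2sq B x ^+ 3 = psi4_2 B x ^+ 2.
Proof.
move=> hr ne e; rewrite (dbl_shift ne e) /psi4_2; have := brel_shift x hr; move: ne {e}.
case: (bshift B x) => B2 B4 B6 B8; rewrite /brel /bshift /b2 /b4 /b6 /b8 => ne h.
transitivity (B6 ^+ 4 - 2%:R * B4 * B8 * B6 ^+ 2 + B8 ^+ 2 * (B2 * B6 - 4%:R * B8)).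
  by field.
by rewrite h; ring.
Qed.

Lemma psi3_dbl B x z : brel B -> psi2sq B x != 0 -> z * psi2sq B x = dbl_num B x ->
  psi3 B z * psi2sq B x ^+ 4 =
  psi3 B x * (psi2sq B x ^+ 2 * psi4_2 B x - psi4_2 B x ^+ 2 - psi3 B x ^+ 3).
Proof.
move=> hr ne e; rewrite (dbl_shift ne e) /psi4_2; have := brel_shift x hr; move: ne {e}.
case: (bshift B x) => B2 B4 B6 B8; rewrite /brel /bshift /b2 /b4 /b6 /b8 => ne h.
transitivity (B8 * (- B8 ^+ 2 * (B2 * B6 - 4%:R * B8) - B8 ^+ 3 + 3%:R * B4 * B8 * B6 ^+ 2
   - 2%:R * B6 ^+ 4)); first by field.
by rewrite h; ring.
Qed.

End Duplication.

(** * Kummer lines and heights *)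

(* The x-coordinate of an elliptic curve, as a map X from the group of points to the x-line
   with X = None at the origin. Unlike a Weierstrass equation, this data can be rescaled by
   [x = r + k x'] even when [k] is not a square. *)
Record kummer_line (K : fieldType) (G : zmodType) (B : binv K) (X : G -> option K) : Prop :=
  KummerLine {
  kummer_rel : brel B;
  kummer_disc : bdisc B != 0;
  kummer_0 : X 0 = None;
  kummer_eq0 : forall P, X P = None -> P = 0;
  kummer_opp : forall P, X (- P) = X P;
  kummer_inj : forall P Q, X P = X Q -> P = Q \/ P = - Q;
  kummer_add : forall P Q x y, X P = Some x -> X Q = Some y -> x != y ->
    exists z w, [/\ X (P + Q) = Some z, X (P - Q) = Some w,
      (z + w) * (x - y) ^+ 2 = add_num B x y & z * w * (x - y) ^+ 2 = mul_num B x y];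
  kummer_dbl : forall P x, X P = Some x -> psi2sq B x != 0 ->
    exists2 z, X (P + P) = Some z & z * psi2sq B x = dbl_num B x;
  kummer_dbl0 : forall P x, X P = Some x -> psi2sq B x = 0 -> P + P = 0 }.

(* The last clause, a weak form of continuity, is needed at the points of order 2 only: there
   the duplication formula says nothing. *)
Record kummer_height (R : realType) (K : fieldType) (abs : K -> R) (G : zmodType)
    (B : binv K) (X : G -> option K) (lam : G -> R) : Prop := KummerHeight {
  height_ge : exists C, forall P x, X P = Some x ->
    2%:R^-1 * ln (Num.max 1 (abs x)) - C <= lam P;
  height_dbl : forall P x, X P = Some x -> psi2sq B x != 0 ->
    lam (P + P) = 4%:R * lam P - 2%:R^-1 * ln (abs (psi2sq B x))
                  + 4%:R^-1 * ln (abs (bdisc B));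
  height_2torsion : forall P x, X P = Some x -> psi2sq B x = 0 ->
    forall d e : R, 0 < d -> 0 < e -> exists Q y,
    [/\ X Q = Some y, abs (y - x) < d, psi2sq B y != 0 & `|lam Q - lam P| < e] }.

Definition xaffine (K : fieldType) (G : Type) (r k : K) (X : G -> option K) P : option K :=
  omap (fun x => (x - r) / k) (X P).

Section KummerAffine.
Variables (K : fieldType) (G : zmodType).
Implicit Types (B : binv K) (X : G -> option K) (P Q : G) (x y z w r k : K).

Lemma xaffine_Some X r k P x' : xaffine r k X P = Some x' ->
  exists2 x, X P = Some x & x' = (x - r) / k.
Proof. by rewrite /xaffine; case: (X P) => //= x [<-]; exists x. Qed.

Lemma psi2sq_affine B r k x : k != 0 ->
  psi2sq (bscale (bshift B r) k) ((x - r) / k) = psi2sq B x / k ^+ 3.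
Proof. by move=> k0; rewrite bshift_affine. Qed.

Lemma psi3_affine B r k x : k != 0 ->
  psi3 (bscale (bshift B r) k) ((x - r) / k) = psi3 B x / k ^+ 4.
Proof. by move=> k0; rewrite bshift_affine. Qed.

Lemma psi2sq_affine_eq0 B r k x : k != 0 ->
  (psi2sq (bscale (bshift B r) k) ((x - r) / k) == 0) = (psi2sq B x == 0).
Proof.
by move=> k0; rewrite psi2sq_affine // mulf_eq0 invr_eq0 expf_eq0 (negPf k0) andbF orbF.
Qed.

Lemma bdisc_affine B r k : brel B -> k != 0 ->
  bdisc (bscale (bshift B r) k) = bdisc B / k ^+ 6.
Proof. by move=> hr k0; rewrite bdisc_scale // bdisc_shift. Qed.

Lemma kummer_line_affine B X r k : k != 0 -> kummer_line B X ->
  kummer_line (bscale (bshift B r) k) (xaffine r k X).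
Proof.
move=> k0 kum; have hr := kummer_rel kum; split.
- by apply: brel_scale => //; apply: brel_shift.
- by rewrite bdisc_affine // mulf_neq0 ?kummer_disc ?invr_eq0 ?expf_neq0 //; case: kum.
- by rewrite /xaffine (kummer_0 kum).
- by move=> P; rewrite /xaffine; case E: (X P) => [x|] //= _; apply: (kummer_eq0 kum).
- by move=> P; rewrite /xaffine (kummer_opp kum).
- move=> P Q e; apply: (kummer_inj kum); move: e; rewrite /xaffine.
  case: (X P) (X Q) => [x|] [y|] //= [e]; congr Some; apply: (addIr (- r)).
  by apply: (mulIf (_ : k^-1 != 0)); rewrite ?invr_eq0.
- move=> P Q _ _ /xaffine_Some[x EP ->] /xaffine_Some[y EQ ->] ne.
  have ne' : x != y by apply: contraNneq ne => ->.
  have [z [w [EZ EW es ep]]] := kummer_add kum EP EQ ne'.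
  exists ((z - r) / k), ((w - r) / k); rewrite /xaffine EZ EW; split => //.
    by rewrite add_num_affine // -es; field.
  by rewrite mul_num_affine // -es -ep; field.
- move=> P _ /xaffine_Some[x EP ->]; rewrite psi2sq_affine_eq0 => // ne.
  have [z EZ ez] := kummer_dbl kum EP ne.
  exists ((z - r) / k); first by rewrite /xaffine EZ.
  by rewrite psi2sq_affine // dbl_num_affine // -ez; field.
- move=> P _ /xaffine_Some[x EP ->] /eqP; rewrite psi2sq_affine_eq0 // => /eqP.
  exact: (kummer_dbl0 kum).
Qed.

End KummerAffine.

Section KummerHeight.
Variables (R : realType) (K : fieldType) (abs : nonarch_abs R K).
Variables (G : zmodType) (lam : G -> R).
Implicit Types (B : binv K) (X : G -> option K) (P Q : G) (x y z w r k : K).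

Lemma max1_abs_affine_le r k : k != 0 -> exists2 c : R, 0 < c &
  forall x, Num.max 1 (abs ((x - r) / k)) <= c * Num.max 1 (abs x).
Proof.
move=> k0; have max_ge1 (a : R) : 1 <= Num.max 1 a by rewrite le_max lexx.
have max_gt0 (a : R) : 0 < Num.max 1 a by apply: lt_le_trans (max_ge1 a).
have max_ge (a : R) : a <= Num.max 1 a by rewrite le_max lexx orbT.
exists (Num.max 1 (abs r) * Num.max 1 (abs k)^-1) => [|x]; first by rewrite mulr_gt0.
rewrite ge_max !mulr_ege1 //= mulrAC absM absV ler_pM ?invr_ge0 //.
apply: absB_le; first by apply: le_trans (max_ge _) _; rewrite ler_peMl // ltW.
by apply: le_trans (max_ge _) _; rewrite ler_peMr // ltW.
Qed.

Lemma kummer_height_affine B X r k : k != 0 ->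
  kummer_line B X -> kummer_height abs B X lam ->
  kummer_height abs (bscale (bshift B r) k) (xaffine r k X) lam.
Proof.
move=> k0 kum [[C hC] hdbl happ]; have kp : 0 < abs k by rewrite abs_gt0.
have hr := kummer_rel kum; have d0 := kummer_disc kum; split.
- have [c c0 hc] := max1_abs_affine_le r k0.
  exists (C + 2%:R^-1 * ln c) => P _ /xaffine_Some[x EP ->]; apply: le_trans (hC _ _ EP).
  have m0 (a : R) : 0 < Num.max 1 a by rewrite lt_max ltr01.
  have := hc x; rewrite -ler_ln ?posrE ?mulr_gt0 // lnM ?posrE //; lra.
- move=> P _ /xaffine_Some[x EP ->]; rewrite psi2sq_affine_eq0 // => ne.
  rewrite (hdbl _ _ EP ne) psi2sq_affine // bdisc_affine //.
  rewrite ![abs (_ / _)]absM !absV !absX.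
  rewrite !ln_div ?posrE ?exprn_gt0 ?abs_gt0 // !lnXn //; lra.
- move=> P _ /xaffine_Some[x EP ->] /eqP; rewrite psi2sq_affine_eq0 // => /eqP e0 d e dp ep.
  have dk : 0 < d * abs k by rewrite mulr_gt0.
  have [Q [y [EQ yx ne hQ]]] := happ _ _ EP e0 _ _ dk ep.
  exists Q, ((y - r) / k); split; rewrite ?psi2sq_affine_eq0 //; first by rewrite /xaffine EQ.
  rewrite (_ : (y - r) / k - (x - r) / k = (y - x) / k); last by field.
  by rewrite absM absV ltr_pdivrMr.
Qed.

Lemma kummer_height_le B X (S : K -> Prop) (l : K -> R) :
  kummer_line B X -> kummer_height abs B X lam ->
  (exists C, forall x, S x -> l x <= 2%:R^-1 * ln (Num.max 1 (abs x)) + C) ->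
  (forall x z, S x -> psi2sq B x != 0 -> z * psi2sq B x = dbl_num B x ->
     S z /\ 4%:R * l x - 2%:R^-1 * ln (abs (psi2sq B x))
                  + 4%:R^-1 * ln (abs (bdisc B)) <= l z) ->
  (forall x, S x -> psi2sq B x = 0 -> exists2 d : R, 0 < d &
     forall y, abs (y - x) < d -> S y /\ l x <= l y) ->
  forall P x, X P = Some x -> S x -> l x <= lam P.
Proof.
move=> kum [[C hC] hdbl happ] [C' hC'] l_dbl l_loc.
pose b := Num.max 0 (C + C').
have b0 : 0 <= b by rewrite le_max lexx.
have approx n P x : X P = Some x -> S x -> l x - b * 4%:R^-1 ^+ n <= lam P.
  elim: n P x => [|n IHn] P x EP Sx.
    have := hC _ _ EP; have := hC' _ Sx.
    have : C + C' <= b by rewrite le_max lexx orbT.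
    rewrite expr0; lra.
  have not_2torsion Q y : X Q = Some y -> S y -> psi2sq B y != 0 ->
      l y - b * 4%:R^-1 ^+ n.+1 <= lam Q.
    move=> EQ Sy ne; have [z Ez ez] := kummer_dbl kum EQ ne.
    have [Sz lz] := l_dbl _ _ Sy ne ez.
    have := IHn _ _ Ez Sz; rewrite (hdbl _ _ EQ ne) exprS.
    set q := _ ^+ n; lra.
  have [e0|ne] := eqVneq (psi2sq B x) 0; last exact: not_2torsion.
  rewrite leNgt; apply/negP => h.
  have [d d0 hd] := l_loc _ Sx e0.
  have gap : 0 < l x - b * 4%:R^-1 ^+ n.+1 - lam P by rewrite subr_gt0.
  have [Q [y [EQ yx ne]]] := happ _ _ EP e0 _ _ d0 gap.
  have [Sy ly] := hd _ yx; have := not_2torsion _ _ EQ Sy ne.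
  rewrite ltr_norml => ? /andP[]; lra.
move=> P x EP Sx; rewrite leNgt; apply/negP => h.
have gap : 0 < (l x - lam P) / (b + 1) by rewrite divr_gt0 ?subr_gt0 // ltr_wpDl.
have q01 : 0 <= (4%:R^-1 : R) < 1 by apply/andP; split; lra.
have [n] := exists_exprn_lt q01 gap; have := approx n _ _ EP Sx.
rewrite ltr_pdivlMr; last by rewrite ltr_wpDl.
have /andP[q0 _] := q01; have := exprn_ge0 n q0; set q := _ ^+ n; nra.
Qed.

End KummerHeight.

(** * Lower bounds from division polynomials *)

Section Roots.
Variable R : realType.
Implicit Types (a c : R) (n : nat).

Lemma powRVn a n : (0 < n)%N -> 0 <= a -> (a `^ n%:R^-1) ^+ n = a.
Proof.
by move=> n0 a0; rewrite -powR_mulrn ?powR_ge0 // -powRrM mulVf ?powRr1 // pnatr_eq0 -lt0n.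
Qed.

Lemma powRVn_le a c n : (0 < n)%N -> 0 <= a -> 0 <= c -> (a `^ n%:R^-1 <= c) = (a <= c ^+ n).
Proof.
by move=> n0 a0 c0; rewrite -(@ler_pXn2r _ n) ?nnegrE ?powR_ge0 // powRVn.
Qed.

Lemma powRVn_lt a c n : (0 < n)%N -> 0 <= a -> 0 <= c -> (a `^ n%:R^-1 < c) = (a < c ^+ n).
Proof.
by move=> n0 a0 c0; rewrite -(@ltr_pXn2r _ n) ?nnegrE ?powR_ge0 // powRVn.
Qed.

End Roots.

Section BInvBounds.
Variables (R : realType) (K : fieldType) (abs : nonarch_abs R K).
Implicit Types (B : binv K) (x y t : K) (c : R).

Definition integral_binv B :=
  [/\ abs (b2 B) <= 1, abs (b4 B) <= 1, abs (b6 B) <= 1 & abs (b8 B) <= 1].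

Lemma bshift_le B x c : integral_binv B -> 1 <= c -> abs x <= c ->
  [/\ abs (b2 (bshift B x)) <= c, abs (b4 (bshift B x)) <= c ^+ 2,
      abs (psi2sq B x) <= c ^+ 3 & abs (psi3 B x) <= c ^+ 4].
Proof.
move=> [i2 i4 i6 i8] c1 xc.
have cX a n : abs a <= 1 -> abs a <= c ^+ n by move=> a1; apply: le_trans a1 (exprn_ege1 _ c1).
have mono a m n : abs a <= 1 -> (m <= n)%N -> abs (a * x ^+ m) <= c ^+ n.
  by move=> a1; apply: abs_monomial_le.
have lin a n : abs a <= 1 -> abs (a * x) <= c ^+ n.+1 by move=> a1; rewrite -[x]expr1 mono.
rewrite b2_shift b4_shift b6_shift b8_shift -[X in abs (b2 B + _) <= X]expr1.
by split; rewrite !absD_le ?mono ?lin ?cX ?abs_natM_le ?abs_nat.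
Qed.

Lemma bdisc_le1 B : integral_binv B -> abs (bdisc B) <= 1.
Proof.
move=> [i2 i4 i6 i8]; rewrite /bdisc mulNr.
by rewrite absD_le ?absB_le ?absN ?absM_le1 ?absX_le1 ?abs_nat.
Qed.

Lemma bdisc_lt B c : 0 < c -> abs (b2 B) <= c ^+ 2 -> abs (b4 B) < c ^+ 4 ->
  abs (b6 B) < c ^+ 6 -> abs (b8 B) < c ^+ 8 -> abs (bdisc B) < c ^+ 12.
Proof.
move=> c0 h2 h4 h6 h8.
have cX n : 0 < c ^+ n by rewrite exprn_gt0.
have ltX a m n : abs a < c ^+ m -> (0 < n)%N -> abs (a ^+ n) < c ^+ (m * n).
  by move=> am n0; rewrite absX exprM ltr_pXn2r ?nnegrE // ltW.
rewrite /bdisc mulNr; apply: absD_lt; first (apply: absB_lt; first apply: absB_lt).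
- rewrite absN -[12%N]/(4 + 8)%N exprD; apply: absM_lt => //.
  by rewrite -[4%N]/(2 * 2)%N exprM absX_le.
- by apply: abs_natM_lt; apply: (ltX _ 4%N 3%N).
- by apply: abs_natM_lt; apply: (ltX _ 6%N 2%N).
- rewrite -[12%N]/(6 + 6)%N exprD; apply: absM_lt => //.
  rewrite -mulrA; apply: abs_natM_le; rewrite -[6%N]/(2 + 4)%N exprD.
  by apply: absM_le => //; apply: ltW.
Qed.

Lemma b2_b4_le B c : 0 < c -> brel B -> abs (c4inv B) <= c ^+ 4 ->
  abs (b6 B) <= c ^+ 6 -> abs (b8 B) <= c ^+ 8 ->
  abs (b2 B) <= c ^+ 2 /\ abs (b4 B) <= c ^+ 4.
Proof.
move=> c0 /brel_b4 e4 hc4 h6 h8; have cX n : 0 < c ^+ n by rewrite exprn_gt0.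
have b4_le d : c ^+ 2 <= d -> abs (b2 B) <= d -> abs (b4 B) ^+ 2 <= d * c ^+ 6.
  move=> cd h2; rewrite -absX e4; apply: absB_le; first by rewrite absM_le.
  apply: abs_natM_le; apply: le_trans h8 _.
  by rewrite -[8%N]/(2 + 6)%N exprD ler_pM2r.
suff h2 : abs (b2 B) <= c ^+ 2.
  split => //; rewrite -(@ler_pXn2r _ 2) ?nnegrE //; last exact: ltW.
  by apply: le_trans (b4_le _ (lexx _) h2) _; rewrite -!exprD -exprM.
rewrite leNgt; apply/negP => lt2.
have bp : 0 < abs (b2 B) by apply: lt_trans lt2.
have h4 : abs (b2 B) ^+ 2 <= abs (b4 B).
  have -> : abs (b2 B) ^+ 2 = abs (24%:R * b4 B).
    rewrite (_ : 24%:R * _ = b2 B ^+ 2 - c4inv B); last by rewrite /c4inv; ring.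
    rewrite absBl absX //; apply: le_lt_trans hc4 _.
    by rewrite -[4%N]/(2 * 2)%N exprM ltr_pXn2r ?nnegrE // ltW.
  exact: abs_natM_le.
have : abs (b2 B) ^+ 4 <= abs (b2 B) * c ^+ 6.
  apply: le_trans (b4_le _ (ltW lt2) (lexx _)).
  by rewrite -[4%N]/(2 * 2)%N exprM lerXn2r ?nnegrE ?exprn_ge0.
rewrite exprS ler_pM2l // leNgt => /negP; apply.
by rewrite -[6%N]/(2 * 3)%N exprM ltr_pXn2r ?nnegrE // ltW.
Qed.

End BInvBounds.

Section PsiRadius.
Variables (R : realType) (K : fieldType) (abs : nonarch_abs R K).
Implicit Types (B : binv K) (x y z t : K) (c : R).

Definition psi_radius B x : R :=
  Num.max (abs (psi2sq B x) `^ 6%:R^-1) (abs (psi3 B x) `^ 8%:R^-1).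

Lemma psi_radius_ge0 B x : 0 <= psi_radius B x.
Proof. by rewrite le_max powR_ge0. Qed.
Hint Resolve psi_radius_ge0 : core.

Lemma psi_radius_le B x c : 0 <= c ->
  (psi_radius B x <= c) = (abs (psi2sq B x) <= c ^+ 6) && (abs (psi3 B x) <= c ^+ 8).
Proof. by move=> c0; rewrite ge_max !powRVn_le. Qed.

Lemma psi_radius_lt B x c : 0 <= c ->
  (psi_radius B x < c) = (abs (psi2sq B x) < c ^+ 6) && (abs (psi3 B x) < c ^+ 8).
Proof. by move=> c0; rewrite gt_max !powRVn_lt. Qed.

Lemma psi_radius_lt1 B x :
  (psi_radius B x < 1) = (abs (psi2sq B x) < 1) && (abs (psi3 B x) < 1).
Proof. by rewrite psi_radius_lt // !expr1n. Qed.

Lemma abs_psi2sq_le B x : abs (psi2sq B x) <= psi_radius B x ^+ 6.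
Proof. by have := lexx (psi_radius B x); rewrite {1}psi_radius_le // => /andP[]. Qed.

Lemma abs_psi3_le B x : abs (psi3 B x) <= psi_radius B x ^+ 8.
Proof. by have := lexx (psi_radius B x); rewrite {1}psi_radius_le // => /andP[]. Qed.

Lemma psi_radius_gt0 B x : psi2sq B x != 0 -> 0 < psi_radius B x.
Proof.
move=> ne; rewrite lt_neqAle psi_radius_ge0 andbT; apply: contra_neq ne => r0.
apply/eqP; rewrite -(abs_eq0 abs) eq_le abs_ge0 andbT.
by have := abs_psi2sq_le B x; rewrite -r0 expr0n.
Qed.

Lemma psi_radius_dbl B x z : brel B -> psi2sq B x != 0 -> z * psi2sq B x = dbl_num B x ->
  abs (b4 (bshift B x)) <= psi_radius B x ^+ 4 ->
  psi_radius B x ^+ 8 <= psi_radius B z ^+ 2 * abs (psi2sq B x).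
Proof.
move=> hr ne ez h4; have M0 := psi_radius_gt0 ne.
have := abs_psi2sq_le B x; have := abs_psi3_le B x; have := ltxx (psi_radius B x).
rewrite {1}psi_radius_lt //; set M := psi_radius B x in h4 M0 * => dominant h8 h6.
have MX n : 0 < M ^+ n by rewrite exprn_gt0.
rewrite leNgt; set T := _ * abs _; apply/negP => TM.
have T0 : 0 <= T by rewrite mulr_ge0 ?exprn_ge0.
have F2 : abs (psi4_2 B x ^+ 2) <= T ^+ 3.
  by rewrite -(psi2sq_dbl hr ne ez) absM absX exprMn -exprM ler_wpM2r ?exprn_ge0 ?abs_psi2sq_le.
have F4 : abs (psi3 B x * (psi2sq B x ^+ 2 * psi4_2 B x - psi4_2 B x ^+ 2 - psi3 B x ^+ 3))
    <= T ^+ 4.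
  by rewrite -(psi3_dbl hr ne ez) absM absX exprMn -exprM ler_wpM2r ?exprn_ge0 ?abs_psi3_le.
have F_lt : abs (psi4_2 B x) < M ^+ 12.
  rewrite -(@ltr_pXn2r _ 2) ?nnegrE ?(ltW (MX _)) // -absX; apply: le_lt_trans F2 _.
  by rewrite -exprM -[(12 * 2)%N]/(8 * 3)%N exprM ltr_pXn2r ?nnegrE ?(ltW (MX _)).
have [lt8|ge8] := ltP (abs (psi3 B x)) (M ^+ 8).
  move: dominant; rewrite lt8 andbT => /negbT; rewrite -leNgt => ge6.
  have e6 : abs (psi2sq B x ^+ 2) = M ^+ 12.
    by rewrite absX -[12%N]/(6 * 2)%N exprM; congr (_ ^+ _); apply/le_anti; rewrite h6.
  move: F_lt; rewrite /psi4_2 absBr e6 ?ltxx // -[12%N]/(4 + 8)%N exprD.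
  exact: absM_lt.
have e8 : abs (psi3 B x) = M ^+ 8 by apply/le_anti; rewrite h8.
have e24 : abs (psi3 B x ^+ 3) = M ^+ 24 by rewrite absX e8 -exprM.
move: F4; rewrite absM absBr ?e24; last first.
  apply: absB_lt.
    rewrite -[24%N]/(12 + 12)%N exprD; apply: absM_lt => //.
    by rewrite -[12%N]/(6 * 2)%N exprM absX_le.
  by rewrite absX -[24%N]/(12 * 2)%N exprM ltr_pXn2r ?nnegrE ?(ltW (MX _)).
rewrite e8 -exprD -[(8 + 24)%N]/(8 * 4)%N exprM leNgt.
by rewrite ltr_pXn2r ?nnegrE ?(ltW (MX _)) ?TM.
Qed.

Lemma psi_radius_le_max1 B x : integral_binv abs B -> psi_radius B x ^+ 2 <= Num.max 1 (abs x).
Proof.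
move=> hB; set c := Num.max 1 (abs x).
have c1 : 1 <= c by rewrite le_max lexx.
have xc : abs x <= c by rewrite le_max lexx orbT.
have c0 : 0 <= c by apply: le_trans c1.
have [_ _ h6 h8] := bshift_le hB c1 xc.
rewrite -(sqr_sqrtr c0) lerXn2r ?nnegrE ?sqrtr_ge0 // psi_radius_le ?sqrtr_ge0 //.
by rewrite -[6%N]/(2 * 3)%N -[8%N]/(2 * 4)%N !exprM sqr_sqrtr // h6 h8.
Qed.

(* At least one of 4 and 3, the leading coefficients of the two division polynomials, is a
   unit. *)
Lemma psi_radius_ge B x : integral_binv abs B -> 1 < abs x -> abs x <= psi_radius B x ^+ 2.
Proof.
move=> [i2 i4 i6 i8] x1; rewrite leNgt; apply/negP => lt.
have : psi_radius B x < Num.sqrt (abs x).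
  by rewrite -(@ltr_pXn2r _ 2) ?nnegrE ?sqrtr_ge0 // sqr_sqrtr.
rewrite psi_radius_lt ?sqrtr_ge0 // -[6%N]/(2 * 3)%N -[8%N]/(2 * 4)%N !exprM sqr_sqrtr //.
have mono a m n : abs a <= 1 -> (m < n)%N -> abs (a * x ^+ m) < abs x ^+ n.
  by move=> a1; apply: abs_monomial_lt.
have cst a n : abs a <= 1 -> (0 < n)%N -> abs a < abs x ^+ n.
  by move=> a1 n0; have := mono a 0%N n a1 n0; rewrite expr0 mulr1.
have lin a n : abs a <= 1 -> (1 < n)%N -> abs (a * x) < abs x ^+ n.
  by move=> a1 n0; rewrite -[x in a * x]expr1 mono.
have [e4|e3] := abs_coprime_nat abs (isT : coprime 4 3) => /andP[l6 l8].
  have e : abs (4%:R * x ^+ 3) = abs x ^+ 3 by rewrite absM e4 mul1r absX.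
  move: l6; rewrite b6_shift absDr e ?ltxx //.
  by rewrite !absD_lt ?mono ?lin ?cst ?abs_natM_le.
have e : abs (3%:R * x ^+ 4) = abs x ^+ 4 by rewrite absM e3 mul1r absX.
move: l8; rewrite b8_shift absDr e ?ltxx //.
by rewrite !absD_lt ?mono ?lin ?cst ?abs_natM_le.
Qed.

Lemma abs_psi3_near B x : psi3 B x != 0 ->
  exists2 d : R, 0 < d & forall y, abs (y - x) < d -> abs (psi3 B y) = abs (psi3 B x).
Proof.
move=> n8; set u := abs (psi3 B x).
pose c := 1 + abs (b2 (bshift B x)) + abs (b4 (bshift B x)) + abs (psi2sq B x).
have [p2 p4 p6] : [/\ 0 <= abs (b2 (bshift B x)), 0 <= abs (b4 (bshift B x))
  & 0 <= abs (psi2sq B x)] by [].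
have u0 : 0 < u by rewrite abs_gt0.
have c0 : 0 < c by rewrite /c; lra.
exists (Num.min 1 (u / c)) => [|y]; first by rewrite lt_min ltr01 divr_gt0.
rewrite lt_min ltr_pdivlMr // => /andP[t1 tu].
rewrite -[y](subrKC x) -bshiftD; move: (y - x) t1 tu => t t1 tu.
rewrite [b8 (bshift (bshift _ _) _)]b8_shift.
set r := (X in abs X); have -> : r = psi3 B x + t * (3%:R * psi2sq B x
    + (3%:R * b4 (bshift B x) + (b2 (bshift B x) + 3%:R * t) * t) * t) by rewrite /r; ring.
have tM a : abs a <= c -> abs (a * t) <= c.
  by move=> ac; rewrite -[c]mulr1 absM_le // ltW.
rewrite absDl //; apply: le_lt_trans tu; rewrite absM ler_wpM2l //.
apply: absD_le; first by apply: abs_natM_le; rewrite /c; lra.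
apply/tM/absD_le; first by apply: abs_natM_le; rewrite /c; lra.
apply/tM/absD_le; first by rewrite /c; lra.
by apply: abs_natM_le; rewrite /c; lra.
Qed.

Lemma psi_radius_near B x : psi2sq B x = 0 -> psi3 B x != 0 ->
  exists2 d : R, 0 < d & forall y, abs (y - x) < d -> psi_radius B x <= psi_radius B y.
Proof.
move=> e6 /abs_psi3_near[d d0 hd]; exists d => // y /hd e8.
by rewrite psi_radius_le // e6 abs0 exprn_ge0 // -e8 abs_psi3_le.
Qed.

Lemma psi_radius_potgood B x : brel B -> bdisc B != 0 ->
  abs (c4inv B) ^+ 3 <= abs (bdisc B) ->
  abs (bdisc B) `^ 12%:R^-1 <= psi_radius B x /\
  abs (b4 (bshift B x)) <= psi_radius B x ^+ 4.
Proof.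
move=> hr d0; have := brel_shift x hr; rewrite -(c4inv_shift B x) -(bdisc_shift x hr).
have := abs_psi2sq_le B x; have := abs_psi3_le B x.
have := psi_radius_ge0 B x; set M := psi_radius B x => M0.
rewrite -(bdisc_shift x hr) in d0; clearbody M; move: (bshift B x) d0 => {hr}B d0 h8 h6 hr hc.
have Dp : 0 < abs (bdisc B) by rewrite abs_gt0.
set d := _ `^ _; have dp : 0 < d by rewrite powR_gt0.
have d12 : d ^+ 12 = abs (bdisc B) by rewrite powRVn.
have hc4 : abs (c4inv B) <= d ^+ 4.
  by rewrite -(@ler_pXn2r _ 3) ?nnegrE ?exprn_ge0 ?(ltW dp) // -exprM d12.
have dM : d <= M.
  rewrite leNgt; apply/negP => Md.
  have MX n : M ^+ n.+1 < d ^+ n.+1 by rewrite ltr_pXn2r ?nnegrE ?(ltW dp).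
  have lt6 := le_lt_trans h6 (MX 5%N); have lt8 := le_lt_trans h8 (MX 7%N).
  have [h2 _] := b2_b4_le dp hr hc4 (ltW lt6) (ltW lt8).
  have lt4 : abs (b4 B) < d ^+ 4.
    rewrite -(@ltr_pXn2r _ 2) ?nnegrE ?exprn_ge0 ?(ltW dp) // -absX (brel_b4 hr) -exprM.
    apply: absB_lt; last exact: abs_natM_lt.
    by rewrite -[(4 * 2)%N]/(2 + 6)%N exprD absM_lt ?exprn_gt0.
  by have := bdisc_lt dp h2 lt4 lt6 lt8; rewrite d12 ltxx.
split => //; have hM : abs (c4inv B) <= M ^+ 4.
  by apply: le_trans hc4 _; rewrite lerXn2r ?nnegrE // ltW.
by have [] := b2_b4_le (lt_le_trans dp dM) hr hM h6 h8.
Qed.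

End PsiRadius.

Section PsiRadiusHeight.
Variables (R : realType) (K : fieldType) (abs : nonarch_abs R K).
Variables (G : zmodType) (lam : G -> R) (B : binv K) (X : G -> option K).
Hypotheses (kum : kummer_line B X) (hgt : kummer_height abs B X lam).
Hypothesis hB : integral_binv abs B.
Local Notation rho := (psi_radius abs B).

Lemma height_ge_psi_radius (c : R) : 0 < c ->
  (forall x, c <= rho x -> abs (b4 (bshift B x)) <= rho x ^+ 4) ->
  forall P x, X P = Some x -> c <= rho x ->
  ln (rho x) - 12%:R^-1 * ln (abs (bdisc B)) <= lam P.
Proof.
move=> c0 h4; have rho_gt0 x : c <= rho x -> 0 < rho x := lt_le_trans c0.
apply: (kummer_height_le kum hgt).
- exists (- 12%:R^-1 * ln (abs (bdisc B))) => x cx; have := psi_radius_le_max1 x hB.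
  rewrite -ler_ln ?posrE ?exprn_gt0 ?rho_gt0 // ?lt_max ?ltr01 // lnXn ?rho_gt0 //; lra.
- move=> x z cx ne ez; have h := psi_radius_dbl (kummer_rel kum) ne ez (h4 _ cx).
  have r0 := rho_gt0 _ cx; have p0 : 0 < abs (psi2sq B x) by rewrite abs_gt0.
  have rz : rho x <= rho z.
    rewrite -(@ler_pXn2r _ 2) ?nnegrE ?psi_radius_ge0 //.
    rewrite -(ler_pM2r (exprn_gt0 6 r0)) -exprD; apply: le_trans h _.
    by rewrite ler_wpM2l ?exprn_ge0 ?psi_radius_ge0 ?abs_psi2sq_le.
  have rz0 := lt_le_trans r0 rz; split; first exact: le_trans rz.
  move: h; rewrite -ler_ln ?posrE ?mulr_gt0 ?exprn_gt0 // lnM ?posrE ?exprn_gt0 // !lnXn //.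
  lra.
- move=> x cx e6; have r0 := rho_gt0 _ cx.
  have n8 : psi3 B x != 0.
    by apply: contraTneq r0 => e8; rewrite -leNgt psi_radius_le // e6 e8 abs0 !expr0n lexx.
  have [d d0 hd] := psi_radius_near abs e6 n8; exists d => // y /hd rxy.
  split; first exact: le_trans rxy.
  by rewrite lerD2r ler_ln ?posrE // (lt_le_trans r0).
Qed.

Definition nonsingular P := if X P is Some x then 1 <= rho x else true.

Lemma height_ge_nonsingular P : P != 0 -> nonsingular P ->
  - 12%:R^-1 * ln (abs (bdisc B)) <= lam P.
Proof.
move=> P0; rewrite /nonsingular; case EP: (X P) => [x|]; last first.
  by rewrite (kummer_eq0 kum EP) eqxx in P0.
move=> r1; have : 0 <= ln (rho x) by rewrite ln_ge0.
have := @height_ge_psi_radius 1 ltr01 _ P x EP r1; rewrite mulNr => h r0.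
apply: le_trans (h _); first by rewrite ler_wpDl.
move=> {EP r1 r0 h}y r1; have [y1|y1] := leP (abs y) 1.
  have [_ h4 _ _] := bshift_le hB (lexx 1) y1.
  by apply: le_trans h4 _; rewrite expr1n exprn_ege1.
have [_ h4 _ _] := bshift_le hB (ltW y1) (lexx _).
apply: le_trans h4 _; rewrite -[4%N]/(2 * 2)%N exprM.
by rewrite lerXn2r ?nnegrE ?exprn_ge0 ?psi_radius_ge0 // psi_radius_ge.
Qed.

Lemma height_ge0_potgood P : abs (c4inv B) ^+ 3 <= abs (bdisc B) -> P != 0 -> 0 <= lam P.
Proof.
move=> hc P0; case EP: (X P) => [x|]; last by rewrite (kummer_eq0 kum EP) eqxx in P0.
have d0 := kummer_disc kum; have Dp : 0 < abs (bdisc B) by rewrite abs_gt0.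
have hrho y := psi_radius_potgood y (kummer_rel kum) d0 hc; have [hx _] := hrho x.
apply: le_trans (height_ge_psi_radius (powR_gt0 _ Dp) (fun y _ => (hrho y).2) EP hx).
have dp : 0 < abs (bdisc B) `^ 12%:R^-1 by rewrite powR_gt0.
by rewrite subr_ge0 -ln_powR ler_ln ?posrE // (lt_le_trans dp).
Qed.

End PsiRadiusHeight.

Section NonsingularSubgroup.
Variables (R : realType) (K : fieldType) (abs : nonarch_abs R K).
Implicit Types (B : binv K) (x y s u : K).

(* The reduction has its singular point at x = 0. *)
Definition singular_at0 B :=
  [/\ abs (b2 B) <= 1, abs (b4 B) < 1, abs (b6 B) < 1 & abs (b8 B) < 1].

Lemma singular_at0_shift B s : brel B -> integral_binv abs B -> psi_radius abs B s < 1 ->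
  singular_at0 (bshift B s).
Proof.
move=> hr hB rs; have s1 : abs s <= 1.
  rewrite leNgt; apply/negP => s1; have := psi_radius_ge hB s1.
  by rewrite leNgt (lt_trans _ s1) // exprn_ilt1 // psi_radius_ge0.
have [l2 _ _ _] := bshift_le hB (lexx 1) s1.
move: rs; rewrite psi_radius_lt1 => /andP[l6 l8]; split => //.
rewrite -(@expr_lt1 _ 2) // -absX (brel_b4 (brel_shift s hr)).
by apply: absB_lt; [exact: absM_lt1 | exact: abs_natM_lt].
Qed.

Lemma psi_radius_lt1_near0 B u : singular_at0 B -> abs u < 1 -> psi_radius abs B u < 1.
Proof.
move=> [l2 l4 l6 l8] u1; rewrite psi_radius_lt1 b6_shift b8_shift.
have [l4' l6'] := (ltW l4, ltW l6).
have mono a n : abs a <= 1 -> abs (a * u ^+ n.+1) < 1 by move=> a1; rewrite absM_lt1 ?absX_lt1.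
have lin a : abs a <= 1 -> abs (a * u) < 1 by move=> a1; rewrite absM_lt1.
by rewrite !absD_lt ?mono ?lin ?abs_natM_le ?abs_nat.
Qed.

Lemma abs_mul_num B x y : singular_at0 B -> 1 <= abs x -> 1 <= abs y ->
  abs (mul_num B x y) = abs x ^+ 2 * abs y ^+ 2.
Proof.
move=> [_ l4 l6 l8] x1 y1; have e : abs (x ^+ 2 * y ^+ 2) = (abs x * abs y) ^+ 2.
  by rewrite absM !absX exprMn.
have xy1 : 1 <= abs x * abs y by rewrite mulr_ege1.
have x0 : 0 <= abs x by []. have y0 : 0 <= abs y by [].
have term_lt a b : abs a < 1 -> abs b <= abs x * abs y -> abs (a * b) < (abs x * abs y) ^+ 2.
  move=> a1 hb; apply: lt_le_trans (_ : abs x * abs y <= _); last by rewrite ler_eXnr.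
  by rewrite mulrC -[X in _ < X]mulr1; apply: absM_lt => //; apply: lt_le_trans xy1.
have -> : mul_num B x y =
    x ^+ 2 * y ^+ 2 - (b4 B * (x * y) + b6 B * (x + y) + b8 B * 1) by rewrite /mul_num; ring.
rewrite -[RHS]exprMn absBl e //; apply: absD_lt; last by apply: term_lt; rewrite ?abs1.
apply: absD_lt; apply: term_lt; rewrite ?absM //.
by apply: absD_le; nra.
Qed.

Lemma abs_dbl_num B x : singular_at0 B -> 1 <= abs x -> abs (dbl_num B x) = abs x ^+ 4.
Proof.
move=> [_ l4 l6 l8] x1.
have term_lt a n : abs a < 1 -> (n <= 4)%N -> abs (a * x ^+ n) < abs x ^+ 4.
  move=> a1 n4; rewrite mulrC -[X in _ < X]mulr1; apply: absM_lt => //.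
    by rewrite exprn_gt0 // (lt_le_trans _ x1).
  by rewrite absX ler_weXn2l.
have -> : dbl_num B x =
    x ^+ 4 - (b4 B * x ^+ 2 + 2%:R * b6 B * x ^+ 1 + b8 B * x ^+ 0) by rewrite /dbl_num; ring.
by rewrite absBl absX // !absD_lt ?term_lt ?abs_natM_lt.
Qed.

Variable G : zmodType.
Implicit Types (X : G -> option K) (P Q : G).

Lemma nonsingularN B X P : kummer_line B X -> nonsingular abs B X (- P) = nonsingular abs B X P.
Proof. by move=> kum; rewrite /nonsingular (kummer_opp kum). Qed.

Lemma singular_at0_sub B X P Q x y : kummer_line B X -> singular_at0 B ->
  X P = Some x -> X Q = Some y -> 1 <= abs x -> 1 <= abs y -> X (P - Q) <> Some 0.
Proof.
move=> kum s0 EP EQ x1 y1 E0; have [exy|nxy] := eqVneq x y; last first.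
  have [z [w [_ EW _]]] := kummer_add kum EP EQ nxy.
  move: EW; rewrite E0 => -[<-]; rewrite mulr0 mul0r => /esym/eqP.
  rewrite -(abs_eq0 abs) abs_mul_num // mulf_eq0 !expf_eq0 /= !gt_eqF //.
    exact: lt_le_trans y1.
  exact: lt_le_trans x1.
have e : X P = X Q by rewrite EP EQ exy.
have [ePQ|ePQ] := kummer_inj kum e; first by move: E0; rewrite ePQ subrr (kummer_0 kum).
move: E0; have -> : P - Q = P + P by rewrite -ePQ.
have [e0|ne] := eqVneq (psi2sq B x) 0.
  by rewrite (kummer_dbl0 kum EP e0) (kummer_0 kum).
have [z ->] := kummer_dbl kum EP ne; move=> ez [z0]; move: ez.
rewrite z0 mul0r => /esym/eqP.
by rewrite -(abs_eq0 abs) abs_dbl_num // expf_eq0 /= gt_eqF // (lt_le_trans _ x1).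
Qed.

Lemma nonsingularB B X P Q : kummer_line B X -> integral_binv abs B ->
  nonsingular abs B X P -> nonsingular abs B X Q -> nonsingular abs B X (P - Q).
Proof.
move=> kum hB hP hQ; case EP: (X P) => [x|]; last first.
  by rewrite (kummer_eq0 kum EP) sub0r nonsingularN.
case EQ: (X Q) => [y|]; last by rewrite (kummer_eq0 kum EQ) subr0.
rewrite /nonsingular EP EQ in hP hQ *; case ES: (X (P - Q)) => [s|] //.
rewrite leNgt; apply/negP => rs.
have s0 := singular_at0_shift (kummer_rel kum) hB rs.
have far u : 1 <= psi_radius abs B u -> 1 <= abs (u - s).
  apply: contraTT; rewrite -!ltNge => us; rewrite -[u](subrKC s).
  by have := psi_radius_lt1_near0 s0 us; rewrite /psi_radius bshiftD.
have kumS := kummer_line_affine s (oner_neq0 K) kum.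
have scale1 : bscale (bshift B s) 1 = bshift B s.
  by case: (bshift B s) => *; rewrite /bscale /= !expr1n !divr1.
rewrite scale1 in kumS; have shift T u : X T = Some u -> xaffine s 1 X T = Some (u - s).
  by rewrite /xaffine => ->; rewrite /= divr1.
have := singular_at0_sub kumS s0 (shift _ _ EP) (shift _ _ EQ) (far _ hP) (far _ hQ).
by rewrite (shift _ _ ES) subrr.
Qed.

End NonsingularSubgroup.

(** * The Tate curve *)

(* The b-invariants of [y ^+ 2 + x * y = x ^+ 3 + b]. Replacing the Tate curve by this
   equation, which has the same reduction, keeps all formulas polynomial. *)
Definition tate_binv (K : fieldType) (b : K) := BInv 1 0 (4%:R * b) b.

Section TateNormalForm.
Variable K : fieldType.
Hypotheses (two_neq0 : (2%:R : K) != 0) (three_neq0 : (3%:R : K) != 0).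

Lemma smooth_neq0 i j : ((2 ^ i * 3 ^ j)%N%:R : K) != 0.
Proof. by rewrite natrM !natrX mulf_neq0 ?expf_neq0. Qed.

Lemma tate_normal_form (B : binv K) v w : brel B -> v != 0 ->
  c4inv B = v ^+ 2 -> c6inv B = v ^+ 3 * (1 + 2%:R * w) ->
  bscale (bshift B ((- b2 B - v) / 12%:R)) (- v) = tate_binv (w / 432%:R).
Proof.
move=> hr v0 hc4 hc6; have n4 : (4%:R : K) != 0 := smooth_neq0 2 0.
have n12 : (12%:R : K) != 0 := smooth_neq0 2 1.
have n24 : (24%:R : K) != 0 := smooth_neq0 3 1.
have n216 : (216%:R : K) != 0 := smooth_neq0 3 3.
have n432 : (432%:R : K) != 0 := smooth_neq0 4 3.
set x0 := _ / 12%:R; set b := w / 432%:R.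
have e2 : b2 (bshift B x0) = - v by rewrite b2_shift /x0; field.
have e4 : b4 (bshift B x0) = 0.
  apply: (mulfI n24); rewrite mulr0.
  transitivity (b2 (bshift B x0) ^+ 2 - c4inv (bshift B x0)); first by rewrite /c4inv; ring.
  by rewrite c4inv_shift hc4 e2 sqrrN subrr.
have e6 : psi2sq B x0 = 4%:R * b * (- v) ^+ 3.
  apply: (mulfI n216); transitivity
    (- c6inv (bshift B x0) - b2 (bshift B x0) ^+ 3 + 36%:R * b2 (bshift B x0) * b4 (bshift B x0)).
    by rewrite /c6inv; ring.
  by rewrite c6inv_shift hc6 e2 e4 /b; field.
have e8 : psi3 B x0 = b * (- v) ^+ 4.
  have := brel_shift x0 hr; rewrite /brel e2 e4 e6 => h; apply: (mulfI n4).
  by rewrite h; ring.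
have vX n : (- v) ^+ n != 0 by rewrite expf_neq0 // oppr_eq0.
rewrite /bscale /tate_binv; congr BInv; rewrite ?e2 ?e4 ?e6 ?e8 ?mul0r ?mulfK //.
by rewrite divff // oppr_eq0.
Qed.

Variables (R : realType) (abs : nonarch_abs R K).
Hypothesis cpl : abs_complete abs.

(* If |j| > 1, then c6 ^+ 2 / c4 ^+ 3 = 1 - 1728 / j has a square root 1 + 2 w in K, and c4 is
   a square as well. *)
Lemma c4inv_sqrt (B : binv K) : brel B -> abs (bdisc B) < abs (c4inv B) ^+ 3 ->
  exists v w, [/\ v != 0, c4inv B = v ^+ 2, c6inv B = v ^+ 3 * (1 + 2%:R * w)
    & abs w <= abs (432%:R * bdisc B / c4inv B ^+ 3)].
Proof.
move=> hr hc; have c40 : c4inv B != 0.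
  by apply: contraTneq hc => ->; rewrite abs0 expr0n /= -leNgt.
set C4 := c4inv B in hc c40 *; set C6 := c6inv B.
have c4p : 0 < abs C4 by rewrite abs_gt0.
pose a := - (432%:R * bdisc B / C4 ^+ 3).
have a1 : abs a < 1.
  rewrite absN -mulrA; apply: abs_natM_lt.
  by rewrite absM absV absX ltr_pdivrMr ?mul1r // exprn_gt0.
have [w ew wa] := sqrt_1D4M cpl a1.
have w1 : 1 + 2%:R * w != 0.
  rewrite -(abs_eq0 abs) absDl ?abs1 ?oner_eq0 //.
  by apply: abs_natM_lt; apply: le_lt_trans a1.
have eC6 : C6 ^+ 2 = C4 ^+ 3 * (1 + 2%:R * w) ^+ 2.
  by rewrite ew /C6 c4inv_c6inv_disc // -/C4 /a; field.
pose v := C6 / (C4 * (1 + 2%:R * w)).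
have v2 : C4 = v ^+ 2 by rewrite /v expr_div_n eC6; field; rewrite c40 w1.
exists v, w; split => //; last by rewrite -[X in _ <= X]absN.
- by apply: contraNneq c40 => e; rewrite v2 e expr0n.
- by rewrite exprSr -v2 /v; field; rewrite c40 w1.
Qed.

Lemma bdisc_tate b : abs b < 1 -> abs (bdisc (tate_binv b)) = abs b.
Proof.
move=> b1; have -> : bdisc (tate_binv b) = - (b * (1 + 432%:R * b)).
  by rewrite /bdisc /tate_binv /b2 /b4 /b6 /b8; ring.
by rewrite absN absM absDl ?abs1 ?mulr1 // abs_natM_lt.
Qed.

Lemma tate_form_exists (B : binv K) : brel B -> bdisc B != 0 -> integral_binv abs B ->
  abs (bdisc B) < abs (c4inv B) ^+ 3 ->
  exists r k b, [/\ k != 0, b != 0, abs b < 1, abs k <= 1 &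
    bscale (bshift B r) k = tate_binv b].
Proof.
move=> hr d0 [i2 i4 _ _] hc; have [v [w [v0 hc4 hc6 wa]]] := c4inv_sqrt hr hc.
have n432 : (432%:R : K) != 0 := smooth_neq0 4 3.
have tateE := tate_normal_form hr v0 hc4 hc6.
exists ((- b2 B - v) / 12%:R), (- v), (w / 432%:R); split => //.
- by rewrite oppr_eq0.
- apply: contraNneq d0 => w0; have k0 : - v != 0 by rewrite oppr_eq0.
  have := bdisc_scale (bshift B ((- b2 B - v) / 12%:R)) k0.
  rewrite tateE w0 bdisc_shift // /bdisc /tate_binv /b2 /b4 /b6 /b8 => e.
  have : bdisc B / (- v) ^+ 6 == 0 by rewrite -e; apply/eqP; ring.
  by rewrite mulf_eq0 invr_eq0 expf_eq0 (negPf k0) andbF orbF.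
- have c4p : 0 < abs (c4inv B) ^+ 3 by apply: le_lt_trans hc.
  apply: le_lt_trans (_ : abs (bdisc B) / abs (c4inv B) ^+ 3 < 1); last first.
    by rewrite ltr_pdivrMr ?mul1r.
  rewrite absM absV ler_pdivrMr ?abs_gt0 //; apply: le_trans wa _.
  by rewrite -mulrA absM mulrC absM absV absX.
- rewrite absN -(@expr_le1 _ 2) // -absX -hc4 /c4inv.
  by rewrite absB_le ?absX_le1 ?abs_natM_le.
Qed.

End TateNormalForm.

(* [V / 2 * B_2 (m / V)], with [B_2] the second Bernoulli polynomial. *)
Definition bern2 (R : fieldType) (V m : R) := V / 12%:R - m / 2%:R + m ^+ 2 / (2%:R * V).

Section Bern2.
Variable R : realFieldType.
Implicit Types V m : R.

Lemma bern2_0 V : bern2 V 0 = V / 12%:R.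
Proof. by rewrite /bern2 expr0n /= !mul0r subr0 addr0. Qed.

Lemma bern2_sym V m : V != 0 -> bern2 V (V - m) = bern2 V m.
Proof. by move=> V0; rewrite /bern2; field. Qed.

Lemma bern2_min V m : V != 0 -> bern2 V (Num.min m (V - m)) = bern2 V m.
Proof. by case: leP => // _ V0; rewrite bern2_sym. Qed.

Lemma bern2_dbl V m : V != 0 -> bern2 V (m *+ 2) = 4%:R * bern2 V m + m - V / 4%:R.
Proof. by move=> V0; rewrite /bern2; field. Qed.

Lemma bern2_le V m : 0 < V -> 0 <= m <= V -> bern2 V m <= V / 12%:R.
Proof.
move=> V0 /andP[m0 mV].
have -> : bern2 V m = V / 12%:R - m * (V - m) / (2%:R * V).
  by rewrite /bern2; field; rewrite gt_eqF.
by rewrite gerBl divr_ge0 ?mulr_ge0 ?subr_ge0 // ltW.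
Qed.

End Bern2.

(* The addition law on a circle of length V folded by P |-> - P: if [m1] and [m2] are the
   distances of P and Q to the origin, then [n1] and [n2] are those of P + Q and P - Q, up to
   order. *)
Definition folded_sum (R : numDomainType) (V m1 m2 n1 n2 : R) :=
  let s := Num.min (m1 + m2) (V - (m1 + m2)) in
  (n1 = `|m1 - m2| /\ n2 = s) \/ (n2 = `|m1 - m2| /\ n1 = s).

Section FoldedSum.
Variable R : realFieldType.
Implicit Types V m n : R.

Lemma folded_sum_sym V m1 m2 n1 n2 : folded_sum V m1 m2 n1 n2 -> folded_sum V m2 m1 n1 n2.
Proof. by rewrite /folded_sum distrC [m1 + m2]addrC. Qed.

Lemma folded_sum_swap V m1 m2 n1 n2 : folded_sum V m1 m2 n1 n2 -> folded_sum V m1 m2 n2 n1.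
Proof. by case=> -[? ?]; [right | left]. Qed.

Lemma folded_sum0 V m : 0 <= m <= V / 2%:R -> folded_sum V m 0 m m.
Proof.
by move=> /andP[m0 mV]; left; rewrite addr0 subr0 ger0_norm // min_l //; lra.
Qed.

Lemma folded_sum_half V m : 0 <= m <= V / 2%:R ->
  folded_sum V m (V / 2%:R) (V / 2%:R - m) (V / 2%:R - m).
Proof.
move=> /andP[m0 mV]; left; rewrite min_r; last by lra.
by rewrite distrC ger0_norm ?subr_ge0 //; split => //; lra.
Qed.

Lemma folded_sum_diag V m : folded_sum V m m 0 (Num.min (m *+ 2) (V - m *+ 2)).
Proof. by left; rewrite subrr normr0 -mulr2n. Qed.

End FoldedSum.

Section TateDepth.
Variables (R : realType) (K : fieldType) (abs : nonarch_abs R K) (b : K).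
Hypotheses (b_neq0 : b != 0) (b_lt1 : abs b < 1).
Implicit Types (x y z w s t : K).
Local Notation V := (- ln (abs b)).
Local Notation q := (Num.sqrt (abs b)).

Lemma abs_b_gt0 : 0 < abs b. Proof. by rewrite abs_gt0. Qed.
Lemma q_gt0 : 0 < q. Proof. by rewrite sqrtr_gt0 abs_b_gt0. Qed.
Lemma sqr_q : q ^+ 2 = abs b. Proof. by rewrite sqr_sqrtr. Qed.
Lemma q_lt1 : q < 1. Proof. by rewrite -(@expr_lt1 _ 2) ?sqrtr_ge0 // sqr_q. Qed.
Lemma ln_q : - ln q = V / 2%:R.
Proof. by rewrite -[in RHS]sqr_q lnXn ?q_gt0 // mulr2n; lra. Qed.
Lemma tate_V_gt0 : 0 < V. Proof. by rewrite oppr_gt0 ln_lt0 // abs_b_gt0. Qed.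
Lemma sqr_lt_q a : 0 <= a -> a <= q -> a ^+ 2 < q.
Proof.
move=> a0 aq; rewrite expr2; apply: le_lt_trans (ler_wpM2l a0 aq) _.
by rewrite gtr_pMl ?q_gt0 // (le_lt_trans aq q_lt1).
Qed.

Hint Resolve abs_b_gt0 q_gt0 q_lt1 tate_V_gt0 : core.
Hint Extern 0 (is_true (@Order.le _ _ _ (Num.sqrt _))) => (apply: sqrtr_ge0) : core.

(* As |x| is clamped before its logarithm is taken, x = 0 gets depth V / 2 although
   [ln 0 = 0]. *)
Definition tate_depth x : R := - ln (Num.max q (Num.min 1 (abs x))).

Lemma tate_depth_big x : 1 <= abs x -> tate_depth x = 0.
Proof. by move=> x1; rewrite /tate_depth min_l // max_r ?ln1 ?oppr0 // ltW. Qed.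

Lemma tate_depth_small x : abs x <= q -> tate_depth x = V / 2%:R.
Proof. by move=> xq; rewrite /tate_depth max_l ?ln_q // ge_min xq orbT. Qed.

Lemma tate_depth_mid x : q <= abs x <= 1 -> tate_depth x = - ln (abs x).
Proof. by case/andP=> qx x1; rewrite /tate_depth min_r // max_r. Qed.

Lemma tate_depth_itv x : 0 <= tate_depth x <= V / 2%:R.
Proof.
have m0 : 0 < Num.max q (Num.min 1 (abs x)) by rewrite lt_max q_gt0.
rewrite -ln_q /tate_depth oppr_ge0 lerN2 ler_ln ?posrE // le_max lexx andbT.
by rewrite ln_le0 // ge_max ge_min lexx ltW.
Qed.

Lemma tate_depth_near x y : abs (y - x) < q -> tate_depth y = tate_depth x.
Proof.
move=> yx; have [xq|xq] := leP (abs x) q; last first.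
  by rewrite /tate_depth (abs_close (lt_trans yx xq)).
rewrite !tate_depth_small // -(subrK x y).
by apply: absD_le => //; apply: ltW.
Qed.

(* The element s - t has absolute value [Num.max (p ^+ 2) (abs b)] unless p = q, in which
   case the quotient has depth V / 2 whatever the cancellation. *)
Lemma tate_depth_quotient x s t p : abs b < p < 1 -> abs s = p ^+ 2 -> abs t = abs b ->
  abs x = abs (s - t) / p -> tate_depth x = Num.min (- ln p) (V + ln p).
Proof.
case/andP=> bp p1 hs ht hx; have p0 := lt_trans abs_b_gt0 bp.
have lnE : (- ln p <= V + ln p) = (q <= p).
  by rewrite -[q <= p]ler_ln ?posrE // -[ln q]opprK ln_q; apply/idP/idP; lra.
have sqE (a c : R) : 0 <= a -> 0 <= c -> (a ^+ 2 < c ^+ 2) = (a < c).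
  by move=> ? ?; rewrite ltr_pXn2r ?nnegrE.
have [pq|qp|epq] := ltgtP p q.
- have e : abs x = abs b / p by rewrite hx absBr ?ht // hs -sqr_q sqE // ltW.
  rewrite tate_depth_mid e.
    by rewrite ln_div ?posrE // opprB addrC min_r // ltW // ltNge lnE -ltNge.
  rewrite ler_pdivlMr // ler_pdivrMr // mul1r (ltW bp) andbT.
  by rewrite -[X in _ <= X]sqr_q expr2 ler_pM2l // ltW.
- have e : abs x = p.
    rewrite hx absBl hs; first by rewrite expr2 mulfK // gt_eqF.
    by rewrite ht -sqr_q sqE // ltW.
  by rewrite tate_depth_mid e ?ltW //= min_l // lnE ltW.
- rewrite tate_depth_small; first by rewrite -[ln p]opprK epq ln_q min_l; lra.
  rewrite hx ler_pdivrMr // epq -expr2; apply: absB_le; rewrite ?hs ?ht ?sqr_q //.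
  by rewrite epq sqr_q.
Qed.

Lemma singular_at0_tate : singular_at0 abs (tate_binv b).
Proof. by split; rewrite ?abs1 ?abs0 // abs_natM_lt. Qed.

Lemma add_num_tate x y :
  add_num (tate_binv b) x y = x * y + (2%:R * (x * y * (x + y)) + 4%:R * b).
Proof. by rewrite /add_num /tate_binv /b2 /b4 /b6; ring. Qed.

Lemma mul_num_tate x y :
  mul_num (tate_binv b) x y = (x * y) ^+ 2 - b * (1 + 4%:R * (x + y)).
Proof. by rewrite /mul_num /tate_binv /b4 /b6 /b8; ring. Qed.

Lemma dbl_num_tate x : dbl_num (tate_binv b) x = x ^+ 4 - b * (1 + 8%:R * x).
Proof. by rewrite /dbl_num /tate_binv /b4 /b6 /b8; ring. Qed.

Lemma psi2sq_tate x : psi2sq (tate_binv b) x = x ^+ 2 + (4%:R * b + 4%:R * x ^+ 3).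
Proof. by rewrite b6_shift /tate_binv /b2 /b4 /b6; ring. Qed.

Lemma abs_bM_1D n x : abs x < 1 -> abs (b * (1 + n%:R * x)) = abs b.
Proof. by move=> x1; rewrite absM absDl ?abs1 ?mulr1 // abs_natM_lt. Qed.

Lemma abs_bM_1D_le n x : 1 <= abs x -> abs (b * (1 + n%:R * x)) <= abs b * abs x.
Proof. by move=> x1; rewrite absM ler_pM2l // absD_le ?abs1 ?abs_natM_le. Qed.

Lemma abs_add_num_tate_le x y (c : R) :
  abs x * abs y <= c -> abs x * abs y * abs (x + y) <= c -> abs b <= c ->
  abs (add_num (tate_binv b) x y) <= c.
Proof.
move=> h1 h2 h3; rewrite add_num_tate.
by rewrite !absD_le ?abs_natM_le // ?absM // ?absM.
Qed.

Section TateAdd.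
Variables x y z w : K.
Hypotheses (xy_neq : x != y) (yx : abs y <= abs x).
Hypothesis zDw : (z + w) * (x - y) ^+ 2 = add_num (tate_binv b) x y.
Hypothesis zMw : z * w * (x - y) ^+ 2 = mul_num (tate_binv b) x y.

Let xBy_gt0 : 0 < abs (x - y) ^+ 2.
Proof. by rewrite exprn_gt0 // abs_gt0 subr_eq0. Qed.

Let xBy_le : abs (x - y) <= abs x. Proof. exact: absB_le. Qed.
Let xDy_le : abs (x + y) <= abs x. Proof. exact: absD_le. Qed.

Let abs_zDw : abs (z + w) = abs (add_num (tate_binv b) x y) / abs (x - y) ^+ 2.
Proof. by rewrite -zDw absM absX mulfK // gt_eqF. Qed.

Let abs_zMw : abs (z * w) = abs (mul_num (tate_binv b) x y) / abs (x - y) ^+ 2.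
Proof. by rewrite -zMw [abs (_ * _ ^+ 2)]absM absX mulfK // gt_eqF. Qed.

Lemma tate_add_big : 1 <= abs y -> 1 <= abs z /\ 1 <= abs w.
Proof.
move=> y1; have x1 := le_trans y1 yx; set c := abs x ^+ 2 * abs y / abs (x - y) ^+ 2.
have c1 : 1 <= c.
  rewrite ler_pdivlMr // mul1r; apply: le_trans (_ : abs x ^+ 2 <= _).
    by rewrite lerXn2r ?nnegrE.
  by rewrite ler_peMr // exprn_ge0.
have hM : c <= abs (z * w).
  rewrite abs_zMw abs_mul_num //; last exact: singular_at0_tate.
  by rewrite ler_pM2r ?invr_gt0 // ler_wpM2l ?exprn_ge0 // expr2; nra.
have hD : abs (z + w) <= c.
  rewrite abs_zDw ler_pM2r ?invr_gt0 //; apply: abs_add_num_tate_le.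
  - by rewrite ler_wpM2r // ler_eXnr.
  - by rewrite mulrAC ler_wpM2r // expr2 ler_wpM2l.
  - by apply: le_trans (ltW b_lt1) _; rewrite mulr_ege1 // exprn_ege1.
exact: abs_roots_ge1 c1 hM hD.
Qed.

Lemma tate_add_big_mid : 1 <= abs x -> q < abs y < 1 -> abs z = abs y /\ abs w = abs y.
Proof.
move=> x1 /andP[qy y1]; have x0 : 0 < abs x by apply: lt_le_trans x1.
have yltx := lt_le_trans y1 x1.
have xBy : abs (x - y) = abs x by rewrite absBl.
have by2 : abs b < abs y ^+ 2 by rewrite -[abs b]sqr_q ltr_pXn2r ?nnegrE.
have xx2 : abs x <= abs x ^+ 2 by rewrite ler_eXnr.
apply: abs_roots_eq.
  have e : abs ((x * y) ^+ 2) = abs x ^+ 2 * abs y ^+ 2 by rewrite absX absM exprMn.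
  rewrite abs_zMw xBy mul_num_tate absBl e; first by rewrite mulrC mulKf // gt_eqF ?exprn_gt0.
  apply: le_lt_trans (abs_bM_1D_le _ _) _; rewrite absDl //.
  by rewrite mulrC; apply: ltr_leM; rewrite ?exprn_gt0.
rewrite abs_zDw xBy ler_pdivrMr ?exprn_gt0 // mulrC.
apply: abs_add_num_tate_le.
- by rewrite ler_wpM2r.
- by rewrite mulrAC ler_wpM2r // expr2 ler_wpM2l.
- by apply: le_trans (ltW by2) _; rewrite expr2 ler_wpM2r // (le_trans (ltW yltx)).
Qed.

Lemma tate_add_big_small : 1 <= abs x -> abs y <= q -> abs z <= q /\ abs w <= q.
Proof.
move=> x1 yq; have x0 : 0 < abs x by apply: lt_le_trans x1.
have yltx := lt_le_trans (le_lt_trans yq q_lt1) x1.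
have xBy : abs (x - y) = abs x by rewrite absBl.
have x2 : 0 < abs x ^+ 2 by rewrite exprn_gt0.
have xx2 : abs x <= abs x ^+ 2 by rewrite ler_eXnr.
have hM : abs (z * w) <= q ^+ 2.
  rewrite abs_zMw xBy ler_pdivrMr // mul_num_tate sqr_q; apply: absB_le.
    by rewrite absX absM exprMn mulrC ler_wpM2r ?exprn_ge0 // -[X in _ <= X]sqr_q lerXn2r ?nnegrE.
  by apply: le_trans (abs_bM_1D_le _ _) _; rewrite absDl // ler_pM2l.
have hD : abs (z + w) <= q.
  rewrite abs_zDw xBy ler_pdivrMr // mulrC; apply: abs_add_num_tate_le.
  - by rewrite ler_pM.
  - by rewrite mulrAC; apply: ler_pM => //; rewrite ?mulr_ge0 // expr2 ler_wpM2l.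
  - rewrite -[X in X <= _]sqr_q [q ^+ 2]expr2 ler_wpM2r // (le_trans (ltW q_lt1)) //.
    exact: exprn_ege1.
exact: abs_roots_le hM hD.
Qed.

Lemma tate_add_mid_small : q < abs x < 1 -> abs y <= q ->
  abs z = q / abs x /\ abs w = q / abs x.
Proof.
case/andP=> qx x1 yq; have x0 : 0 < abs x by apply: lt_trans qx.
have yltx := le_lt_trans yq qx.
have xBy : abs (x - y) = abs x by rewrite absBl.
have xyq : abs x * abs y <= q * abs x by rewrite mulrC ler_wpM2r.
have xq_lt : q * abs x < q by rewrite gtr_pMr.
have hb : abs (b * (1 + 4%:R * (x + y))) = abs b by rewrite abs_bM_1D // absDl.
apply: abs_roots_eq.
  rewrite abs_zMw xBy mul_num_tate absBr hb; first by rewrite expr_div_n sqr_q.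
  rewrite absX absM -[X in _ < X]sqr_q ltr_pXn2r ?nnegrE ?mulr_ge0 //.
  exact: le_lt_trans xq_lt.
rewrite (_ : q / abs x = q * abs x / abs x ^+ 2); last by field; rewrite gt_eqF.
rewrite abs_zDw xBy ler_pM2r ?invr_gt0 ?exprn_gt0 //; apply: abs_add_num_tate_le => //.
- by apply: le_trans xyq; rewrite ler_piMr ?mulr_ge0 // (le_trans xDy_le) // ltW.
- by rewrite -[X in X <= _]sqr_q expr2 ler_pM2l // ltW.
Qed.

Lemma tate_add_small : abs x <= q -> 1 <= abs z /\ 1 <= abs w.
Proof.
move=> xq; have yq := le_trans yx xq; have x1 := le_lt_trans xq q_lt1.
set c := abs b / abs (x - y) ^+ 2.
have xyb : abs x * abs y <= abs b by rewrite -[abs b]sqr_q expr2 ler_pM.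
have c1 : 1 <= c.
  rewrite ler_pdivlMr // mul1r -[abs b]sqr_q lerXn2r ?nnegrE //.
  exact: le_trans xBy_le xq.
have hM : abs (z * w) = c.
  have hb : abs (b * (1 + 4%:R * (x + y))) = abs b.
    by rewrite abs_bM_1D // (le_lt_trans xDy_le).
  rewrite abs_zMw mul_num_tate [abs (_ ^+ 2 - _)]absBr hb // absX absM.
  apply: le_lt_trans (_ : _ <= abs b * abs b) _; first by rewrite expr2 ler_pM ?mulr_ge0.
  by rewrite gtr_pMr.
have hD : abs (z + w) <= c.
  rewrite abs_zDw ler_pM2r ?invr_gt0 //; apply: abs_add_num_tate_le => //.
  by apply: le_trans xyb; rewrite ler_piMr ?mulr_ge0 // (le_trans xDy_le) // ltW.
by apply: abs_roots_ge1 c1 _ hD; rewrite hM.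
Qed.

Section TateAddMid.
Hypotheses (qy : q < abs y) (x1 : abs x < 1).
Local Notation p := (abs x * abs y).

Let y_gt0 : 0 < abs y. Proof. exact: lt_trans qy. Qed.
Let x_gt0 : 0 < abs x. Proof. exact: lt_le_trans yx. Qed.
Let p_gt0 : 0 < p. Proof. exact: mulr_gt0. Qed.

Let p_itv : abs b < p < 1.
Proof.
rewrite -[X in X < _ < _]sqr_q expr2 ltr_pM ?(lt_le_trans qy yx) //=.
by rewrite -[X in _ < X]mulr1 ltr_pM // (le_lt_trans yx).
Qed.

Let abs_xDy_lt1 : abs (x + y) < 1. Proof. exact: le_lt_trans x1. Qed.

Lemma abs_add_num_tate_mid : abs (add_num (tate_binv b) x y) = p.
Proof.
have /andP[bp _] := p_itv; rewrite add_num_tate -absM absDl // absM.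
apply: absD_lt; apply: abs_natM_lt => //.
by rewrite absM absM gtr_pMr.
Qed.

Lemma abs_zMw_lt_mid : abs (z * w) < abs (z + w) ^+ 2.
Proof.
have eD : abs (z + w) * abs (x - y) ^+ 2 = p.
  by rewrite abs_zDw divfK ?abs_add_num_tate_mid // gt_eqF.
have eM : abs (z * w) * abs (x - y) ^+ 2 = abs (mul_num (tate_binv b) x y).
  by rewrite abs_zMw divfK // gt_eqF.
rewrite -(ltr_pM2r (exprn_gt0 2 xBy_gt0)) -exprMn eD.
rewrite [X in _ * X < _]expr2 mulrA eM -absX -[X in X < _]absM mul_num_tate mulrBl.
apply: absB_lt.
  rewrite absM absX absM absX gtr_pMr ?exprn_gt0 // expr_lt1 //.
  exact: le_lt_trans xBy_le x1.
rewrite absM abs_bM_1D // absX exprMn mulrC; apply: ltr_leM => //.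
- by rewrite exprn_gt0.
- by rewrite lerXn2r ?nnegrE.
- by rewrite -[X in X < _]sqr_q ltr_pXn2r ?nnegrE.
Qed.

Lemma tate_depth_zMw u : abs u = abs (z * w) / abs (z + w) ->
  tate_depth u = Num.min (- ln (abs x) - ln (abs y)) (V - (- ln (abs x) - ln (abs y))).
Proof.
rewrite abs_zDw abs_zMw abs_add_num_tate_mid => hu.
have hu' : abs u = abs ((x * y) ^+ 2 - b * (1 + 4%:R * (x + y))) / p.
  by rewrite -mul_num_tate hu; field; rewrite !gt_eqF // abs_gt0 subr_eq0.
have hxy : abs ((x * y) ^+ 2) = p ^+ 2 by rewrite absX absM.
have hb := abs_bM_1D 4 abs_xDy_lt1.
by rewrite (tate_depth_quotient p_itv hxy hb hu') lnM ?posrE // !opprD !opprK.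
Qed.

Lemma tate_depth_zDw u : abs u = abs (z + w) ->
  tate_depth u = `|- ln (abs x) - - ln (abs y)|.
Proof.
rewrite abs_zDw abs_add_num_tate_mid => hu; move: yx.
rewrite le_eqVlt => /orP[/eqP exy|ltyx].
  rewrite exy subrr normr0 tate_depth_big // hu exy -expr2 ler_pdivlMr // mul1r.
  by rewrite lerXn2r ?nnegrE.
have {}hu : abs u = abs y / abs x by rewrite hu absBl //; field; rewrite gt_eqF.
have lnyx : ln (abs y) < ln (abs x) by rewrite ltr_ln ?posrE.
rewrite tate_depth_mid hu; first by rewrite ln_div ?posrE // ler0_norm; [ring | lra].
rewrite ler_pdivlMr // ler_pdivrMr // mul1r yx andbT.
by apply: le_trans (ltW qy); rewrite ger_pMr // ltW.
Qed.

Lemma tate_add_mid :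
  folded_sum V (- ln (abs x)) (- ln (abs y)) (tate_depth z) (tate_depth w).
Proof.
case: (abs_roots_split abs_zMw_lt_mid) => -[hD hM]; [left | right];
  by split; [apply: tate_depth_zDw | apply: tate_depth_zMw].
Qed.

End TateAddMid.
End TateAdd.

Lemma tate_depth_add x y z w : x != y ->
  (z + w) * (x - y) ^+ 2 = add_num (tate_binv b) x y ->
  z * w * (x - y) ^+ 2 = mul_num (tate_binv b) x y ->
  folded_sum V (tate_depth x) (tate_depth y) (tate_depth z) (tate_depth w).
Proof.
wlog yx : x y / abs y <= abs x.
  move=> H ne es ep; case/orP: (le_total (abs y) (abs x)) => h; first exact: H.
  apply: folded_sum_sym; apply: H => //; rewrite 1?eq_sym // -[y - x]opprB sqrrN.
    by rewrite es add_numC.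
  by rewrite ep mul_numC.
move=> ne es ep; have itv0 := tate_depth_itv.
have [y1|y1] := leP 1 (abs y).
  have [z1 w1] := tate_add_big ne yx es ep y1.
  rewrite !tate_depth_big ?(le_trans y1 yx) //.
  by apply: folded_sum0; rewrite lexx divr_ge0 // ltW.
have [x1|x1] := leP 1 (abs x).
  apply: folded_sum_sym; rewrite (tate_depth_big x1).
  have [yq|yq] := leP (abs y) q.
    have [zq wq] := tate_add_big_small ne yx es ep x1 yq.
    rewrite (tate_depth_small yq) (tate_depth_small zq) (tate_depth_small wq).
    by apply: folded_sum0; rewrite divr_ge0 ?lexx // ltW.
  have [|ez ew] := tate_add_big_mid ne yx es ep x1; first by rewrite yq y1.
  by rewrite /tate_depth ez ew; apply: folded_sum0 (itv0 y).
have [xq|xq] := leP (abs x) q.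
  have [z1 w1] := tate_add_small ne yx es ep xq.
  rewrite (tate_depth_small xq) (tate_depth_small (le_trans yx xq)) !tate_depth_big //.
  by have := @folded_sum_half R V (V / 2%:R); rewrite subrr; apply; rewrite divr_ge0 ?lexx // ltW.
have [yq|yq] := leP (abs y) q; last first.
  rewrite (@tate_depth_mid x) ?ltW // (@tate_depth_mid y) ?ltW //.
  exact: tate_add_mid ne yx es ep yq x1.
have [|ez ew] := tate_add_mid_small ne yx es ep _ yq; first by rewrite xq x1.
have xq0 : 0 < abs x := lt_trans q_gt0 xq.
have xV := tate_depth_itv x.
have qx v : abs v = q / abs x -> tate_depth v = V / 2%:R - tate_depth x.
  move=> ev; rewrite tate_depth_mid ev; last first.
    by rewrite ler_pdivlMr // ler_pdivrMr // mul1r (ltW xq) andbT ger_pMr // ltW.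
  by rewrite (@tate_depth_mid x) ?ltW // ln_div ?posrE // -ln_q; ring.
by rewrite (tate_depth_small yq) (qx z ez) (qx w ew); apply: folded_sum_half.
Qed.

Lemma tate_psi2sq_big x : 1 <= abs x -> abs (psi2sq (tate_binv b) x) <= abs x ^+ 3.
Proof.
move=> x1; have x13 : 1 <= abs x ^+ 3 by rewrite exprn_ege1.
rewrite psi2sq_tate !absD_le ?abs_natM_le ?absX // ?ler_weXn2l //.
by rewrite (le_trans (ltW b_lt1)).
Qed.

Lemma tate_psi2sq_mid x : q < abs x < 1 -> abs (psi2sq (tate_binv b) x) = abs x ^+ 2.
Proof.
case/andP=> qx x1; have x0 : 0 < abs x by apply: lt_trans qx.
rewrite psi2sq_tate absDl absX //; apply: absD_lt; apply: abs_natM_lt.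
  by rewrite -[X in X < _]sqr_q ltr_pXn2r ?nnegrE.
by rewrite absX ltr_iXn2l.
Qed.

Lemma tate_psi2sq_small x : abs x <= q -> abs (psi2sq (tate_binv b) x) <= abs b.
Proof.
move=> xq; have x1 : abs x <= 1 by apply: le_trans xq (ltW q_lt1).
have x2 : abs (x ^+ 2) <= abs b by rewrite absX -[X in _ <= X]sqr_q lerXn2r ?nnegrE.
rewrite psi2sq_tate !absD_le ?abs_natM_le //.
by apply: le_trans x2; rewrite !absX ler_wiXn2l.
Qed.

Lemma tate_dbl_num_small x : abs x <= q -> abs (dbl_num (tate_binv b) x) = abs b.
Proof.
move=> xq; have x1 := le_lt_trans xq q_lt1.
rewrite dbl_num_tate absBr abs_bM_1D // absX -[4%N]/(2 * 2)%N exprM -[X in _ < X]sqr_q.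
by rewrite ltr_pXn2r ?nnegrE ?exprn_ge0 // sqr_lt_q.
Qed.

Definition tate_bound x := 2%:R^-1 * ln (Num.max 1 (abs x)) + bern2 V (tate_depth x).

Lemma ln_max1_ge0 (a : R) : 0 <= ln (Num.max 1 a).
Proof. by rewrite ln_ge0 // le_max lexx. Qed.

Lemma tate_bound_big x : 1 <= abs x -> tate_bound x = 2%:R^-1 * ln (abs x) + V / 12%:R.
Proof. by move=> x1; rewrite /tate_bound max_r // tate_depth_big // bern2_0. Qed.

Lemma tate_bound_small x : abs x <= 1 -> tate_bound x = bern2 V (tate_depth x).
Proof. by move=> x1; rewrite /tate_bound max_l // ln1 mulr0 add0r. Qed.

Section TateDbl.
Variables x z : K.
Hypothesis psi2_neq0 : psi2sq (tate_binv b) x != 0.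
Hypothesis zE : z * psi2sq (tate_binv b) x = dbl_num (tate_binv b) x.

Let abs_zE : abs z = abs (dbl_num (tate_binv b) x) / abs (psi2sq (tate_binv b) x).
Proof. by rewrite -zE absM mulfK // abs_eq0. Qed.

Lemma tate_depth_dbl : tate_depth z = Num.min (tate_depth x *+ 2) (V - tate_depth x *+ 2).
Proof.
have psi_gt0 : 0 < abs (psi2sq (tate_binv b) x) by rewrite abs_gt0.
have [x1|x1] := leP 1 (abs x).
  rewrite (tate_depth_big x1) mul0rn subr0 min_l ?ltW // tate_depth_big // abs_zE.
  rewrite abs_dbl_num //; last exact: singular_at0_tate.
  by rewrite ler_pdivlMr // mul1r (le_trans (tate_psi2sq_big x1)) // ler_weXn2l.
have [xq|xq] := leP (abs x) q.
  have -> : tate_depth x *+ 2 = V by rewrite tate_depth_small // mulr2n; field.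
  rewrite subrr min_r ?ltW // tate_depth_big // abs_zE tate_dbl_num_small //.
  by rewrite ler_pdivlMr // mul1r tate_psi2sq_small.
have x0 : 0 < abs x by apply: lt_trans xq.
have p_itv : abs b < abs x ^+ 2 < 1.
  by rewrite -[X in X < _ < _]sqr_q ltr_pXn2r ?nnegrE // xq expr_lt1.
have -> : tate_depth x *+ 2 = - ln (abs x ^+ 2).
  by rewrite tate_depth_mid ?ltW // lnXn // mulNrn.
rewrite opprK; apply: (tate_depth_quotient (s := x ^+ 4) p_itv _ (abs_bM_1D 8 x1)).
  by rewrite absX -exprM.
by rewrite -dbl_num_tate abs_zE tate_psi2sq_mid // xq.
Qed.

Lemma tate_bound_dbl : 4%:R * tate_bound x - 2%:R^-1 * ln (abs (psi2sq (tate_binv b) x))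
  + 4%:R^-1 * ln (abs (bdisc (tate_binv b))) <= tate_bound z.
Proof.
have V0 : V != 0 by rewrite gt_eqF.
have psi_gt0 : 0 < abs (psi2sq (tate_binv b) x) by rewrite abs_gt0.
have bern_z : bern2 V (tate_depth z) = 4%:R * bern2 V (tate_depth x) + tate_depth x - V / 4%:R.
  by rewrite tate_depth_dbl bern2_min // bern2_dbl.
have lnz : 0 < abs (dbl_num (tate_binv b) x) -> ln (abs (dbl_num (tate_binv b) x))
    - ln (abs (psi2sq (tate_binv b) x)) <= ln (Num.max 1 (abs z)).
  move=> n0; rewrite -ln_div ?posrE // -abs_zE.
  by rewrite ler_ln ?posrE ?lt_max ?ltr01 // ?le_max ?lexx ?orbT // abs_zE divr_gt0.
rewrite bdisc_tate //; have [x1|x1] := leP 1 (abs x).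
  have x0 : 0 < abs x by apply: lt_le_trans x1.
  move: lnz; rewrite abs_dbl_num //; last exact: singular_at0_tate.
  move=> /(_ (exprn_gt0 4 x0)); rewrite lnXn // [tate_bound z]/tate_bound bern_z.
  by rewrite tate_depth_big // bern2_0 tate_bound_big // => h; lra.
rewrite (tate_bound_small (ltW x1)) [tate_bound z]/tate_bound bern_z.
have [xq|xq] := leP (abs x) q.
  move: lnz; rewrite tate_dbl_num_small // => /(_ abs_b_gt0).
  by rewrite tate_depth_small // => h; lra.
have mid : q <= abs x <= 1 by rewrite !ltW.
rewrite tate_psi2sq_mid ?xq // lnXn ?(lt_trans _ xq) // (tate_depth_mid mid).
by have := ln_max1_ge0 (abs z); lra.
Qed.

End TateDbl.
End TateDepth.

Section TateKummer.
Variables (R : realType) (K : fieldType) (abs : nonarch_abs R K) (b : K).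
Hypotheses (b_neq0 : b != 0) (b_lt1 : abs b < 1).
Variables (G : zmodType) (X : G -> option K).
Hypothesis kum : kummer_line (tate_binv b) X.
Implicit Types (x : K) (P Q : G).
Local Notation V := (- ln (abs b)).
Local Notation q := (Num.sqrt (abs b)).

Definition point_depth P := if X P is Some x then tate_depth abs b x else 0.

Lemma point_depth_itv P : 0 <= point_depth P <= V / 2%:R.
Proof.
rewrite /point_depth; case: (X P) => [x|]; first exact: tate_depth_itv.
by rewrite lexx divr_ge0 // ltW // tate_V_gt0.
Qed.

Lemma point_depth0 : point_depth 0 = 0.
Proof. by rewrite /point_depth (kummer_0 kum). Qed.

Lemma point_depthN P : point_depth (- P) = point_depth P.
Proof. by rewrite /point_depth (kummer_opp kum). Qed.

Lemma point_depth_dbl P :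
  point_depth (P + P) = Num.min (point_depth P *+ 2) (V - point_depth P *+ 2).
Proof.
have V0 := tate_V_gt0 b_neq0 b_lt1.
have [P0|P0] := eqVneq P 0; first by rewrite P0 addr0 point_depth0 mul0rn subr0 min_l // ltW.
rewrite {2 3}/point_depth; case EP: (X P) => [x|]; last first.
  by rewrite (kummer_eq0 kum EP) eqxx in P0.
have [e0|ne] := eqVneq (psi2sq (tate_binv b) x) 0; last first.
  have [z EZ ez] := kummer_dbl kum EP ne.
  by rewrite /point_depth EZ; apply: tate_depth_dbl.
rewrite (kummer_dbl0 kum EP e0) point_depth0.
have [x1|x1] := leP 1 (abs x); first by rewrite tate_depth_big // mul0rn subr0 min_l // ltW.
have [xq|xq] := leP (abs x) q.
  rewrite tate_depth_small // (_ : V / 2%:R *+ 2 = V); last by rewrite mulr2n; field.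
  by rewrite subrr min_r // ltW.
have := tate_psi2sq_mid (abs := abs) b_neq0 (x := x); rewrite xq x1 e0 abs0 => /(_ isT)/esym/eqP.
by rewrite expf_eq0 /= gt_eqF // (lt_trans _ xq) // q_gt0.
Qed.

Lemma point_depth_rel P Q : folded_sum V
  (point_depth P) (point_depth Q) (point_depth (P + Q)) (point_depth (P - Q)).
Proof.
have dbl T : folded_sum V (point_depth T) (point_depth T) 0 (point_depth (T + T)).
  by rewrite point_depth_dbl; apply: folded_sum_diag.
case EP: (X P) => [x|]; last first.
  rewrite (kummer_eq0 kum EP) add0r sub0r point_depthN point_depth0; apply: folded_sum_sym.
  exact: folded_sum0 (point_depth_itv _).
case EQ: (X Q) => [y|]; last first.
  rewrite (kummer_eq0 kum EQ) addr0 subr0 point_depth0.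
  exact: folded_sum0 (point_depth_itv _).
have [exy|ne] := eqVneq x y; last first.
  have [z [w [EZ EW es ep]]] := kummer_add kum EP EQ ne.
  by rewrite /point_depth EP EQ EZ EW; apply: tate_depth_add es ep.
have [->|->] : P = Q \/ P = - Q by apply: (kummer_inj kum); rewrite EP EQ exy.
  by rewrite subrr point_depth0; apply: folded_sum_swap.
by rewrite addNr point_depth0 -opprD !point_depthN.
Qed.

Lemma height_ge_bern2 (lam : G -> R) P : kummer_height abs (tate_binv b) X lam ->
  P != 0 -> bern2 V (point_depth P) <= lam P.
Proof.
move=> hgt P0; rewrite /point_depth; case EP: (X P) => [x|]; last first.
  by rewrite (kummer_eq0 kum EP) eqxx in P0.
have V0 := tate_V_gt0 b_neq0 b_lt1.
apply: le_trans (_ : tate_bound abs b x <= _).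
  by rewrite ler_wpDl // mulr_ge0 ?invr_ge0 // ln_max1_ge0.
apply: (kummer_height_le (S := fun=> True) kum hgt _ _ _ EP I).
- exists (V / 12%:R) => y _; rewrite lerD2l bern2_le //.
  by have /andP[-> h] := tate_depth_itv b_neq0 b_lt1 y; apply: le_trans h _; lra.
- by move=> y z _ ne ez; split => //; apply: tate_bound_dbl.
- move=> y _ _; exists q => [|w wy]; first exact: q_gt0.
  split => //; rewrite /tate_bound (tate_depth_near b_neq0 wy).
  have q1 := q_lt1 b_lt1; have [y1|y1] := leP (abs y) 1.
    by rewrite lerD2r ler_pM2l ?invr_gt0 // ln1 ln_max1_ge0.
  by rewrite (abs_close (lt_trans wy (lt_trans q1 y1))) (max_r (ltW y1)).
Qed.

End TateKummer.

Lemma nonsingular_depth0 (R : realType) (K : fieldType) (abs : nonarch_abs R K)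
    (G : zmodType) (B : binv K) (X : G -> option K) (r k b : K) (P : G) :
  k != 0 -> abs k <= 1 -> abs b < 1 -> bscale (bshift B r) k = tate_binv b ->
  nonsingular abs B X P -> point_depth abs b (xaffine r k X) P = 0.
Proof.
move=> k0 k1 b1 tateE; rewrite /nonsingular /point_depth /xaffine.
case: (X P) => [x|] //= rx; apply: tate_depth_big => //; rewrite leNgt; apply/negP => x1.
have := psi_radius_lt1_near0 (singular_at0_tate b1) x1; rewrite -tateE psi_radius_lt1.
have kX n : 0 < abs k ^+ n <= 1 by rewrite exprn_gt0 ?exprn_ile1 // abs_gt0.
rewrite psi2sq_affine // psi3_affine // !absM !absV !absX.
have [/andP[k30 k31] /andP[k40 k41]] := (kX 3%N, kX 4%N).
rewrite !ltr_pdivrMr // !mul1r => /andP[l6 l8].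
by move: rx; rewrite leNgt psi_radius_lt1 (lt_le_trans l6) ?(lt_le_trans l8).
Qed.

(** * Energy of finite sets *)

Section SumOfSquares.
Variable R : realFieldType.

Lemma sum_sum_prod (I J : finType) (f : I -> J -> R) :
  \sum_i \sum_j \sum_k f i k * f j k = \sum_k (\sum_i f i k) ^+ 2.
Proof.
transitivity (\sum_i \sum_k f i k * \sum_j f j k).
  apply: eq_bigr => i _; rewrite exchange_big; apply: eq_bigr => k _.
  by rewrite mulr_sumr.
by rewrite exchange_big; apply: eq_bigr => k _; rewrite -mulr_suml expr2.
Qed.

Lemma sqr_sum_le (I : finType) (f : I -> R) : (\sum_i f i) ^+ 2 <= #|I|%:R * \sum_i f i ^+ 2.
Proof.
have [/card0_eq I0|I_gt0] := posnP #|I|.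
  by rewrite !big_pred0 // expr0n mulr0.
set S := \sum_i f i; have n0 : 0 < #|I|%:R :> R by rewrite ltr0n.
have : 0 <= \sum_i (f i - S / #|I|%:R) ^+ 2 by apply: sumr_ge0 => i _; apply: sqr_ge0.
have -> : \sum_i (f i - S / #|I|%:R) ^+ 2 = \sum_i f i ^+ 2 - S ^+ 2 / #|I|%:R.
  transitivity (\sum_i (f i ^+ 2 - 2%:R * (S / #|I|%:R) * f i + (S / #|I|%:R) ^+ 2)).
    by apply: eq_bigr => i _; ring.
  rewrite !big_split /= sumrN -mulr_sumr sumr_const -/S -[_ *+ #|I|]mulr_natl.
  by field; rewrite gt_eqF.
by rewrite subr_ge0 ler_pdivrMr // mulrC.
Qed.

Lemma sum_sum_const (I : finType) (a : R) : \sum_(i : I) \sum_(j : I) a = #|I|%:R ^+ 2 * a.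
Proof. by rewrite !sumr_const -[LHS]mulr_natl -[a *+ _]mulr_natl mulrA -expr2. Qed.

Lemma sum_ord_leq (f : nat -> R) n k : (k < n)%N ->
  \sum_(t < n) (t <= k)%:R * f t = \sum_(t < k.+1) f t.
Proof.
move=> kn; rewrite (big_ord_widen _ f kn) [RHS]big_mkcond; apply: eq_bigr => t _.
by rewrite ltnS; case: leqP; rewrite ?mul1r ?mul0r.
Qed.

Lemma sum_ord_id n : \sum_(t < n) t%:R = n%:R * (n%:R - 1) / 2%:R :> R.
Proof.
elim: n => [|n IHn]; first by rewrite big_ord0 !mul0r.
by rewrite big_ord_recr /= IHn -natr1; field.
Qed.

Lemma sum_ord_sqr n : \sum_(t < n) t%:R ^+ 2 = n%:R * (n%:R - 1) * (2%:R * n%:R - 1) / 6%:R :> R.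
Proof.
elim: n => [|n IHn]; first by rewrite big_ord0 !mul0r.
by rewrite big_ord_recr /= IHn -natr1; field.
Qed.

End SumOfSquares.

Section BernoulliKernel.
Variables (R : realFieldType) (n : nat).
Implicit Types k l : 'I_n.

(* Up to a constant these vectors turn the kernel B_2 (|k - l| / n) on Z / n into a Gram
   matrix. *)
Definition bern2_vec (t k : nat) : R := (t <= k)%:R + t%:R / n%:R.

Lemma ord_natr_gt0 k : 0 < n%:R :> R.
Proof. by rewrite ltr0n (leq_trans _ (ltn_ord k)). Qed.

Lemma sum_bern2_vec k : \sum_(t < n) bern2_vec t k = k%:R + 1 + (n%:R - 1) / 2%:R.
Proof.
have n0 := ord_natr_gt0 k; rewrite big_split /= -mulr_suml sum_ord_id.
congr (_ + _); last by field; rewrite gt_eqF.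
transitivity (\sum_(t < n) (t <= k)%:R * 1 : R); first by apply: eq_bigr => t _; rewrite mulr1.
by rewrite (sum_ord_leq (fun=> 1)) // sumr_const card_ord natr1.
Qed.

Lemma sum_leq_leq k l :
  \sum_(t < n) (t <= k)%:R * (t <= l)%:R = (k%:R + l%:R - `|k%:R - l%:R|) / 2%:R + 1 :> R.
Proof.
wlog kl : k l / (k <= l)%N.
  move=> H; case/orP: (leq_total k l) => h; first exact: H.
  by rewrite distrC [k%:R + _]addrC -H //; apply: eq_bigr => t _; rewrite mulrC.
rewrite (sum_ord_leq (fun t => (t <= l)%:R)) //.
transitivity (\sum_(t < k.+1) 1 : R).
  by apply: eq_bigr => t _; rewrite (leq_trans _ kl) // -ltnS.
by rewrite sumr_const card_ord -natr1 distrC ger0_norm ?subr_ge0 ?ler_nat //; field.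
Qed.

Lemma bern2_gram k l :
  n%:R * \sum_(t < n) bern2_vec t k * bern2_vec t l
    - (\sum_(t < n) bern2_vec t k) * (\sum_(t < n) bern2_vec t l) =
  n%:R ^+ 2 * bern2 1 (`|k%:R - l%:R| / n%:R) - 12%:R^-1.
Proof.
have n0 := ord_natr_gt0 k.
have sum_leq_id (j : 'I_n) : \sum_(t < n) (t <= j)%:R * t%:R = j%:R * (j%:R + 1) / 2%:R :> R.
  by rewrite (sum_ord_leq (fun t => t%:R)) // sum_ord_id -natr1; field.
have -> : \sum_(t < n) bern2_vec t k * bern2_vec t l =
  \sum_(t < n) (t <= k)%:R * (t <= l)%:R
  + (\sum_(t < n) (t <= k)%:R * t%:R + \sum_(t < n) (t <= l)%:R * t%:R) / n%:R
  + (\sum_(t < n) t%:R ^+ 2) / n%:R ^+ 2.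
  rewrite -big_split !mulr_suml -!big_split /=; apply: eq_bigr => t _.
  by rewrite /bern2_vec; field; rewrite gt_eqF.
rewrite !sum_bern2_vec !sum_leq_id sum_leq_leq sum_ord_sqr /bern2.
have -> : (`|k%:R - l%:R| / n%:R) ^+ 2 = (k%:R - l%:R) ^+ 2 / n%:R ^+ 2 :> R.
  by rewrite expr_div_n real_normK ?num_real.
by field; rewrite gt_eqF.
Qed.

Lemma sum_bern2_cyclic_ge (I : finType) (k : I -> 'I_n) : (0 < n)%N ->
  #|I|%:R ^+ 2 / n%:R ^+ 2 / 12%:R <=
  \sum_i \sum_j bern2 1 (`|(k i)%:R - (k j)%:R| / n%:R) :> R.
Proof.
move=> n_gt0; have n0 : 0 < n%:R :> R by rewrite ltr0n.
pose gram i j : R := n%:R * (\sum_(t < n) bern2_vec t (k i) * bern2_vec t (k j))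
    - (\sum_(t < n) bern2_vec t (k i)) * (\sum_(t < n) bern2_vec t (k j)).
have gram_ge0 : 0 <= \sum_i \sum_j gram i j.
  have -> : \sum_i \sum_j gram i j = n%:R * \sum_(t < n) (\sum_i bern2_vec t (k i)) ^+ 2
      - (\sum_(t < n) \sum_i bern2_vec t (k i)) ^+ 2.
    rewrite -(sum_sum_prod (fun i t => bern2_vec (nat_of_ord t) (k i))).
    rewrite [X in _ - X ^+ 2]exchange_big /=.
    rewrite expr2 mulr_suml mulr_sumr -sumrB; apply: eq_bigr => i _.
    by rewrite !mulr_sumr -sumrB.
  by rewrite subr_ge0 -[X in X%:R * _]card_ord; apply: sqr_sum_le.
set S := (X in _ <= X); move: gram_ge0.
have -> : \sum_i \sum_j gram i j = n%:R ^+ 2 * S - #|I|%:R ^+ 2 / 12%:R.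
  rewrite -sum_sum_const /S mulr_sumr -sumrB; apply: eq_bigr => i _.
  by rewrite mulr_sumr -sumrB; apply: eq_bigr => j _; apply: bern2_gram.
by rewrite subr_ge0 => gram_ge0; rewrite mulrAC ler_pdivrMr ?exprn_gt0 // [S * _]mulrC.
Qed.

End BernoulliKernel.

Section Cosets.
Variables (G : zmodType) (H : pred G) (reps : seq G).
Hypothesis H_sub : forall P Q, H P -> H Q -> H (P - Q).
Hypothesis repsP : forall P, exists2 Q, Q \in reps & H (P - Q).

Lemma coset_index (I : Type) (P : I -> G) :
  exists f : I -> 'I_(size reps), forall i, H (P i - nth 0 reps (f i)).
Proof.
have idx i : exists j : 'I_(size reps), H (P i - nth 0 reps j).
  have [Q Qr hQ] := repsP (P i).
  have lt : (index Q reps < size reps)%N by rewrite index_mem.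
  by exists (Ordinal lt); rewrite nth_index.
by exists (fun i => xchoose (idx i)) => i; apply: (xchooseP (idx i)).
Qed.

Lemma same_coset (I : Type) (P : I -> G) (f : I -> 'I_(size reps)) :
  (forall i, H (P i - nth 0 reps (f i))) -> forall i j, f i = f j -> H (P i - P j).
Proof.
move=> hf i j e; have := H_sub (hf i) (hf j).
by rewrite e opprB addrA subrK.
Qed.

Lemma reps_gt0 : (0 < size reps)%N.
Proof. by have [f _] := coset_index (fun _ : unit => 0); apply: leq_ltn_trans (ltn_ord (f tt)). Qed.

Lemma sum_same_coset_ge (R : realFieldType) (I : finType) (P : I -> G) :
  #|I|%:R ^+ 2 / (size reps)%:R <= \sum_i \sum_j (H (P i - P j))%:R :> R.
Proof.
have [f hf] := coset_index P.
have c0 : 0 < (size reps)%:R :> R by rewrite ltr0n reps_gt0.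
pose g i (k : 'I_(size reps)) : R := (f i == k)%:R.
have sum_g i : \sum_k g i k = 1.
  by rewrite (bigD1 (f i)) //= /g eqxx big1 ?addr0 // => k /negPf; rewrite eq_sym => ->.
apply: (@le_trans _ _ (\sum_i \sum_j \sum_k g i k * g j k)).
  rewrite sum_sum_prod ler_pdivrMr // mulrC -[X in X%:R * _]card_ord.
  apply: le_trans (sqr_sum_le _); rewrite exchange_big /=.
  by under eq_bigr do rewrite sum_g; rewrite sumr_const.
apply: ler_sum => i _; apply: ler_sum => j _; rewrite (bigD1 (f i)) //= big1 ?addr0.
  rewrite /g eqxx mul1r; case: eqP => [e|_]; last by rewrite ler0n.
  by rewrite (same_coset hf) // e.
by move=> k /negPf; rewrite /g eq_sym => ->; rewrite mul0r.
Qed.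

End Cosets.

Section DepthFunction.
Variables (R : archiRealFieldType) (G : zmodType) (V : R) (m : G -> R).
Hypothesis V0 : 0 < V.
Hypothesis m_itv : forall P, 0 <= m P <= V / 2%:R.
Hypothesis m_rel : forall P Q, folded_sum V (m P) (m Q) (m (P + Q)) (m (P - Q)).

Lemma depth_ge0 P : 0 <= m P. Proof. by case/andP: (m_itv P). Qed.
Lemma depth_le P : m P <= V / 2%:R. Proof. by case/andP: (m_itv P). Qed.

Lemma depth0 : m 0 = 0.
Proof.
by have := m_rel 0 0; rewrite addr0 subr0 /folded_sum [m 0 - m 0]subrr normr0; case=> -[].
Qed.

Lemma depthD_depth0 P Q : m Q = 0 -> m (P + Q) = m P.
Proof.
move=> hQ; have := m_rel P Q; rewrite hQ /folded_sum subr0 addr0 ger0_norm ?depth_ge0 //.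
by rewrite min_l; [case=> -[] | have := depth_le P; lra].
Qed.

Lemma depthN P : m (- P) = m P.
Proof.
have := m_rel 0 P; rewrite !add0r depth0 /folded_sum !add0r normrN ger0_norm ?depth_ge0 //.
by rewrite min_l; [case=> -[] | have := depth_le P; lra].
Qed.

Lemma depth_eq0_mulz P z : m P = 0 -> m (P *~ z) = 0.
Proof.
have muln k Q : m Q = 0 -> m (Q *+ k) = 0.
  by move=> hQ; elim: k => [|k IHk]; rewrite ?mulr0n ?depth0 // mulrSr depthD_depth0.
by case: z => k h; rewrite ?NegzE ?mulrNz ?depthN -pmulrn muln.
Qed.

Section Generator.
Variable P0 : G.
Hypothesis P0_gt0 : 0 < m P0.
Hypothesis P0_min : forall P, m P != 0 -> m P0 <= m P.
Local Notation delta := (m P0).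

Lemma depth_generator P : exists z : int, m (P - P0 *~ z) = 0.
Proof.
have descent t Q : m Q < t%:R * delta -> exists z : int, m (Q - P0 *~ z) = 0.
  elim: t Q => [|t IHt] Q; first by rewrite mul0r ltNge depth_ge0.
  rewrite -natr1 mulrDl mul1r => hQ.
  have [e|ne] := eqVneq (m Q) 0; first by exists 0; rewrite mulr0z subr0.
  have ge := P0_min ne.
  have h : m (Q + P0) = m Q - delta \/ m (Q - P0) = m Q - delta.
    by case: (m_rel Q P0) => -[e _]; [left|right]; rewrite e ger0_norm // subr_ge0.
  have lt : m Q - delta < t%:R * delta by rewrite ltrBlDr.
  case: h => e; rewrite -e in lt; have [z hz] := IHt _ lt.
    by exists (z - 1); rewrite mulrzBr mulr1z opprB addrA.
  by exists (z + 1); rewrite mulrzDr mulr1z opprD addrA addrAC.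
apply: (descent (Num.truncn (m P / delta)).+1 P).
by rewrite -ltr_pdivrMr // truncnS_gt.
Qed.

Lemma depth_multiple k : k%:R * delta <= V ->
  m (P0 *+ k) = Num.min (k%:R * delta) (V - k%:R * delta).
Proof.
have half := depth_le P0; have dp := P0_gt0.
elim/ltn_ind: k => -[|[|k]] IH hk.
- by rewrite mulr0n depth0 mul0r subr0 min_l // ltW.
- by rewrite mulr1n mul1r min_l //; lra.
set x := k%:R * delta; have x0 : 0 <= x by rewrite mulr_ge0 // ltW.
have x1E : k.+1%:R * delta = x + delta by rewrite -natr1 mulrDl mul1r.
have x2E : k.+2%:R * delta = x + 2%:R * delta by rewrite -natr1 mulrDl mul1r x1E; ring.
have IH1 := IH k.+1 (ltnSn _); have IH0 := IH k (ltnW (ltnSn _)).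
rewrite x2E in hk *; rewrite x1E in IH1; rewrite -/x in IH0; clear IH x1E x2E; clearbody x.
have {}IH1 : m (P0 *+ k.+1) = Num.min (x + delta) (V - (x + delta)) by apply: IH1; lra.
have {}IH0 : m (P0 *+ k) = Num.min x (V - x) by apply: IH0; lra.
have := m_rel (P0 *+ k.+1) P0; rewrite -[P0 *+ k.+1 + P0]mulrSr.
have -> : P0 *+ k.+1 - P0 = P0 *+ k by rewrite mulrSr addrK.
rewrite IH1 IH0 /folded_sum; have [hx|hx] := leP (x + delta) (V - (x + delta)).
  have -> : `|x + delta - delta| = x by rewrite addrK ger0_norm.
  have -> : x + delta + delta = x + 2%:R * delta by ring.
  rewrite (min_l (_ : x <= V - x)); last by lra.
  by case=> -[Dm Bm]; [rewrite Dm | ].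
have -> : `|V - (x + delta) - delta| = V - (x + 2%:R * delta) by rewrite ger0_norm; [ring | lra].
have -> : V - (V - (x + delta) + delta) = x by ring.
have -> : V - (x + delta) + delta = V - x by ring.
rewrite (min_r (_ : V - (x + 2%:R * delta) <= x + 2%:R * delta)); last by lra.
by case=> -[Bm Dm]; [rewrite Bm | rewrite Dm minC].
Qed.

Lemma depth_period : exists2 n, (1 < n)%N & V = n%:R * delta.
Proof.
have half := depth_le P0; have dp := P0_gt0.
have [n /andP[n_le lt_nS]] : exists n, (n%:R <= V / delta) && (V / delta < n.+1%:R).
  by exists (Num.truncn (V / delta)); rewrite truncn_itv // divr_ge0 // ltW.
rewrite ler_pdivlMr // in n_le; rewrite ltr_pdivrMr // -natr1 mulrDl mul1r in lt_nS.
have n_gt1 : (1 < n)%N.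
  rewrite ltnNge; apply/negP => hn.
  have : n%:R <= 1 :> R by rewrite -[1]/(1%:R) ler_nat.
  nra.
exists n => //; have n_ge2 : 2%:R <= n%:R :> R by rewrite ler_nat.
have e : m (P0 *+ n) = V - n%:R * delta by rewrite depth_multiple // min_r //; nra.
have [z|nz] := eqVneq (m (P0 *+ n)) 0; first by apply/subr0_eq; rewrite -e z.
by have := P0_min nz; rewrite e; lra.
Qed.

Section Period.
Variable n : nat.
Hypotheses (n_gt0 : (0 < n)%N) (eV : V = n%:R * delta).

Lemma depth_residue P : exists k : 'I_n, m (P - P0 *+ k) = 0.
Proof.
have [z hz] := depth_generator P.
have hn : m (P0 *+ n) = 0 by rewrite depth_multiple -?eV // subrr min_r // ltW.
have nz : n%:Z != 0 by rewrite eqz_nat -lt0n.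
have hk : (`|(z %% n%:Z)%Z| < n)%N by rewrite -ltz_nat gez0_abs ?modz_ge0 // ltz_pmod.
exists (Ordinal hk) => /=.
have -> : P - P0 *+ `|(z %% n%:Z)%Z| = (P - P0 *~ z) + (P0 *+ n) *~ (z %/ n%:Z)%Z.
  rewrite pmulrn gez0_abs ?modz_ge0 //.
  have := divz_eq z n%:Z; move: (z %/ _)%Z (z %% _)%Z => a c ->.
  by rewrite mulrzDr opprD addrA addrAC [P0 *+ n]pmulrn -mulrzA [n%:Z * a]mulrC subrK.
by rewrite depthD_depth0 // depth_eq0_mulz.
Qed.

Lemma depth_multiple_neq0 k : (0 < k < n)%N -> m (P0 *+ k) != 0.
Proof.
case/andP=> k0 kn; have lt : k%:R * delta < V by rewrite eV ltr_pM2r // ltr_nat.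
rewrite depth_multiple ?ltW // gt_eqF // lt_min subr_gt0 lt andbT.
by rewrite mulr_gt0 // ltr0n.
Qed.

Lemma bern2_depth_multiples (k l : 'I_n) :
  bern2 V (m (P0 *+ k - P0 *+ l)) = V * bern2 1 (`|k%:R - l%:R| / n%:R).
Proof.
wlog lk : k l / (l <= k)%N.
  move=> IH; case/orP: (leq_total l k) => h; first exact: IH.
  by rewrite -depthN opprB IH // distrC.
have n0 : 0 < n%:R :> R by rewrite ltr0n.
rewrite -mulrnBr // depth_multiple; last first.
  rewrite eV ler_pM2r // ler_nat.
  by apply: leq_trans (leq_subr _ _) (ltnW (ltn_ord k)).
rewrite bern2_min ?gt_eqF // -natrB // ger0_norm ?ler0n //.
have -> : delta = V / n%:R by rewrite eV mulrAC divff ?mul1r // gt_eqF.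
by rewrite /bern2; field; rewrite !gt_eqF.
Qed.

Lemma sum_bern2_depth_period_ge (I : finType) (P : I -> G) :
  #|I|%:R ^+ 2 / n%:R ^+ 2 * (V / 12%:R) <= \sum_i \sum_j bern2 V (m (P i - P j)).
Proof.
have hk i : exists k : 'I_n, m (P i - P0 *+ k) == 0.
  by have [k hk] := depth_residue (P i); exists k; rewrite hk.
pose k i := xchoose (hk i).
have kP i : m (P i - P0 *+ k i) = 0 by apply/eqP; apply: (xchooseP (hk i)).
have -> : \sum_i \sum_j bern2 V (m (P i - P j)) =
    V * \sum_i \sum_j bern2 1 (`|(k i)%:R - (k j)%:R| / n%:R).
  rewrite mulr_sumr; apply: eq_bigr => i _; rewrite mulr_sumr; apply: eq_bigr => j _.
  rewrite -bern2_depth_multiples; congr (bern2 _ _).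
  have -> : P i - P j = (P0 *+ k i - P0 *+ k j) + ((P i - P0 *+ k i) - (P j - P0 *+ k j)).
    by rewrite opprB addrA [_ + (P i - _)]addrAC [_ + (P i - _)]addrC subrK addrA subrK.
  by rewrite depthD_depth0 // depthD_depth0 ?kP // depthN kP.
by rewrite mulrCA ler_pM2l // sum_bern2_cyclic_ge.
Qed.

End Period.
End Generator.

Variables (H : pred G) (reps : seq G).
Hypothesis H_sub : forall P Q, H P -> H Q -> H (P - Q).
Hypothesis repsP : forall P, exists2 Q, Q \in reps & H (P - Q).
Hypothesis H_depth0 : forall P, H P -> m P = 0.

Lemma depth_min_exists : (exists P, m P != 0) ->
  exists2 P0, 0 < m P0 & forall P, m P != 0 -> m P0 <= m P.
Proof.
have idx P : exists i : 'I_(size reps), m P = m (nth 0 reps i).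
  have [f hf] := coset_index repsP (fun _ : unit => P); exists (f tt).
  by rewrite -{1}(subrKC (nth 0 reps (f tt)) P) depthD_depth0 // H_depth0.
case=> P hP; have [i0 e0] := idx P; rewrite e0 in hP.
case: (arg_minP (fun i : 'I_(size reps) => m (nth 0 reps i))
  (hP : (fun i : 'I_(size reps) => m (nth 0 reps i) != 0) i0)) => i hi i_min.
exists (nth 0 reps i); first by rewrite lt_neqAle eq_sym hi depth_ge0.
by move=> Q; have [j ->] := idx Q; apply: i_min.
Qed.

Lemma depth_period_le P0 n : 0 < m P0 -> V = n%:R * m P0 -> (n <= size reps)%N.
Proof.
move=> P0_gt0 eV; have [f hf] := coset_index repsP (fun k : 'I_n => P0 *+ k).
suff inj : injective f by have := leq_card f inj; rewrite !card_ord.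
have lt_neq (i j : 'I_n) : (i < j)%N -> f i <> f j.
  move=> ij /esym e; have /eqP := H_depth0 (same_coset H_sub hf e).
  rewrite -mulrnBr ?(ltnW ij) //; apply/negP; apply: (depth_multiple_neq0 P0_gt0 eV).
  by rewrite subn_gt0 ij (leq_ltn_trans (leq_subr _ _)).
move=> i j e; apply/val_inj; case: (ltngtP i j) => // h; exfalso.
  exact: lt_neq h e.
exact: lt_neq h (esym e).
Qed.

Lemma sum_bern2_depth_ge (I : finType) (P : I -> G) :
  #|I|%:R ^+ 2 / (size reps)%:R ^+ 2 * (V / 12%:R) <= \sum_i \sum_j bern2 V (m (P i - P j)).
Proof.
have V12 : 0 < V / 12%:R by rewrite divr_gt0.
have c0 := reps_gt0 repsP.
have weaken n : (0 < n <= size reps)%N -> #|I|%:R ^+ 2 / (size reps)%:R ^+ 2 * (V / 12%:R) <=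
    #|I|%:R ^+ 2 / n%:R ^+ 2 * (V / 12%:R).
  case/andP=> n0 nc; rewrite ler_pM2r // ler_wpM2l ?exprn_ge0 //.
  by rewrite lef_pV2 ?posrE ?exprn_gt0 ?ltr0n // lerXn2r ?nnegrE // ler_nat.
have [h|h] := pselect (exists Q, m Q != 0).
  have [P0 P0_gt0 P0_min] := depth_min_exists h.
  have [n n1 eV] := depth_period P0_gt0 P0_min; have n0 : (0 < n)%N by apply: ltnW.
  apply: le_trans (sum_bern2_depth_period_ge P0_gt0 P0_min n0 eV P); apply: weaken.
  by rewrite n0 (depth_period_le P0_gt0 eV).
have m_eq0 Q : m Q = 0 by apply/eqP/negPn/negP => hQ; apply: h; exists Q.
under eq_bigr do under eq_bigr do rewrite m_eq0 bern2_0.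
by rewrite sum_sum_const; have := weaken 1%N c0; rewrite expr1n divr1.
Qed.

End DepthFunction.

Section Energy.
Variables (R : realFieldType) (G : zmodType) (H : pred G) (reps : seq G).
Hypothesis H_sub : forall P Q, H P -> H Q -> H (P - Q).
Hypothesis repsP : forall P, exists2 Q, Q \in reps & H (P - Q).
Variables (lam g : G -> R) (V D : R).
Hypotheses (VD : V <= D) (g0 : g 0 = V / 12%:R).
Hypothesis lam_ge : forall P, P != 0 -> (H P)%:R * ((D - V) / 12%:R) + g P <= lam P.
Hypothesis sum_g_ge : forall (I : finType) (P : I -> G),
  #|I|%:R ^+ 2 / (size reps)%:R ^+ 2 * (V / 12%:R) <= \sum_i \sum_j g (P i - P j).
Variables (I : finType) (P : I -> G).
Hypotheses (P_inj : injective P) (I_gt0 : (0 < #|I|)%N).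

Let local_bound Q := (H Q)%:R * ((D - V) / 12%:R) + g Q.

Lemma sum_local_bound_ge :
  #|I|%:R ^+ 2 / (size reps)%:R ^+ 2 * (D / 12%:R) <= \sum_i \sum_j local_bound (P i - P j).
Proof.
have c0 : 0 < (size reps)%:R :> R by rewrite ltr0n (reps_gt0 repsP).
have -> : \sum_i \sum_j local_bound (P i - P j) =
    (\sum_i \sum_j (H (P i - P j))%:R) * ((D - V) / 12%:R) + \sum_i \sum_j g (P i - P j).
  by rewrite mulr_suml -big_split; apply: eq_bigr => i _; rewrite mulr_suml -big_split.
rewrite -[in D / _](subrK V D) mulrDl mulrDr; apply: lerD; last exact: sum_g_ge.
apply: ler_wpM2r; first by rewrite divr_ge0 // subr_ge0.
apply: le_trans (sum_same_coset_ge H_sub repsP R P).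
rewrite ler_wpM2l ?exprn_ge0 ?ler0n // lef_pV2 ?posrE ?exprn_gt0 // ler_eXnr //.
by rewrite -[1]/(1%:R) ler_nat (reps_gt0 repsP).
Qed.

Lemma sum_local_bound_le :
  \sum_i \sum_j local_bound (P i - P j) - #|I|%:R * (D / 12%:R) <=
  \sum_i \sum_(j | i != j) lam (P i - P j).
Proof.
have H0 : H 0 by have [Q _ hQ] := repsP 0; rewrite -(subrr (0 - Q)); apply: H_sub.
have -> : #|I|%:R * (D / 12%:R) = \sum_(i : I) D / 12%:R by rewrite sumr_const mulr_natl.
rewrite -sumrB; apply: ler_sum => i _.
rewrite (bigD1 i) //= subrr {1}/local_bound H0 mul1r g0 -mulrDl subrK addrAC subrr add0r.
under eq_bigl do rewrite eq_sym.
by apply: ler_sum => j ij; apply: lam_ge; rewrite subr_eq0 (inj_eq P_inj).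
Qed.

Lemma energy_ge :
  ((size reps)%:R ^- 2 - #|I|%:R^-1) * (12%:R^-1 * D) <=
  #|I|%:R ^- 2 * \sum_i \sum_(j | i != j) lam (P i - P j).
Proof.
have N0 : 0 < #|I|%:R :> R by rewrite ltr0n.
have c0 : 0 < (size reps)%:R :> R by rewrite ltr0n (reps_gt0 repsP).
have -> : ((size reps)%:R ^- 2 - #|I|%:R^-1) * (12%:R^-1 * D) = #|I|%:R ^- 2 *
    (#|I|%:R ^+ 2 / (size reps)%:R ^+ 2 * (D / 12%:R) - #|I|%:R * (D / 12%:R)).
  by field; rewrite !gt_eqF.
rewrite ler_pM2l ?invr_gt0 ?exprn_gt0 //.
by apply: le_trans sum_local_bound_le; rewrite lerD2r sum_local_bound_ge.
Qed.

End Energy.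

Section KummerEnergy.
Variables (R : realType) (K : fieldType) (abs : nonarch_abs R K).
Variables (G : zmodType) (B : binv K) (X : G -> option K) (lam : G -> R) (reps : seq G).
Hypotheses (kum : kummer_line B X) (hgt : kummer_height abs B X lam).
Hypothesis hB : integral_binv abs B.
Hypothesis repsP : forall P, exists2 Q, Q \in reps & nonsingular abs B X (P - Q).
Variables (I : finType) (P : I -> G).
Hypotheses (P_inj : injective P) (I_gt0 : (0 < #|I|)%N).
Local Notation D := (- ln (abs (bdisc B))).
Local Notation energy_bound :=
  (((size reps)%:R ^- 2 - #|I|%:R^-1) * (12%:R^-1 * D) <=
   #|I|%:R ^- 2 * \sum_i \sum_(j | i != j) lam (P i - P j)).

Lemma height_ge_disc Q : Q != 0 -> nonsingular abs B X Q -> D / 12%:R <= lam Q.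
Proof. by move=> Q0 /(height_ge_nonsingular kum hgt hB Q0); rewrite mulNr mulrC mulNr. Qed.

Lemma energy_ge_potgood : abs (c4inv B) ^+ 3 <= abs (bdisc B) -> energy_bound.
Proof.
move=> hc; apply: (@energy_ge R G (nonsingular abs B X) reps _ repsP lam (fun=> 0) 0) => //.
- by move=> Q T; apply: nonsingularB.
- by rewrite oppr_ge0 ln_le0 // bdisc_le1.
- by rewrite mul0r.
- move=> Q Q0; rewrite addr0 subr0; case E: (nonsingular abs B X Q); rewrite ?mul1r ?mul0r.
    exact: height_ge_disc.
  exact: (height_ge0_potgood kum hgt hB).
- by move=> J T; rewrite mul0r mulr0 sum_sum_const mulr0.
Qed.

Hypotheses (two_neq0 : (2%:R : K) != 0) (three_neq0 : (3%:R : K) != 0).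
Hypothesis cpl : abs_complete abs.

Lemma energy_ge_potmult : abs (bdisc B) < abs (c4inv B) ^+ 3 -> energy_bound.
Proof.
move=> hc; have hr := kummer_rel kum; have d0 := kummer_disc kum.
have [r [k [b [k0 b0 b1 k1 tateE]]]] := tate_form_exists two_neq0 three_neq0 cpl hr d0 hB hc.
have kumT := kummer_line_affine r k0 kum; have hgtT := kummer_height_affine r k0 kum hgt.
rewrite tateE in kumT hgtT; set m := point_depth abs b (xaffine r k X).
have V0 := tate_V_gt0 b0 b1; set V := - ln (abs b) in V0.
have m_itv Q : 0 <= m Q <= V / 2%:R by apply: point_depth_itv.
have VD : V <= D.
  have eb : abs b = abs (bdisc B) / abs k ^+ 6.
    by rewrite -(bdisc_tate b1) -tateE bdisc_affine // absM absV absX.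
  have Dp : 0 < abs (bdisc B) by rewrite abs_gt0.
  rewrite lerN2 ler_ln ?posrE ?abs_gt0 // eb ler_pdivlMr ?exprn_gt0 ?abs_gt0 //.
  by rewrite ler_piMr // exprn_ile1.
apply: (@energy_ge R G (nonsingular abs B X) reps _ repsP lam (fun Q => bern2 V (m Q)) V) => //.
- by move=> Q T; apply: nonsingularB.
- by rewrite /m (point_depth0 abs kumT) bern2_0.
- move=> Q Q0; case E: (nonsingular abs B X Q); rewrite ?mul1r ?mul0r ?add0r.
    by rewrite /m (nonsingular_depth0 k0 k1 b1 tateE E) bern2_0 -mulrDl subrK height_ge_disc.
  exact: height_ge_bern2.
- move=> J T; apply: (sum_bern2_depth_ge V0 m_itv _ _ repsP) => [S S'|S S'|S].
  + exact: point_depth_rel.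
  + exact: nonsingularB.
  + exact: nonsingular_depth0.
Qed.

Lemma kummer_energy_ge : energy_bound.
Proof.
have [hc|hc] := leP (abs (c4inv B) ^+ 3) (abs (bdisc B)).
  exact: energy_ge_potgood.
exact: energy_ge_potmult.
Qed.

End KummerEnergy.

(** * Points of a Weierstrass curve *)

Section WeierstrassKummer.
Variables (K : fieldType) (W : wcoef K).
Local Notation a1 := (wa1 W).
Local Notation a2 := (wa2 W).
Local Notation a3 := (wa3 W).
Local Notation a4 := (wa4 W).

Definition wbinv := BInv (wb2 W) (wb4 W) (wb6 W) (wb8 W).

Lemma brel_wbinv : brel wbinv.
Proof. by rewrite /brel /wbinv /b2 /b4 /b6 /b8 /wb2 /wb4 /wb6 /wb8; ring. Qed.

Lemma bdisc_wbinv : bdisc wbinv = disc W.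
Proof. by []. Qed.

Lemma psi2sq_wbinv x y : on_curve W (Some (x, y)) -> psi2sq wbinv x = curve_dy W x y ^+ 2.
Proof.
move=> /on_curve_a6 e; rewrite b6_shift /wbinv /b2 /b4 /b6 /wb2 /wb4 /wb6 e /curve_dy.
by ring.
Qed.

Lemma psi3_wbinv x y : on_curve W (Some (x, y)) ->
  psi3 wbinv x = (a2 + 3%:R * x) * curve_dy W x y ^+ 2
    - a1 * curve_dy W x y * curve_dx W x y - curve_dx W x y ^+ 2.
Proof.
move=> /on_curve_a6 e; rewrite b8_shift /wbinv /b2 /b4 /b6 /b8 /wb2 /wb4 /wb6 /wb8 e.
by rewrite /curve_dx /curve_dy; ring.
Qed.

Lemma psi2sq_wbinv_on_curve x y : (2%:R : K) != 0 ->
  psi2sq wbinv x = curve_dy W x y ^+ 2 -> on_curve W (Some (x, y)).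
Proof.
move=> n2 e; have n4 : (4%:R : K) != 0.
  by rewrite (_ : 4%:R = 2%:R * 2%:R :> K) ?mulf_neq0 // -natrM.
apply/eqP/subr0_eq/(mulfI n4); rewrite mulr0.
transitivity (curve_dy W x y ^+ 2 - psi2sq wbinv x); last by rewrite e subrr.
by rewrite b6_shift /wbinv /b2 /b4 /b6 /wb2 /wb4 /wb6 /curve_dy; ring.
Qed.

Lemma chord_add_mul_num x1 y1 x2 y2 : x1 != x2 ->
  on_curve W (Some (x1, y1)) -> on_curve W (Some (x2, y2)) ->
  let y2' := - y2 - a1 * x2 - a3 in
  let z := (slope_sum W (x1, y1) (x2, y2) ((y2 - y1) / (x2 - x1))).1 in
  let w := (slope_sum W (x1, y1) (x2, y2') ((y2' - y1) / (x2 - x1))).1 in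
  (z + w) * (x1 - x2) ^+ 2 = add_num wbinv x1 x2 /\
  z * w * (x1 - x2) ^+ 2 = mul_num wbinv x1 x2.
Proof.
move=> ne C1 C2; have d0 : x2 - x1 != 0 by rewrite subr_eq0 eq_sym.
have e6 := on_curve_a6 C1; have e6' := on_curve_a6 C2.
have e4 : a4 = ((y2 ^+ 2 + a1 * x2 * y2 + a3 * y2 - (x2 ^+ 3 + a2 * x2 ^+ 2)) -
   (y1 ^+ 2 + a1 * x1 * y1 + a3 * y1 - (x1 ^+ 3 + a2 * x1 ^+ 2))) / (x2 - x1).
  apply: (mulIf d0); rewrite divfK //; apply/subr0_eq.
  by transitivity (wa6 W - wa6 W); [rewrite {1}e6 e6'; ring | rewrite subrr].
rewrite /= /add_num /mul_num /wbinv /b2 /b4 /b6 /b8 /wb2 /wb4 /wb6 /wb8.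
by split; rewrite e6 e4; field.
Qed.

Lemma addpt_dbl_num x y : on_curve W (Some (x, y)) -> curve_dy W x y != 0 ->
  exists z y', addpt W (Some (x, y)) (Some (x, y)) = Some (z, y') /\
    z * psi2sq wbinv x = dbl_num wbinv x.
Proof.
move=> C dy0; rewrite addpt_tangent // /slope_sum /=; do 2!eexists; split; first by [].
rewrite (psi2sq_wbinv C) /dbl_num /wbinv /b4 /b6 /b8 /wb4 /wb6 /wb8 (on_curve_a6 C).
by move: dy0; rewrite /curve_dx /curve_dy => dy0; field.
Qed.

Hypothesis D0 : disc W != 0.

Definition xcoord (P : curve_point D0) : option K := omap fst (val P).

Lemma xcoord_Some P x : xcoord P = Some x ->
  exists2 y, val P = Some (x, y) & on_curve W (Some (x, y)).
Proof. by rewrite /xcoord; case: P => [[[x' y]|] C] //= [<-]; exists y. Qed.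

Lemma xcoord_inj P Q : xcoord P = xcoord Q -> P = Q \/ P = - Q.
Proof.
case EQ: (xcoord Q) => [x|]; last first.
  by case: P Q EQ => [[[x y]|] C] [[[x' y']|] C'] //= _ _; left; apply/val_inj.
move/xcoord_Some=> [y1 EP C1]; have [y2 {}EQ C2] := xcoord_Some EQ.
have [ey|e0] := on_curve_same_x C1 C2; [left | right]; apply/val_inj.
  by rewrite EP EQ ey.
rewrite val_pointN EP EQ /=; congr (Some (_, _)); apply/subr0_eq; rewrite -e0.
by ring.
Qed.

Lemma kummer_line_xcoord : kummer_line wbinv xcoord.
Proof.
split => //.
- exact: brel_wbinv.
- by case=> [[[x y]|] C] //= _; apply/val_inj.
- by case=> [[[x y]|] C].
- exact: xcoord_inj.
- move=> P Q x1 x2 /xcoord_Some[y1 EP C1] /xcoord_Some[y2 EQ C2] ne.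
  have [es ep] := chord_add_mul_num ne C1 C2.
  eexists; eexists; split; [| | exact: es | exact: ep].
    by rewrite /xcoord val_pointD EP EQ addpt_chord.
  by rewrite /xcoord val_pointD val_pointN EP EQ [negpt _ _]/= addpt_chord.
- move=> P x /xcoord_Some[y EP C]; rewrite (psi2sq_wbinv C) expf_eq0 /= => dy0.
  have [z [y' [ez e]]] := addpt_dbl_num C dy0; exists z; last by rewrite -(psi2sq_wbinv C).
  by rewrite /xcoord val_pointD EP ez.
- move=> P x /xcoord_Some[y EP C]; rewrite (psi2sq_wbinv C) => /eqP.
  rewrite expf_eq0 /= => /eqP dy0.
  by apply/val_inj; rewrite val_pointD EP addpt_dy0.
Qed.

End WeierstrassKummer.

Section TwoTorsion.
Variables (R : realType) (K : fieldType) (abs : nonarch_abs R K).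
Hypothesis two_neq0 : (2%:R : K) != 0.
Hypothesis cpl : abs_complete abs.
Hypothesis nontrivial : exists2 a : K, a != 0 & abs a < 1.
Implicit Types (d e : R).

Lemma exists_abs_lt e : 0 < e -> exists2 x : K, x != 0 & abs x < e.
Proof.
move=> e0; have [a a0 a1] := nontrivial.
have [|n an] := @exists_exprn_lt R (abs a) e _ e0; first by rewrite abs_ge0.
by exists (a ^+ n); rewrite ?expf_neq0 ?absX.
Qed.

(* With g the derivative of psi2sq at a root, psi2sq (x + g eta ^+ 2) is (g eta) ^+ 2 times an
   element close to 1. *)
Lemma psi2sq_sqr_near_root (B : binv K) x d : brel B -> bdisc B != 0 -> psi2sq B x = 0 ->
  0 < d -> exists h Y, [/\ abs h < d, abs Y < d, Y != 0 & psi2sq B (x + h) = Y ^+ 2].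
Proof.
move=> hr D0 e6 d0; have n4 : (4%:R : K) != 0.
  by rewrite (_ : 4%:R = 2%:R * 2%:R :> K) ?mulf_neq0 // -natrM.
rewrite -(bdisc_shift x hr) in D0; have := brel_shift x hr.
under eq_exists => h do under eq_exists => Y do rewrite -bshiftD.
move: (bshift B x) D0 e6 => {hr}B D0 e6 hr.
have b40 : b4 B != 0.
  apply: contra_neq D0 => e4; have /eqP : 4%:R * b8 B = 0 by rewrite hr e4 e6 mulr0 expr0n subr0.
  by rewrite mulf_eq0 (negPf n4) => /eqP e8; rewrite /bdisc e4 e6 e8; ring.
pose g := 2%:R * b4 B; have g0 : g != 0 by rewrite mulf_neq0.
pose c := 1 + abs (b2 B / 4%:R) + abs g.
have [c2 cg] : 0 <= abs (b2 B / 4%:R) /\ 0 <= abs g by [].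
have c0 : 0 < c by rewrite /c; lra.
pose e := Num.min 1 d; have e_gt0 : 0 < e by rewrite lt_min ltr01.
have ec0 : 0 < Num.min 1 (e / c) by rewrite lt_min ltr01 divr_gt0.
have [eta eta0] := exists_abs_lt ec0; rewrite lt_min ltr_pdivlMr // => /andP[eta1 eta_lt].
have small a n : abs a <= c -> abs (a * eta ^+ n.+1) < e.
  move=> ac; apply: le_lt_trans eta_lt; rewrite absM mulrC exprS ler_pM //.
  by rewrite absM ler_piMr // absX_le1 // ltW.
have [e1 ed] : e <= 1 /\ e <= d by rewrite !ge_min !lexx orbT.
pose f := b2 B / 4%:R * eta ^+ 2 + g * eta ^+ 4.
have f1 : abs f < 1 by apply: lt_le_trans e1; rewrite absD_lt ?small // /c; lra.
have [w ew wf] := sqrt_1D4M cpl f1.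
have w1 : abs (1 + 2%:R * w) = 1 by rewrite absDl abs1 // abs_natM_lt // (le_lt_trans wf).
exists (g * eta ^+ 2), (g * eta * (1 + 2%:R * w)); split.
- by apply: lt_le_trans ed; apply: small; rewrite /c; lra.
- by rewrite absM w1 mulr1 -[eta]expr1; apply: lt_le_trans ed; apply: small; rewrite /c; lra.
- by rewrite !mulf_neq0 // -(abs_eq0 abs) w1 oner_eq0.
- by rewrite exprMn ew b6_shift e6 /f /g; field.
Qed.

Lemma curve_near_2torsion (W : wcoef K) x0 y0 d : disc W != 0 ->
  on_curve W (Some (x0, y0)) -> curve_dy W x0 y0 = 0 -> 0 < d -> exists x y,
  [/\ on_curve W (Some (x, y)), abs (x - x0) < d, abs (y - y0) < d & curve_dy W x y != 0].
Proof.
move=> D0 C dy0 dp; have p0 : psi2sq (wbinv W) x0 = 0 by rewrite (psi2sq_wbinv C) dy0 expr0n.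
pose d' := Num.min d (d * abs 2%:R) / (1 + abs (wa1 W)).
have a1p : 0 < 1 + abs (wa1 W) by rewrite ltr_pwDl.
have min_gt0 : 0 < Num.min d (d * abs 2%:R) by rewrite lt_min dp mulr_gt0 // abs_gt0.
have d'0 : 0 < d' by rewrite divr_gt0.
have d'_le : d' <= Num.min d (d * abs 2%:R).
  by rewrite ler_pdivrMr // ler_peMr ?(ltW min_gt0) // lerDl.
have [h [Y [hd Yd Y0 e]]] := psi2sq_sqr_near_root (brel_wbinv W) D0 p0 d'0.
pose x := x0 + h; pose y := (Y - wa1 W * x - wa3 W) / 2%:R.
have dyE : curve_dy W x y = Y by rewrite /curve_dy /y; field.
exists x, y; split; rewrite ?dyE //.
- by apply: psi2sq_wbinv_on_curve; rewrite // dyE.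
- rewrite /x addrC addKr; apply: lt_le_trans hd (le_trans d'_le _).
  by rewrite ge_min lexx.
- have -> : y - y0 = (Y - wa1 W * h) / 2%:R.
    apply: (mulIf two_neq0); rewrite divfK // -[in RHS](subr0 (Y - _)) -dy0 /y /x /curve_dy.
    by field.
  have le2 : Num.min d (d * abs 2%:R) <= d * abs 2%:R by rewrite ge_min lexx orbT.
  rewrite absM absV ltr_pdivrMr ?abs_gt0 //; apply: lt_le_trans le2.
  rewrite -[Num.min _ _](divfK (lt0r_neq0 a1p)) -/d'; apply: absB_lt.
    by apply: lt_le_trans Yd _; rewrite ler_peMr ?(ltW d'0) // lerDl.
  rewrite absM; apply: le_lt_trans (ler_wpM2l _ (ltW hd)) _ => //.
  by rewrite mulrC ltr_pM2l // ltrDr.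
Qed.

End TwoTorsion.

Section NeronHeight.
Variables (R : realType) (K : fieldType) (abs : nonarch_abs R K).
Hypothesis two_neq0 : (2%:R : K) != 0.
Hypothesis cpl : abs_complete abs.
Hypothesis nontrivial : exists2 a : K, a != 0 & abs a < 1.
Variables (W : wcoef K) (D0 : disc W != 0) (lam : K * K -> R).
Hypothesis neron : is_neron_local_height abs W lam.

Definition point_height (P : curve_point D0) : R := lamE lam (val P).

Lemma neron_height_ge : exists C, forall x y, on_curve W (Some (x, y)) ->
  2%:R^-1 * ln (Num.max 1 (abs x)) - C <= lam (x, y).
Proof.
case: neron => _ bounded [L near_O] _.
have [M hM] := near_O _ ltr01; set M1 := Num.max M 1; have [b hb] := bounded M1.
have M11 : 1 <= M1 by rewrite le_max lexx orbT.
exists (Num.max (1 - L) (b + 2%:R^-1 * ln M1)) => x y C; set c := Num.max _ (b + _).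
have c1 : 1 - L <= c by rewrite le_max lexx.
have c2 : b + 2%:R^-1 * ln M1 <= c by rewrite le_max lexx orbT.
have [xM|xM] := leP (abs x) M1.
  have := hb _ _ C xM; rewrite ler_norml => /andP[h _].
  have : ln (Num.max 1 (abs x)) <= ln M1.
    by rewrite ler_ln ?posrE ?lt_max ?ltr01 ?orbT // ge_max M11.
  by lra.
have xM' : M < abs x by apply: le_lt_trans xM; rewrite le_max lexx.
have x1 : 1 <= abs x by apply: le_trans M11 (ltW xM).
have := hM _ _ C xM'; rewrite ltr_norml => /andP[h _].
by rewrite max_r //; lra.
Qed.

Lemma kummer_height_neron : kummer_height abs (wbinv W) (@xcoord K W D0) point_height.
Proof.
have [C hC] := neron_height_ge; case: (neron) => cont _ _ dbl; split.
- by exists C => P x /xcoord_Some[y EP C']; rewrite /point_height EP; apply: hC.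
- move=> P x /xcoord_Some[y EP C']; rewrite (psi2sq_wbinv C') expf_eq0 /= => dy0.
  have [z [y' [ez _]]] := addpt_dbl_num C' dy0.
  have := dbl x y C'; rewrite ez => /(_ isT).
  rewrite /point_height val_pointD EP ez /= => ->.
  have p0 : 0 < abs (curve_dy W x y) by rewrite abs_gt0.
  by rewrite absX lnXn // bdisc_wbinv -/(curve_dy W x y); lra.
- move=> P x /xcoord_Some[y EP C']; rewrite (psi2sq_wbinv C') => /eqP.
  rewrite expf_eq0 /= => /eqP dy0 d e dp ep; have [d' dp' hd] := cont _ _ C' _ ep.
  have mp : 0 < Num.min d d' by rewrite lt_min dp.
  have [x' [y' [C'' hx hy ne]]] := curve_near_2torsion two_neq0 cpl nontrivial D0 C' dy0 mp.
  move: hx hy; rewrite !lt_min => /andP[hx hx'] /andP[hy hy'].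
  exists (mkpoint D0 C''), x'; split => //; first by rewrite (psi2sq_wbinv C'') expf_neq0.
  by rewrite /point_height EP /=; apply: hd.
Qed.

End NeronHeight.

Section IntegralModel.
Variables (R : realType) (K : fieldType) (abs : nonarch_abs R K) (W : wcoef K).
Hypothesis intW : integral_model abs W.
Implicit Types x y : K.
Local Notation a1 := (wa1 W).
Local Notation a2 := (wa2 W).
Local Notation a3 := (wa3 W).
Local Notation a4 := (wa4 W).

Lemma integral_wbinv : integral_binv abs (wbinv W).
Proof.
case: intW => h1 h2 h3 h4 h6.
split; rewrite /wbinv /b2 /b4 /b6 /b8 /wb2 /wb4 /wb6 /wb8;
  by rewrite !absD_le ?absN ?absM_le1 ?absX_le1 ?abs_nat.
Qed.

Lemma integral_point_y x y : on_curve W (Some (x, y)) -> abs x <= 1 -> abs y <= 1.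
Proof.
case: intW => h1 h2 h3 h4 h6 /eqP C x1; rewrite leNgt; apply/negP => y1.
have y2 : abs y < abs y ^+ 2 by rewrite expr2 ltr_pMr // (lt_trans ltr01).
have lhs : abs (y ^+ 2 + a1 * x * y + a3 * y) = abs y ^+ 2.
  rewrite -addrA absDl absX //; apply: absD_lt; apply: le_lt_trans y2.
    by rewrite absM ler_piMl // absM_le1.
  by rewrite absM ler_piMl.
suff : abs y ^+ 2 <= 1 by rewrite leNgt exprn_egt1.
by rewrite -lhs C !absD_le ?absM_le1 ?absX_le1.
Qed.

Lemma psi_radius_lt1_singular x y : on_curve W (Some (x, y)) -> abs x <= 1 ->
  (psi_radius abs (wbinv W) x < 1) = (abs (curve_dy W x y) < 1) && (abs (curve_dx W x y) < 1).
Proof.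
move=> C x1; have y1 := integral_point_y C x1; case: intW => h1 h2 h3 h4 h6.
rewrite psi_radius_lt1 (psi2sq_wbinv C) (psi3_wbinv C) absX expr_lt1 //.
have [dy1|//] := ltP (abs (curve_dy W x y)) 1.
have dx1 : abs (curve_dx W x y) <= 1.
  by rewrite /curve_dx !absD_le ?absN ?absM_le1 ?absX_le1 ?abs_nat.
set t := (X in abs (X - _)); have t1 : abs t < 1.
  apply: absB_lt; first by rewrite absM_lt1 ?absX_lt1 ?absD_le ?absM_le1 ?abs_nat.
  by rewrite mulrAC absM_lt1 ?absM_le1.
rewrite -[RHS](@expr_lt1 _ 2) // -absX; apply/idP/idP => h; last exact: absB_lt.
by rewrite -[_ ^+ 2](subKr t) absB_lt.
Qed.

Lemma nonsingular_reductionP x y : on_curve W (Some (x, y)) ->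
  (1 < abs x \/ ~ (abs (curve_dy W x y) < 1 /\ abs (curve_dx W x y) < 1)) <->
  1 <= psi_radius abs (wbinv W) x.
Proof.
move=> C; have [x1|x1] := ltP 1 (abs x).
  split=> _; last by left.
  have := psi_radius_ge integral_wbinv x1; rewrite leNgt; apply: contraNle => r1.
  by rewrite (le_lt_trans _ x1) // exprn_ile1 ?psi_radius_ge0 // ltW.
rewrite leNgt (psi_radius_lt1_singular C x1); split.
  by case=> // h; apply/negP => /andP.
by move=> /negP h; right => /andP.
Qed.

End IntegralModel.

Section MinimalModel.
Variables (R : realType) (K : fieldType) (abs : nonarch_abs R K).
Variables (W : wcoef K) (D0 : disc W != 0) (u r s t : K).
Hypotheses (u0 : u != 0) (intW : integral_model abs (chg W u r s t)).

Lemma wbinv_chg : wbinv (chg W u r s t) = bscale (bshift (wbinv W) r) (u ^+ 2).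
Proof.
rewrite /wbinv /bscale /bshift /b2 /b4 /b6 /b8 /wb2 /wb4 /wb6 /wb8 /chg /=.
by congr BInv; field.
Qed.

Lemma disc_chg_neq0 : disc (chg W u r s t) != 0.
Proof.
have u2 : u ^+ 2 != 0 by rewrite expf_neq0.
rewrite -bdisc_wbinv wbinv_chg bdisc_affine //; last exact: brel_wbinv.
by rewrite mulf_neq0 // invr_eq0 expf_neq0.
Qed.

Lemma chg_pt_on_curve x y : on_curve W (Some (x, y)) ->
  on_curve (chg W u r s t) (chg_pt u r s t (Some (x, y))).
Proof. by move=> /on_curve_a6 e; apply/eqP; rewrite /chg /= e; field. Qed.

Lemma in_E0_nonsingular (P : curve_point D0) : in_E0 abs W u r s t (val P) <->
  nonsingular abs (wbinv (chg W u r s t)) (xaffine r (u ^+ 2) (@xcoord K W D0)) P.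
Proof.
case: P => [[[x y]|] C]; rewrite /in_E0 /nonsingular /xaffine /xcoord //=.
exact: nonsingular_reductionP (chg_pt_on_curve C).
Qed.

End MinimalModel.

Section WeierstrassEnergy.
Variables (R : realType) (K : fieldType) (abs : nonarch_abs R K).
Hypotheses (two_neq0 : (2%:R : K) != 0) (three_neq0 : (3%:R : K) != 0).
Hypothesis cpl : abs_complete abs.
Hypothesis nontrivial : exists2 a : K, a != 0 & abs a < 1.
Variables (W : wcoef K) (u r s t : K) (lam : K * K -> R).
Hypotheses (D0 : disc W != 0) (u0 : u != 0).
Hypothesis intW : integral_model abs (chg W u r s t).
Hypothesis neron : is_neron_local_height abs W lam.

Lemma neron_energy_ge (I : finType) (P : I -> curve_point D0) (c : nat) :
  is_tamagawa abs W u r s t c -> injective P -> (0 < #|I|)%N ->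
  (c%:R ^- 2 - #|I|%:R^-1) * (12%:R^-1 * - ln (abs (disc (chg W u r s t)))) <=
  #|I|%:R ^- 2 * \sum_i \sum_(j | i != j) point_height lam (P i - P j).
Proof.
case=> reps [<- onW _ repsP] P_inj I_gt0.
have u2 : u ^+ 2 != 0 by rewrite expf_neq0.
have kum := kummer_line_xcoord D0.
have hgt := kummer_height_neron two_neq0 cpl nontrivial D0 neron.
have := kummer_line_affine r u2 kum; have := kummer_height_affine r u2 kum hgt.
rewrite -(wbinv_chg W r s t u0) => hgt' kum'.
have repsP' Q : exists2 T, T \in map (to_point D0) reps &
    nonsingular abs (wbinv (chg W u r s t)) (xaffine r (u ^+ 2) (@xcoord K W D0)) (Q - T).
  have [T Tr hT] := repsP _ (valP Q); exists (to_point D0 T); first exact: map_f.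
  apply/in_E0_nonsingular => //.
  by rewrite val_pointD val_pointN val_to_point //; apply: (allP onW).
have := kummer_energy_ge kum' hgt' (integral_wbinv intW) repsP' P_inj I_gt0.
by rewrite size_map; apply.
Qed.

Lemma Lambda_ge (Z : seq (option (K * K))) (c : nat) :
  is_tamagawa abs W u r s t c -> uniq Z -> all (on_curve W) Z -> (0 < size Z)%N ->
  (c%:R ^- 2 - (size Z)%:R^-1) * (12%:R^-1 * ln (abs (disc (chg W u r s t))^-1)) <=
  Lambda W lam Z.
Proof.
move=> tam uZ onW Z0; rewrite absV lnV; last by rewrite posrE abs_gt0 disc_chg_neq0.
pose P (i : 'I_(size Z)) := to_point D0 (nth None Z i).
have PE i : val (P i) = nth None Z i.
  by apply: val_to_point; apply: (allP onW); apply: mem_nth.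
have P_inj : injective P.
  by move=> i j /(congr1 val)/eqP; rewrite !PE nth_uniq // => /eqP/val_inj.
have := neron_energy_ge tam P_inj; rewrite card_ord => /(_ Z0).
congr (_ <= _ * _); apply: eq_bigr => i _; apply: eq_bigr => j _.
by rewrite /point_height val_pointD val_pointN !PE.
Qed.

End WeierstrassEnergy.

Lemma disc_map_wcoef (F K : fieldType) (f : {rmorphism F -> K}) (W : wcoef F) :
  disc (map_wcoef f W) = f (disc W).
Proof. by rewrite /disc /wb8 /wb6 /wb4 /wb2 /=; ring. Qed.

Theorem lemma3p1 (R : realType) (k : fieldExtType rat) (K : fieldType)
  (abs : K -> R) (iota : {rmorphism k -> K}) (p : nat) (E : wcoef k)
  (u r s t : K) (lam : K * K -> R) (cv : nat) (Z : seq (option (K * K))) :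
  prime p ->
  is_nonarch_abs abs ->
  abs p%:R = p%:R^-1 ->
  abs_complete abs ->
  abs_dense abs iota ->
  disc E != 0 ->
  is_minimal_change abs (map_wcoef iota E) u r s t ->
  is_neron_local_height abs (map_wcoef iota E) lam ->
  is_tamagawa abs (map_wcoef iota E) u r s t cv ->
  uniq Z ->
  all (on_curve (map_wcoef iota E)) Z ->
  (0 < size Z)%N ->
  Lambda (map_wcoef iota E) lam Z >=
    (cv%:R ^- 2 - (size Z)%:R^-1) *
    (12%:R^-1 * ln (abs ((disc (chg (map_wcoef iota E) u r s t))^-1))).
Proof.
move=> p_prime na absp cpl _ E_disc [u0 intW _] neron tam uZ onW Z0.
have natr_neq0 n : (0 < n)%N -> (n%:R : K) != 0.
  have char0 : [pchar K] =i pred0.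
    by move=> q; rewrite (fmorph_pchar iota) (pchar_lalg k) pchar_num.
  by rewrite (pcharf0P K).1 // -lt0n.
have nontrivial : exists2 a : K, a != 0 & abs a < 1.
  exists p%:R; first by rewrite natr_neq0 // prime_gt0.
  by rewrite absp invf_lt1 ?ltr1n ?ltr0n ?prime_gt0 ?prime_gt1.
have W_disc : disc (map_wcoef iota E) != 0 by rewrite disc_map_wcoef fmorph_eq0.
exact: (Lambda_ge (abs := NonarchAbs na) (natr_neq0 2%N isT) (natr_neq0 3%N isT) cpl
  nontrivial W_disc u0 intW neron tam uZ onW Z0).
Qed.
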